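(* Let $q\ge2$ be an integer, $T=T_q$ the homogeneous tree of degree $q+1$ with the canonical flow measure $\mu(x)=q^{\ell(x)}$, and $\mathcal L$ the flow Laplacian. Let $\varepsilon:T\to\mathbb C$ be bounded with $\sum_{y\in\mathfrak s(x)}\varepsilon(y)=0$ for all $x\in T$, let $\nabla_{\varepsilon}f(x)=\frac1q\sum_{y\in\mathfrak s(x)}\varepsilon(y)f(y)$, and let $\mathcal R_\varepsilon=\nabla_{\varepsilon}\mathcal L^{-1/2}$ be the associated horizontal Riesz transform. Then the adjoint operator $\mathcal R_\varepsilon^*$ (with respect to the $L^2(\mu)$ pairing) is of weak type $(1,1)$ on $(T,\mu)$; i.e. there is a constant $C<\infty$ such that $\mu(\{x\in T: |\mathcal R_\varepsilon^*f(x)|>\lambda\})\le C\lambda^{-1}\|f\|_{L^1(\mu)}$ for all $\lambda>0$ and all $f\in L^1(\mu)\cap L^2(\mu)$.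
   Context: $T=T_q$ ($q\ge2$ an integer) is the infinite tree in which every vertex has exactly $q+1$ neighbours, identified with its vertex set, with graph distance $d$. Fix a vertex $o$ and an infinite geodesic ray $\omega_*$ emanating from $o$. For $x\in T$ let $x\wedge\omega_*$ be the vertex of $\omega_*$ closest to $x$; the level of $x$ is $\ell(x)=d(o,x\wedge\omega_* )-d(x,x\wedge\omega_* )$. Each $x$ has a unique neighbour $\mathfrak p(x)$ (predecessor) with $\ell(\mathfrak p(x))=\ell(x)+1$; the other $q$ neighbours, of level $\ell(x)-1$, form the set $\mathfrak s(x)$ of successors. The measure $\mu$ on $T$ is $\mu(\{x\})=\mu(x)=q^{\ell(x)}$. The flow Laplacian is $\mathcal L f(x)=f(x)-\frac{1}{2\sqrt q}\sum_{y\sim x}\frac{\mu(y)^{1/2}}{\mu(x)^{1/2}}f(y)$, where $\sim$ denotes adjacency. It equals $\frac12\nabla^*\nabla$, where $\nabla f(x)=f(x)-f(\mathfrak p(x))$ and $\nabla^*$ is the $L^2(\mu)$-adjoint. It is bounded, nonnegative, self-adjoint and injective on $L^2(\mu)$; $\mathcal L^{-1/2}$ is the (unbounded) operator defined by the Spectral Theorem. Finitely supported functions belong to its domain. Since $\nabla_\varepsilon=\nabla_\varepsilon\nabla$, $\mathcal R_\varepsilon$ extends to a bounded operator on $L^2(\mu)$, and $\mathcal R_\varepsilon^*$ is its $L^2(\mu)$-adjoint, formally $\mathcal R_\varepsilon^*=\mathcal L^{-1/2}\nabla_\varepsilon^*$. *)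

(* Defs.v *)
From HB Require Import structures.
From mathcomp Require Import all_boot all_order all_algebra.
From mathcomp Require Import complex.
From mathcomp Require Import all_classical all_reals all_analysis.

Set Implicit Arguments.
Unset Strict Implicit.
Unset Printing Implicit Defensive.

Import Order.TTheory GRing.Theory Num.Theory numFieldNormedType.Exports.
Import HBSimple.

Local Open Scope classical_set_scope.
Local Open Scope ring_scope.
Local Open Scope complex_scope.
Local Open Scope card_scope.

Section Tree.
Variables (V : choiceType) (adj : rel V).

Definition walk (x y : V) (n : nat) : Prop :=
  exists p : seq V, [/\ path adj x p, last x p = y & size p = n].

(* 0 is a junk value, used only if x and y are not connected. *)
Definition gdist (x y : V) : nat :=
  if pselect (exists n, `[< walk x y n >]) is left h then ex_minn h else 0.

(* Infinite as soon as it has a vertex and q >= 1. *)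
Definition homogeneous_tree (q : nat) : Prop :=
  [/\ symmetric adj /\ irreflexive adj,
      forall x y, exists n, walk x y n,
      forall c : seq V, (2 < size c)%N -> uniq c -> ~~ cycle adj c &
      forall x, [set y | adj x y] #= `I_q.+1].

Definition geodesic_ray (omega : nat -> V) : Prop :=
  forall m n, (m <= n)%N -> gdist (omega m) (omega n) = (n - m)%N.

Variable omega : nat -> V.

(* x /\ omega; the default value of xget is never reached. *)
Definition confluent (x : V) : V :=
  xget (omega 0) [set v | range omega v /\
    forall u, range omega u -> (gdist x v <= gdist x u)%N].

(* The base vertex o is omega 0. *)
Definition level (x : V) : int :=
  (gdist (omega 0) (confluent x))%:Z - (gdist x (confluent x))%:Z.

Definition successors (x : V) : set V :=
  [set y | adj x y /\ level y = level x - 1].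

End Tree.

(* The spaces L^1(w), L^2(w) and the operators on them, for the measure with
   masses w x > 0 at the points of a discrete set V. Operators are total
   functions on V -> R[i]; only their values on L^2(w) matter. *)
Section Lebesgue.
Variables (R : realType) (V : choiceType) (w : V -> R).
Local Notation C := R[i].
Local Notation fct := (V -> C).

Definition wmeasure (A : set V) : \bar R := \esum_(x in A) (w x)%:E.

Definition norm1 (f : fct) : \bar R :=
  \esum_(x in [set: V]) (Normc.normc (f x) * w x)%:E.

Definition norm2sq (f : fct) : \bar R :=
  \esum_(x in [set: V]) (Normc.normc (f x) ^+ 2 * w x)%:E.

Definition L1 (f : fct) : Prop := (norm1 f < +oo)%E.
Definition L2 (f : fct) : Prop := (norm2sq f < +oo)%E.

(* Sums of absolutely summable families. *)
Definition rsum (u : V -> R) : R :=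
  fine (\esum_(x in [set: V]) (Num.max (u x) 0)%:E)
  - fine (\esum_(x in [set: V]) (Num.max (- u x) 0)%:E).

Definition csum (u : fct) : C :=
  rsum (fun x => complex.Re (u x)) +i* rsum (fun x => complex.Im (u x)).

Definition inner (f g : fct) : C := csum (fun x => f x * (g x)^* * (w x)%:C).

Definition bounded_operator (A : fct -> fct) : Prop :=
  (forall (a : C) (f g : fct), L2 f -> L2 g ->
     A (fun x => a * f x + g x) = (fun x => a * A f x + A g x)) /\
  exists M : R, forall f, L2 f -> (norm2sq (A f) <= (M ^+ 2)%:E * norm2sq f)%E.

Definition is_adjoint (A B : fct -> fct) : Prop :=
  (forall f, L2 f -> L2 (B f)) /\
  forall f g, L2 f -> L2 g -> inner (A f) g = inner f (B g).

Definition orthogonal_projection (P : fct -> fct) : Prop :=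
  [/\ bounded_operator P,
      forall f, L2 f -> P (P f) = P f &
      is_adjoint P P].

Definition opmeasure := set (measurableTypeR R) -> fct -> fct.

(* The measure <E(.) f, f>, as E(A) is an orthogonal projection. *)
Definition scalar_measure (E : opmeasure) (f : fct)
    (A : set (measurableTypeR R)) : \bar R := norm2sq (E A f).

Definition projection_valued_measure (E : opmeasure) : Prop :=
  [/\ forall A, measurable A -> orthogonal_projection (E A),
      forall f, L2 f -> E setT f = f,
      forall A B, measurable A -> measurable B ->
        forall f, L2 f -> E (A `&` B) f = E A (E B f) &
      forall f, L2 f -> semi_sigma_additive (scalar_measure E f)].

Definition simple_integral (E : opmeasure)
    (s : {sfun (measurableTypeR R) >-> R}) (f : fct) : fct :=
  fun x => \sum_(c \in range s) c%:C * E (s @^-1` [set c]) f x.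

(* (\int psi dE) f = g, the unbounded operator \int psi dE being seen as a
   graph: the map s |-> (\int s dE) f is isometric on the simple functions of
   L^2(R, <E(.) f, f>) and is extended to this space by density. In
   particular f is in the domain iff \int |psi|^2 d<E(.) f, f> is finite. *)
Definition spectral_integral (E : opmeasure) (psi : R -> R)
    (f g : fct) : Prop :=
  [/\ L2 f, L2 g &
  exists s : nat -> {sfun (measurableTypeR R) >-> R},
    (fun n => \int[scalar_measure E f]_(t in [set: measurableTypeR R])
       ((psi t - s n t) ^+ 2)%:E)%E @ \oo --> 0%E /\
    (fun n => norm2sq (fun x => simple_integral E (s n) f x - g x))
       @ \oo --> 0%E].

Definition spectral_resolution (A : fct -> fct) (E : opmeasure) : Prop :=
  projection_valued_measure E /\
  forall f, L2 f -> spectral_integral E id f (A f).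

(* A^(-1/2) f = g, for A with spectral resolution E. For A nonnegative and
   injective, E vanishes on ]-oo, 0], so that the values of powR on this
   half-line are irrelevant. *)
Definition inv_sqrt (E : opmeasure) (f g : fct) : Prop :=
  spectral_integral E (fun t => t `^ (- 2^-1)) f g.

End Lebesgue.

Section Flow.
Variables (R : realType) (q : nat) (V : choiceType) (adj : rel V).
Variable omega : nat -> V.
Local Notation C := R[i].
Local Notation fct := (V -> C).

Definition flow_measure (x : V) : R := q%:R ^ level adj omega x.

Local Notation mu := flow_measure.

Definition flow_laplacian (f : fct) : fct := fun x =>
  f x - ((2 * Num.sqrt q%:R)^-1)%:C *
    \sum_(y \in [set y | adj x y])
      (Num.sqrt (mu y) / Num.sqrt (mu x))%:C * f y.

Definition nabla_eps (eps f : fct) : fct := fun x =>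
  (q%:R^-1)%:C * \sum_(y \in successors adj omega x) eps y * f y.

(* Reps is the bounded extension of nabla_eps L^(-1/2), for E the spectral
   resolution of the flow Laplacian L. *)
Definition horizontal_riesz (eps : fct) (E : opmeasure R V)
    (Reps : fct -> fct) : Prop :=
  bounded_operator mu Reps /\
  forall f g, inv_sqrt mu E f g -> Reps f = nabla_eps eps g.

End Flow.

(* Main.v *)
Require Import Defs.
From HB Require Import structures.
From mathcomp Require Import all_boot all_order all_algebra.
From mathcomp Require Import complex.
From mathcomp Require Import all_classical all_reals all_analysis.
From mathcomp Require Import measurable_realfun.
From mathcomp Require Import finmap zify ring lra.

(** Let [p] be the predecessor map, [pull f = f \o p], [avg f x] the mean of [f]
    over the successors of [x], and [A = (pull + avg) / 2]. On the weighted space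
    [pull] is an isometry with [avg (pull f) = f], and the flow Laplacian is
    [1 - A]. The horizontal gradient is [f |-> avg (eps f)]; it kills the range of
    [pull], because [eps] has zero sum over each set of successors.

    Write [tower n f = avg (eps avg^n f)], so that [tower 0] is the horizontal
    gradient. From [avg \o pull = id] one gets the commutation relation
    [tower n (A f) = (tower (n - 1) f + tower (n + 1) f) / 2], with no first term
    for [n = 0] ([tower_avgop]): the powers of [A] perform on the depth [n] a
    simple random walk killed below 0. Hence a polynomial [P(A)] followed by the
    horizontal gradient is a combination of the towers, whose coefficients are
    the sums of the coefficients of [P] against ballot numbers ([tower_polyop]).
    For polynomials [P_j] that approach [(1 - x)^(-1/2)], the resulting weights
    [c_n] lie between 0 and [4 / (n + 1)], uniformly in [j]
    ([ballot_coef_bound], [newton_coef_le]).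

    The adjoint of such a combination is explicit: at [z] it is the sum over [n]
    of [c_n] times the conjugate of [eps (p^n z)] times [g (p^(n+1) z)]. Its terms
    are orthogonal, since [eps] has zero averages, and they remain orthogonal
    when [g] is replaced in the [n]-th term by a truncation of [g] that depends
    on [n]. Truncating [g] at the height [(n + 1) lambda] in the [n]-th term loses
    only a set of measure at most [norm1 g / lambda], because iterates of [p]
    preserve the measure; the remaining square norm is at most a constant
    times [lambda norm1 g], because [c_n] is of the size of [1 / n]. Chebyshev's
    inequality then gives the weak type estimate with a constant that does not
    depend on [j] ([cotower_weak_type]).

    It remains to let [j] tend to infinity. The approximations of the Riesz
    transform are uniformly bounded, as the squared norms of the towers telescope
    ([nrm_sum_tower]). They converge strongly on the vectors whose spectral
    support avoids 0, since the Newton approximants converge uniformly there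
    ([inv_sqrt_local]); those vectors are dense because [A] is a contraction
    without fixed vectors ([avgop_fixed], [inv_sqrt_dense]). Strong convergence,
    tested on point masses, becomes pointwise convergence of the adjoints
    ([adjoint_approx]), through which the weak type estimate passes
    ([adjoint_weak_type]). *)

Set Implicit Arguments.
Unset Strict Implicit.
Unset Printing Implicit Defensive.

Import HBSimple.
Import Order.TTheory GRing.Theory Num.Theory numFieldNormedType.Exports.

Local Open Scope classical_set_scope.
Local Open Scope ring_scope.
Local Open Scope complex_scope.

(** * The tree and its flow *)

Section TreeDistance.
Variables (V : choiceType) (adj : rel V).
Hypothesis adj_sym : symmetric adj.
Hypothesis adj_irr : irreflexive adj.
Hypothesis conn : forall x y, exists n, walk adj x y n.
Hypothesis acyclic :
  forall c : seq V, (2 < size c)%N -> uniq c -> ~~ cycle adj c.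

Local Notation d := (gdist adj).

Lemma gdist_walk x y : walk adj x y (d x y).
Proof.
rewrite /gdist; case: pselect => [h|]; last first.
  by case; case: (conn x y) => n w; exists n; apply/asboolP.
by case: ex_minnP => m /asboolP.
Qed.

Lemma gdist_min x y n : walk adj x y n -> (d x y <= n)%N.
Proof.
move=> w; rewrite /gdist; case: pselect => [h|//].
by case: ex_minnP => m _; apply; apply/asboolP.
Qed.

Lemma walk0 x y : walk adj x y 0 -> x = y.
Proof. by case=> -[|z p] [] //= _ ->. Qed.

Lemma walkS x y n :
  walk adj x y n.+1 <-> exists2 z, adj x z & walk adj z y n.
Proof.
split=> [[[|z p] [//=  /andP[xz zp] lp [sp]]]|[z xz [p [zp lp sp]]]].
  by exists z => //; exists p.
by exists (z :: p); split=> /=; rewrite ?xz ?sp.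
Qed.

Lemma gdist_eq0 x y : d x y = 0%N -> x = y.
Proof. by move=> dxy; have := gdist_walk x y; rewrite dxy => /walk0. Qed.

Lemma gdistxx x : d x x = 0%N.
Proof. by apply/eqP; rewrite -leqn0; apply: gdist_min; exists [::]. Qed.

Lemma gdist_adj_le r x y : adj x y -> (d x r <= (d y r).+1)%N.
Proof.
by move=> xy; apply: gdist_min; apply/walkS; exists y => //; apply: gdist_walk.
Qed.

Lemma gdist_sym x y : d x y = d y x.
Proof.
suff h a b : (d a b <= d b a)%N by apply/eqP; rewrite eqn_leq !h.
apply: gdist_min; case: (gdist_walk b a) => p [bp lp sp].
exists (rev (belast b p)); split.
- rewrite -lp rev_path; apply: sub_path bp => u v /=; by rewrite adj_sym.
- by case: p {bp sp} lp => [//|z p] /= _; rewrite rev_cons last_rcons.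
- by rewrite size_rev size_belast.
Qed.

Lemma closer_neighbour r x : d x r != 0%N ->
  exists2 y, adj x y & d x r = (d y r).+1.
Proof.
move=> dx0; have := gdist_walk x r; case E : (d x r) dx0 => [//|n] _.
case/walkS => y xy w; exists y => //; apply/eqP; rewrite eqn_leq.
by rewrite -{1}E gdist_adj_le //= ltnS gdist_min.
Qed.

Lemma path_in_ball r n y : (d y r <= n)%N -> exists p : seq V,
  [/\ path adj y p, last y p = r & all (fun v => d v r <= n)%N (y :: p)].
Proof.
elim: n y => [|n IH] y.
  rewrite leqn0 => /eqP dy; exists [::]; split=> //=; first exact: gdist_eq0.
  by rewrite dy.
move=> dyn; case: (eqVneq (d y r) 0%N) => [dy0|/closer_neighbour[z yz dz]].
  by exists [::]; split=> /=; rewrite ?dy0 //; apply: gdist_eq0.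
have [|p [zp lp ap]] := IH z; first by rewrite -ltnS -dz.
exists (z :: p); split=> //=; first by rewrite yz.
rewrite dyn /=; apply: sub_all ap => v /=; lia.
Qed.

Lemma uniq_path_in_ball r n y z : (d y r <= n)%N -> (d z r <= n)%N ->
  exists p : seq V, [/\ path adj y p, last y p = z, uniq (y :: p) &
    all (fun v => d v r <= n)%N (y :: p)].
Proof.
move=> /path_in_ball[p [yp lp ap]] /path_in_ball[p' [zp' lp' ap']].
have yz : path adj y (p ++ rev (belast z p')).
  rewrite cat_path yp lp -lp' rev_path /=.
  by apply: sub_path zp' => u v /=; rewrite adj_sym.
have lz : last y (p ++ rev (belast z p')) = z.
  case: p' {zp' ap' yz} lp' => [/=|u p'] lp'; first by rewrite cats0 lp.
  by rewrite last_cat /= rev_cons last_rcons.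
case/shortenP: yz lz => s ys us ss ls; exists s; split=> //.
apply/allP => v; rewrite inE => /orP[/eqP->|/ss].
  by move/andP: ap => [].
rewrite mem_cat mem_rev => /orP[vp|/mem_belast vp].
  by case/andP: ap => _ /allP; apply.
by move/allP: ap'; apply.
Qed.

(** A path between the two neighbours that stays closer to [r] than [x] closes
    up into a cycle through [x]. *)
Lemma closer_neighbour_uniq r x y z : adj x y -> adj x z ->
  d x r = (d y r).+1 -> d x r = (d z r).+1 -> y = z.
Proof.
move=> xy xz dy dz; apply/eqP; case: (eqVneq y z) => // yz.
have dyz : d z r = d y r by apply: succn_inj; rewrite -dy.
have [p [yp lp up ap]] := @uniq_path_in_ball r _ y z (leqnn _) (eq_leq dyz).
have : ~~ cycle adj (x :: y :: p).
  apply: acyclic; first by case: p lp {yp up ap} => //= yz'; rewrite yz' eqxx in yz.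
  rewrite cons_uniq up andbT; apply/negP => /(allP ap).
  by rewrite dy ltnn.
by rewrite (cycle_path x) /= xy yp lp adj_sym xz.
Qed.

(** Two adjacent vertices at the same distance from [r] would lie on a cycle that
    joins their neighbours closer to [r]. *)
Lemma gdist_adj_neq r x y : adj x y -> d x r <> d y r.
Proof.
move=> xy dxy.
have x0 : d x r != 0%N.
  apply/eqP => dx; have xE := gdist_eq0 dx; move: dxy; rewrite dx => /esym/gdist_eq0 yE.
  by move: xy; rewrite xE yE adj_irr.
have [x' xx' dx'] := closer_neighbour x0.
have [y' yy' dy'] : exists2 y', adj y y' & d y r = (d y' r).+1.
  by apply: closer_neighbour; rewrite -dxy.
have e : d y' r = d x' r by apply: succn_inj; rewrite -dx' -dy'.
have [p [xp lp up ap]] := @uniq_path_in_ball r _ x' y' (leqnn _) (eq_leq e).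
have : ~~ cycle adj (y :: x :: x' :: p).
  apply: acyclic => //; rewrite 2!cons_uniq up andbT inE negb_or.
  have [-> ->] : x \notin x' :: p /\ y \notin x' :: p.
    by split; apply/negP => /(allP ap); rewrite -?dxy dx' ltnn.
  by rewrite !andbT; apply/eqP => xyE; move: xy; rewrite xyE adj_irr.
by rewrite (cycle_path y) /= lp adj_sym yy' adj_sym xy xx' xp.
Qed.

Lemma gdist_adj r x y : adj x y ->
  d x r = (d y r).+1 \/ d y r = (d x r).+1.
Proof.
move=> xy; have := gdist_adj_le r xy.
have := @gdist_adj_le r y x; rewrite adj_sym xy => /(_ isT).
have := gdist_adj_neq (r := r) xy; lia.
Qed.

End TreeDistance.

Section Level.
Variables (V : choiceType) (adj : rel V) (omega : nat -> V).
Hypothesis adj_sym : symmetric adj.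
Hypothesis adj_irr : irreflexive adj.
Hypothesis conn : forall x y, exists n, walk adj x y n.
Hypothesis acyclic :
  forall c : seq V, (2 < size c)%N -> uniq c -> ~~ cycle adj c.
Hypothesis ray : geodesic_ray adj omega.

Local Notation d := (gdist adj).

Lemma ray_adj m : adj (omega m) (omega m.+1).
Proof.
have := gdist_walk conn (omega m) (omega m.+1).
by rewrite ray // subSnn => /walkS[z mz /walk0 <-].
Qed.

(** Otherwise the ray would return to [omega m], the only neighbour of
    [omega m.+1] closer to [x]. *)
Lemma ray_turn x m : d (omega m.+1) x = (d (omega m) x).+1 ->
  d (omega m.+2) x = (d (omega m.+1) x).+1.
Proof.
move=> up; have [h|//] := gdist_adj adj_sym adj_irr conn acyclic x (ray_adj m.+1).
have e : omega m = omega m.+2.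
  apply: (closer_neighbour_uniq adj_sym conn acyclic (r := x) (x := omega m.+1)) => //.
    by rewrite adj_sym ray_adj.
  exact: ray_adj.
by have := ray (leqW (leqnSn m)); rewrite -e gdistxx // -addn2 addKn.
Qed.

(** The turning point [k] is the first index after which the distance to [x]
    increases; it is the confluent of [x] and the ray. *)
Lemma ray_dist x : exists k, (forall m, (m <= k)%N ->
    d (omega m) x = (d (omega k) x + (k - m))%N) /\
  forall m, (k <= m)%N -> d (omega m) x = (d (omega k) x + (m - k))%N.
Proof.
have turn : exists k, d (omega k.+1) x == (d (omega k) x).+1.
  apply: contrapT => /forallNP no.
  have dec m : (d (omega m) x + m)%N = d (omega 0) x.
    elim: m => [|m <-]; first by rewrite addn0.
    have [->|h] := gdist_adj adj_sym adj_irr conn acyclic x (ray_adj m).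
      by rewrite addnS.
    by case: (no m); rewrite h.
  by have := dec (d (omega 0) x).+1; lia.
exists (ex_minn turn); case: ex_minnP => k /eqP up kmin; split=> m.
  elim: k {up} kmin m => [|k IH] kmin m; first by rewrite leqn0 => /eqP->; rewrite addn0.
  have down : d (omega k) x = (d (omega k.+1) x).+1.
    have [//|h] := gdist_adj adj_sym adj_irr conn acyclic x (ray_adj k).
    by have := kmin k; rewrite h eqxx ltnn => /(_ isT).
  rewrite leq_eqVlt => /orP[/eqP->|mk]; first by rewrite subnn addn0.
  rewrite IH //; first by rewrite down; lia.
  by move=> n /kmin; lia.
move=> /subnKC <-; rewrite addKn; suff [] : d (omega (k + (m - k))) x =
    (d (omega k) x + (m - k))%N /\ d (omega (k + (m - k)).+1) x =
    (d (omega (k + (m - k))) x).+1 by [].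
elim: (m - k)%N => [|j [IH up']]; first by rewrite !addn0.
by rewrite !addnS up' IH; split=> //; rewrite ray_turn // up' IH.
Qed.

(** The level is a Busemann function of the ray, so that levels are compared by
    comparing the distances to a single far point of the ray. *)
Lemma level_busemann x : exists k, forall m, (k <= m)%N ->
  level adj omega x = m%:Z - (d (omega m) x)%:Z.
Proof.
have [k [down up]] := ray_dist x; exists k => m km.
have conf : confluent adj omega x = omega k.
  rewrite /confluent; case: xgetP => [v -> [[j _ <-] jmin]|no].
    have := jmin (omega k) (imageT _ _); rewrite !(gdist_sym adj_sym conn x).
    case: (leqP j k) => [/[dup] jk /down ->|/[dup] jk /ltnW/up ->] h.
      by congr omega; lia.
    lia.
  case: (no (omega k)); split; first by exists k.
  move=> _ [j _ <-]; rewrite !(gdist_sym adj_sym conn x).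
  by case: (leqP j k) => [/down ->|/ltnW/up ->]; rewrite leq_addr.
rewrite /level conf up // ray // subn0 (gdist_sym adj_sym conn x); lia.
Qed.

Lemma level_adj x y : adj x y ->
  level adj omega y = level adj omega x + 1 \/
  level adj omega y = level adj omega x - 1.
Proof.
move=> xy; have [k lx] := level_busemann x; have [j ly] := level_busemann y.
rewrite (lx _ (leq_maxl k j)) (ly _ (leq_maxr k j)).
rewrite !(gdist_sym adj_sym conn (omega _)).
by have [->|->] :=
  gdist_adj adj_sym adj_irr conn acyclic (omega (maxn k j)) xy; lia.
Qed.

(** The neighbour in the direction of a far point of the ray remains in the
    direction of all the later ones. *)
Lemma predecessor_ex x :
  exists2 y, adj x y & level adj omega y = level adj omega x + 1.
Proof.
have [k lx] := level_busemann x.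
pose m := (maxn k (`|level adj omega x|).+1)%N.
have km : (k <= m)%N by rewrite leq_maxl.
have d0 : d x (omega m) != 0%N.
  apply/eqP => dx; have := lx _ km; rewrite gdist_sym // dx; lia.
have [y xy dy] := closer_neighbour conn d0.
exists y => //; have [//|h] := level_adj xy.
have [j ly] := level_busemann y.
have lt_m : (maxn m j <= m + j)%N by lia.
have [n nm] : {n | n = maxn m j} by exists (maxn m j).
have gen i : (m <= i)%N -> d x (omega i) = (d y (omega i)).+1.
  elim: i => [|i IH]; first by rewrite leqn0 => /eqP <-.
  rewrite leq_eqVlt => /orP[/eqP <- //|]; rewrite ltnS => mi.
  have lxi := lx i (leq_trans km mi); have lxi1 := lx i.+1 (leq_trans km (leqW mi)).
  have := IH mi; move: lxi lxi1; rewrite !(gdist_sym adj_sym conn (omega _)).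
  have hy := gdist_adj_le conn y (ray_adj i).
  have hx : adj (omega i.+1) (omega i) by rewrite adj_sym ray_adj.
  have := gdist_adj_le conn y hx.
  have := gdist_adj adj_sym adj_irr conn acyclic (omega i.+1) xy.
  move: hy; rewrite !(gdist_sym adj_sym conn (omega _)).
  move=> h1 h2 h3 h4 h5 h6; lia.
have := lx n; have := ly n; have := gen n.
rewrite !(gdist_sym adj_sym conn (omega _)) nm leq_maxl leq_maxr.
by move=> /(_ isT) -> /(_ isT) -> /(_ (leq_trans km (leq_maxl _ _))) ->; lia.
Qed.

(** Both neighbours are closer to a common far point of the ray. *)
Lemma predecessor_uniq x y z : adj x y -> adj x z ->
  level adj omega y = level adj omega x + 1 ->
  level adj omega z = level adj omega x + 1 -> y = z.
Proof.
move=> xy xz; have [i lx] := level_busemann x.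
have [j ly] := level_busemann y; have [k lz] := level_busemann z.
pose m := maxn i (maxn j k).
have [im jm km] : [/\ (i <= m)%N, (j <= m)%N & (k <= m)%N] by split; lia.
rewrite (lx _ im) (ly _ jm) (lz _ km) !(gdist_sym adj_sym conn (omega _)).
move=> hy hz; apply: (closer_neighbour_uniq adj_sym conn acyclic xy xz (r := omega m)); lia.
Qed.

End Level.

(** Only this structure of the flow is used afterwards: the predecessor map,
    whose fibres are the sets of successors, and the growth of the measure. *)
Lemma flow_structure (R : realType) (q : nat) (V : choiceType) (adj : rel V)
    (omega : nat -> V) : homogeneous_tree adj q -> geodesic_ray adj omega ->
  exists p : V -> V,
    [/\ forall x, [set y | adj x y] = p x |` successors adj omega x /\
           ~ successors adj omega x (p x),
        forall x, successors adj omega x = p @^-1` [set x],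
        forall x, finite_set (successors adj omega x) /\
          #|` fset_set (successors adj omega x)| = q &
        (0 < q)%N -> forall x, flow_measure R q adj omega (p x) =
          q%:R * flow_measure R q adj omega x].
Proof.
case=> -[sym irr conn acyc deg] ray.
have ex x : {y | adj x y & level adj omega y = level adj omega x + 1}.
  by apply: cid2; apply: (predecessor_ex sym irr conn acyc ray).
pose p x := s2val (ex x).
have xp x : adj x (p x) by rewrite /p; case: (ex x).
have lp x : level adj omega (p x) = level adj omega x + 1 by rewrite /p; case: (ex x).
have nbr x : [set y | adj x y] = p x |` successors adj omega x.
  apply/seteqP; split=> [y /= xy|y [->|[]]] //; last exact: xp.
  have [h|h] := level_adj sym irr conn acyc ray xy; last by right.
  by left; apply: (predecessor_uniq sym irr conn acyc ray xy (xp x) h (lp x)).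
have notin x : ~ successors adj omega x (p x) by case=> _; rewrite lp; lia.
exists p; split=> //.
- move=> x; apply/seteqP.
  split=> [y [xy ly]|y /= yx]; last first.
    by split; rewrite -yx ?lp ?addrK // sym.
  apply: (predecessor_uniq sym irr conn acyc ray (xp y) _ (lp y)).
    by rewrite sym.
  by rewrite ly subrK.
- move=> x; have dx := deg x; have finN : finite_set [set y | adj x y].
    by exists q.+1.
  have fins : finite_set (successors adj omega x).
    by apply: sub_finite_set finN => y [].
  split=> //; have := card_fset_set dx.
  have /negPf pS : p x \notin fset_set (successors adj omega x).
    by rewrite in_fset_set //; apply/negP => /set_mem/notin.
  by rewrite nbr fset_setU1 // cardfsU1 pS => -[].
- move=> q0 x; rewrite /flow_measure lp exprzDr; first by rewrite expr1z mulrC.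
  by rewrite unitfE pnatr_eq0 -lt0n.
Qed.

(** * Weighted square-summable functions *)

Section Esum.
Variables (R : realType) (T : choiceType).
Implicit Types (I : set T) (u : T -> R).

Lemma esumZ I (c : R) (a : T -> \bar R) : 0 <= c ->
  (forall x, I x -> (0 <= a x)%E) ->
  (\esum_(x in I) (c%:E * a x) = c%:E * \esum_(x in I) a x)%E.
Proof.
suff le k (b : T -> \bar R) : 0 <= k -> (forall x, I x -> (0 <= b x)%E) ->
    (\esum_(x in I) (k%:E * b x) <= k%:E * \esum_(x in I) b x)%E.
  move=> c0 a0; have [->|cn0] := eqVneq c 0.
    by rewrite mul0e esum1 // => x _; rewrite mul0e.
  apply/eqP; rewrite eq_le le //= muleC -lee_pdivlMr ?lt_def ?cn0 // muleC.
  apply: le_trans (le _ _ _ _); rewrite ?invr_ge0 //.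
    by apply: le_esum => x Ix; rewrite muleA -EFinM mulVf // mul1e.
  by move=> x Ix; rewrite mule_ge0 ?a0.
move=> k0 b0; apply: ge_ereal_sup => _ [X [finX XI] <-].
rewrite fsbig_finite //= big_seq -ge0_sume_distrr; last first.
  by move=> x; rewrite in_fset_set // => /set_mem /XI /b0.
rewrite -big_seq -fsbig_finite //=; apply: lee_wpmul2l => //.
by apply: ereal_sup_ubound; exists X.
Qed.

Lemma esum_ltoo I u v : (forall x, I x -> 0 <= u x <= v x) ->
  (\esum_(x in I) (v x)%:E < +oo)%E -> (\esum_(x in I) (u x)%:E < +oo)%E.
Proof.
move=> uv; apply: le_lt_trans; apply: le_esum => x Ix.
by rewrite lee_fin; case/andP: (uv x Ix).
Qed.

Lemma esum_ge1 (a : T -> \bar R) x : (forall y, (0 <= a y)%E) ->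
  (a x <= \esum_(y in [set: T]) a y)%E.
Proof.
move=> a0; apply: esum_ge; exists [set x]; last by rewrite fsbig_set1.
by split=> //; exact: finite_set1.
Qed.

Lemma esum_fibre (p : T -> T) (a : T -> \bar R) : (forall x, (0 <= a x)%E) ->
  (\esum_(z in [set: T]) a z =
   \esum_(x in [set: T]) \esum_(z in p @^-1` [set x]) a z)%E.
Proof.
move=> a0; rewrite esum_esum //; apply/esym.
apply: (reindex_esum _ _ (fun z => (p z, z))).
split=> [z _ //|z z' _ _ []//|[x z] /= [_ <-]]; by exists z.
Qed.

End Esum.

Section NormC.
Variable R : realType.
Implicit Types z : R[i].
Local Notation normc := Normc.normc.

Lemma normc_ge0 z : 0 <= normc z.
Proof. by case: z => a b; rewrite /= sqrtr_ge0. Qed.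

Lemma normc_sq z : normc z ^+ 2 = complex.Re z ^+ 2 + complex.Im z ^+ 2.
Proof. by case: z => a b; rewrite /= sqr_sqrtr // addr_ge0 // sqr_ge0. Qed.

Lemma normc_real (a : R) : normc a%:C = `|a|.
Proof. by rewrite /= expr0n /= addr0 sqrtr_sqr. Qed.

Lemma normc_conj z : normc z^* = normc z.
Proof. by case: z => a b /=; rewrite sqrrN. Qed.

Lemma normc_triangle z z' : normc (z + z') <= normc z + normc z'.
Proof. by have := le_normcD z z'. Qed.

Lemma normc_Re z : `|complex.Re z| <= normc z.
Proof.
rewrite -(ler_pXn2r (n := 2)) ?nnegrE ?normc_ge0 // normc_sq real_normK ?num_real //.
by rewrite lerDl sqr_ge0.
Qed.

Lemma normc_Im z : `|complex.Im z| <= normc z.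
Proof.
rewrite -(ler_pXn2r (n := 2)) ?nnegrE ?normc_ge0 // normc_sq real_normK ?num_real //.
by rewrite lerDr sqr_ge0.
Qed.

Lemma normc_sqD (k : R) z z' : 0 < k ->
  normc (z + z') ^+ 2 <= (1 + k) * normc z ^+ 2 + (1 + k^-1) * normc z' ^+ 2.
Proof.
move=> k0; rewrite !normc_sq; case: z z' => [a b] [c d] /=.
have key (u v : R) : (u + v) ^+ 2 <= (1 + k) * u ^+ 2 + (1 + k^-1) * v ^+ 2.
  have : 0 <= k * (u - k^-1 * v) ^+ 2 by rewrite mulr_ge0 ?sqr_ge0 ?ltW.
  have kk : k * k^-1 = 1 by rewrite divff ?gt_eqF.
  set j := k^-1 in kk *.
  have -> : k * (u - j * v) ^+ 2 =
      k * u ^+ 2 - (k * j) * (2 * (u * v)) + (k * j) * (j * v ^+ 2) by ring.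
  by rewrite kk sqrrD; lra.
have := key a c; have := key b d; lra.
Qed.

End NormC.

Section Norm2.
Variables (R : realType) (V : choiceType) (w : V -> R).
Hypothesis w_gt0 : forall x, 0 < w x.
Local Notation normc := Normc.normc.
Local Notation C := R[i].
Local Notation fct := (V -> C).
Implicit Types f g h : fct.
Local Notation N2 := (norm2sq w).
Local Notation L2 := (L2 w).

Let w_ge0 x : 0 <= w x. Proof. exact: ltW. Qed.

Definition nrm f : R := Num.sqrt (fine (N2 f)).

Lemma mass_ge0 f x : (0 <= (normc (f x) ^+ 2 * w x)%:E)%E.
Proof. by rewrite lee_fin mulr_ge0 ?sqr_ge0. Qed.

Lemma norm2sq_ge0 f : (0 <= N2 f)%E.
Proof. by apply: esum_ge0 => x _; exact: mass_ge0. Qed.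

Lemma norm2sqE f : L2 f -> N2 f = (nrm f ^+ 2)%:E.
Proof.
move=> fL; rewrite /nrm sqr_sqrtr ?fine_ge0 ?norm2sq_ge0 // fineK //.
by rewrite ge0_fin_numE ?norm2sq_ge0.
Qed.

Lemma nrm_ge0 f : 0 <= nrm f. Proof. exact: sqrtr_ge0. Qed.

Lemma le_norm2sq f g : (forall x, normc (f x) <= normc (g x)) ->
  (N2 f <= N2 g)%E.
Proof.
move=> fg; apply: le_esum => x _; rewrite lee_fin ler_wpM2r //.
by rewrite lerXn2r ?nnegrE ?normc_ge0.
Qed.

Lemma norm2sqZ (a : C) f : N2 (fun x => a * f x) = ((normc a ^+ 2)%:E * N2 f)%E.
Proof.
rewrite /norm2sq -esumZ ?sqr_ge0 //.
  2: by move=> x _; exact: (mass_ge0 f).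
by apply: eq_esum => x _; rewrite Normc.normcM exprMn -EFinM -[in LHS]mulrA.
Qed.

Lemma norm2sqD (k : R) f g : 0 < k ->
  (N2 (f + g)%R <= (1 + k)%:E * N2 f + (1 + k^-1)%:E * N2 g)%E.
Proof.
move=> k0; have [k1 k2] : 0 <= 1 + k /\ 0 <= 1 + k^-1.
  by rewrite !addr_ge0 ?invr_ge0 ?ltW.
rewrite /norm2sq -!esumZ //; try (by move=> x _; exact: (mass_ge0 _)).
rewrite -esumD; try (by move=> x _; rewrite mule_ge0 ?mass_ge0).
apply: le_esum => x _; rewrite -!EFinM -EFinD lee_fin.
apply: le_trans (ler_wpM2r (w_ge0 x) (normc_sqD (f x) (g x) k0)) _.
rewrite [leLHS](_ : _ = (1 + k) * (normc (f x) ^+ 2 * w x) +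
  (1 + k^-1) * (normc (g x) ^+ 2 * w x)) //; ring.
Qed.

Lemma L2D f g : L2 f -> L2 g -> L2 (f + g).
Proof.
move=> fL gL; apply: le_lt_trans (norm2sqD f g ltr01) _.
by rewrite lte_add_pinfty // !norm2sqE // -EFinM ltry.
Qed.

Lemma L2Z (a : C) f : L2 f -> L2 (fun x => a * f x).
Proof. by move=> fL; rewrite /Defs.L2 norm2sqZ norm2sqE // -EFinM ltry. Qed.

Lemma fctZN1 f : (fun x => (-1) * f x) = - f.
Proof. by apply/funext => x; rewrite mulN1r. Qed.

Lemma L2N f : L2 f -> L2 (- f).
Proof. by rewrite -fctZN1; exact: L2Z. Qed.

Lemma L2B f g : L2 f -> L2 g -> L2 (f - g).
Proof. by move=> fL gL; apply: L2D => //; exact: L2N. Qed.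

Lemma norm2sq0 : N2 0 = 0%E.
Proof. by apply: esum1 => x _; rewrite Normc.normc0 expr0n mul0r. Qed.

Lemma L20 : L2 0. Proof. by rewrite /Defs.L2 norm2sq0. Qed.

Lemma L2_sum (I : Type) (r : seq I) (F : I -> fct) :
  (forall i, L2 (F i)) -> L2 (\sum_(i <- r) F i).
Proof. by move=> FL; apply: (big_ind L2) => //; [exact: L20|exact: L2D]. Qed.

Lemma nrmP (f : fct) (K : R) : 0 <= K -> (N2 f <= (K ^+ 2)%:E)%E ->
  L2 f /\ nrm f <= K.
Proof.
move=> K0 fK; have fL : L2 f by exact: le_lt_trans fK (ltry _).
by split=> //; move: fK; rewrite norm2sqE // lee_fin ler_pXn2r ?nnegrE ?nrm_ge0.
Qed.

Lemma nrmZ (a : C) f : L2 f -> nrm (fun x => a * f x) = normc a * nrm f.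
Proof.
move=> fL; apply/eqP; rewrite -(eqrXn2 (n := 2)) ?mulr_ge0 ?nrm_ge0 ?normc_ge0 //.
apply/eqP; have := norm2sqZ a f.
by rewrite (norm2sqE fL) (norm2sqE (L2Z a fL)) -EFinM exprMn => -[].
Qed.

Lemma norm2sqN f : N2 (- f) = N2 f.
Proof. by apply: eq_esum => x _; rewrite normcN. Qed.

Lemma nrmN f : nrm (- f) = nrm f. Proof. by rewrite /nrm norm2sqN. Qed.

Lemma nrm_eq0 f : L2 f -> nrm f = 0 -> f = 0.
Proof.
move=> fL f0; apply/funext => x; apply: Normc.eq0_normc; apply/eqP.
have := esum_ge1 x (mass_ge0 f); rewrite -/(N2 f) norm2sqE // f0 lee_fin expr0n /=.
by rewrite pmulr_lle0 // exprn_even_le0.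
Qed.

(** The best parameter in [norm2sqD] is the ratio of the two norms. *)
Lemma nrm_triangle f g : L2 f -> L2 g -> nrm (f + g) <= nrm f + nrm g.
Proof.
move=> fL gL; have fgL := L2D fL gL.
have le k : 0 < k -> nrm (f + g) ^+ 2 <=
    (1 + k) * nrm f ^+ 2 + (1 + k^-1) * nrm g ^+ 2.
  move=> k0; have := norm2sqD f g k0.
  by rewrite (norm2sqE fgL) (norm2sqE fL) (norm2sqE gL) -!EFinM -EFinD lee_fin.
have [f0|f0] := eqVneq (nrm f) 0; first by rewrite (nrm_eq0 fL f0) add0r lerDr nrm_ge0.
have [g0|g0] := eqVneq (nrm g) 0; first by rewrite (nrm_eq0 gL g0) addr0 lerDl nrm_ge0.
have fp : 0 < nrm f by rewrite lt_def f0 nrm_ge0.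
have gp : 0 < nrm g by rewrite lt_def g0 nrm_ge0.
rewrite -(ler_pXn2r (n := 2)) ?nnegrE ?addr_ge0 ?nrm_ge0 //.
have := le (nrm g / nrm f) (divr_gt0 gp fp); congr (_ <= _).
by field; rewrite f0 g0.
Qed.

Lemma nrmBC f g : nrm (f - g) = nrm (g - f).
Proof. by rewrite -nrmN opprB. Qed.

Lemma nrm_dist f g h : L2 f -> L2 g -> L2 h ->
  nrm (f - h) <= nrm (f - g) + nrm (g - h).
Proof.
by move=> fL gL hL; have := nrm_triangle (L2B fL gL) (L2B gL hL); rewrite addrA subrK.
Qed.

Lemma nrm0 : nrm 0 = 0. Proof. by rewrite /nrm norm2sq0 sqrtr0. Qed.

Lemma nrm_sum (I : Type) (r : seq I) (F : I -> fct) : (forall i, L2 (F i)) ->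
  nrm (\sum_(i <- r) F i) <= \sum_(i <- r) nrm (F i).
Proof.
move=> FL; elim: r => [|i r IH]; first by rewrite !big_nil nrm0.
rewrite !big_cons; apply: le_trans (nrm_triangle _ _) _ => //; first exact: L2_sum.
by rewrite lerD2l.
Qed.

Lemma nrm_pointwise f x : L2 f -> normc (f x) ^+ 2 * w x <= nrm f ^+ 2.
Proof. by move=> fL; rewrite -lee_fin -norm2sqE //; exact: (esum_ge1 x (mass_ge0 f)). Qed.

(** A Fatou lemma: bounds on finite sums pass to pointwise limits. *)
Lemma norm2sq_lim (F : nat -> fct) f (K : R) :
  (forall x, (fun n => normc (F n x)) @ \oo --> normc (f x)) ->
  (\forall n \near \oo, (N2 (F n) <= K%:E)%E) -> (N2 f <= K%:E)%E.
Proof.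
move=> Ff FK; apply: ge_ereal_sup => _ [X [finX _] <-].
rewrite fsbig_finite //= sumEFin lee_fin.
have cv : (fun n => \sum_(x <- fset_set X) normc (F n x) ^+ 2 * w x) @ \oo -->
    \sum_(x <- fset_set X) normc (f x) ^+ 2 * w x.
  elim: (enum_fset _) => [|x s IH].
    by under eq_fun do rewrite big_nil; rewrite big_nil; exact: cvg_cst.
  under eq_fun do rewrite big_cons; rewrite big_cons; apply: cvgD => //.
  by apply: cvgMr_tmp; under eq_fun do rewrite expr2; apply: cvgM; exact: Ff.
rewrite -(cvg_lim _ cv) //; apply: limr_le; first by apply/cvg_ex; eexists; exact: cv.
near=> n; rewrite -lee_fin -sumEFin; apply: le_trans (_ : N2 (F n) <= _)%E; last by near: n.
by apply: ereal_sup_ubound; exists X => //; rewrite fsbig_finite.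
Unshelve. all: by end_near.
Qed.

Lemma cvg_normc (u : nat -> C) (z : C) :
  (fun n => complex.Re (u n)) @ \oo --> complex.Re z ->
  (fun n => complex.Im (u n)) @ \oo --> complex.Im z ->
  (fun n => normc (u n)) @ \oo --> normc z.
Proof.
move=> reu imu; have nE (y : C) :
    normc y = Num.sqrt (complex.Re y * complex.Re y + complex.Im y * complex.Im y).
  by case: y => a b /=; rewrite !expr2.
rewrite nE; under eq_fun do rewrite nE.
apply: (cvg_comp _ Num.sqrt); last exact: sqrt_continuous.
by apply: cvgD; apply: cvgM.
Qed.

(** The sequence converges pointwise, as point evaluations are bounded, and
    [norm2sq_lim] carries the Cauchy estimate over to the pointwise limit. *)
Lemma L2_complete (F : nat -> fct) (r : nat -> R) : (forall j, L2 (F j)) ->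
  r @ \oo --> 0 -> (forall i j, nrm (F i - F j) <= r i + r j) ->
  exists2 g, L2 g & forall j, nrm (F j - g) <= r j.
Proof.
move=> FL r0 Fr; have dL i j : L2 (F i - F j) by exact: L2B.
have rge0 j : 0 <= r j by have := Fr j j; rewrite subrr nrm0; lra.
have pt i j x : normc (F i x - F j x) <= (r i + r j) / Num.sqrt (w x).
  have s0 : 0 < Num.sqrt (w x) by rewrite sqrtr_gt0.
  rewrite ler_pdivlMr // -(ler_pXn2r (n := 2)) ?nnegrE ?mulr_ge0 ?normc_ge0 ?addr_ge0 ?(ltW s0) //.
  rewrite exprMn sqr_sqrtr //; apply: le_trans (nrm_pointwise x (dL i j)) _.
  by rewrite lerXn2r ?nnegrE ?nrm_ge0 ?addr_ge0.
have conv (phi : C -> R) (x : V) :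
    (forall y z, `|phi y - phi z| <= normc (y - z)) -> cvg ((fun n => phi (F n x)) @ \oo).
  move=> lip; apply/cauchy_cvgP/cauchy_exP => e e0.
  have s0 : 0 < Num.sqrt (w x) by rewrite sqrtr_gt0.
  have e2 : 0 < e * Num.sqrt (w x) / 3 by rewrite divr_gt0 ?mulr_gt0.
  have /cvgr0_norm_le/(_ _ e2) [N _ rN] := r0.
  exists (phi (F N x)); exists N => // n /= Nn; rewrite /ball /=.
  apply: le_lt_trans (lip _ _) _; apply: le_lt_trans (pt _ _ _) _.
  rewrite ltr_pdivrMr //; have := rN N (leqnn N); have := rN n Nn.
  by rewrite /= !ger0_norm //; set y := e * _ in e2 *; clearbody y; lra.
have reC x : cvg ((fun n => complex.Re (F n x)) @ \oo).
  by apply: conv => y z; rewrite -raddfB normc_Re.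
have imC x : cvg ((fun n => complex.Im (F n x)) @ \oo).
  by apply: conv => y z; rewrite -raddfB normc_Im.
pose g x := limn (fun n => complex.Re (F n x)) +i* limn (fun n => complex.Im (F n x)).
have bound j : L2 (F j - g) /\ nrm (F j - g) <= r j.
  have small e : 0 < e -> (N2 (F j - g)%R <= ((r j + e) ^+ 2)%:E)%E.
    move=> e0; apply: (norm2sq_lim (F := fun n => F j - F n)) => [x|].
      apply: cvg_normc => /=; rewrite !fctE.
        rewrite raddfB; under eq_fun do rewrite fctE raddfB.
        by apply: cvgB; [exact: cvg_cst|exact: reC].
      rewrite raddfB; under eq_fun do rewrite fctE raddfB.
      by apply: cvgB; [exact: cvg_cst|exact: imC].
    have /cvgr0_norm_le/(_ e e0) := r0; apply: filterS => n rn.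
    rewrite norm2sqE // lee_fin lerXn2r ?nnegrE ?nrm_ge0 ?addr_ge0 ?(ltW e0) //.
    by apply: le_trans (Fr j n) _; rewrite lerD2l; move: rn; rewrite ger0_norm.
  have re e : 0 < e -> 0 <= r j + e by move=> e0; rewrite addr_ge0 // ltW.
  split; first exact: (nrmP (re 1 ltr01) (small 1 ltr01)).1.
  by apply/ler_addgt0Pr => e e0; exact: (nrmP (re e e0) (small e e0)).2.
exists g.
  have -> : g = F 0%N - (F 0%N - g) by rewrite opprB addrC subrK.
  apply: L2B => //; exact: (bound 0%N).1.
by move=> j; exact: (bound j).2.
Qed.

Definition polyop (A : fct -> fct) (P : {poly R}) f : fct :=
  \sum_(k < size P) (fun x => (P`_k)%:C * iter k A f x).

End Norm2.

(** * Averaging along the flow *)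

Section Flow.
Variables (R : realType) (V : choiceType) (q : nat) (p : V -> V) (w : V -> R).
Hypothesis q_gt0 : (0 < q)%N.
Hypothesis w_gt0 : forall x, 0 < w x.
Hypothesis w_pred : forall x, w (p x) = q%:R * w x.
Hypothesis fibreP : forall x,
  finite_set (p @^-1` [set x]) /\ #|` fset_set (p @^-1` [set x])| = q.
Local Notation normc := Normc.normc.
Local Notation C := R[i].
Local Notation fct := (V -> C).
Implicit Types f g h u : fct.
Local Notation N2 := (norm2sq w).
Local Notation L2 := (L2 w).
Local Notation nrm := (nrm w).

Let w_ge0 x : 0 <= w x. Proof. exact: ltW. Qed.
Let qR_gt0 : 0 < q%:R :> R. Proof. by rewrite ltr0n. Qed.
Let qR_neq0 : q%:R != 0 :> R. Proof. by rewrite gt_eqF. Qed.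

Lemma w_iter n x : w (iter n p x) = q%:R ^+ n * w x.
Proof. by elim: n => [|n IH] /=; rewrite ?mul1r // w_pred IH exprS mulrA. Qed.

Definition pull f : fct := fun x => f (p x).
Definition avg f : fct := fun x =>
  (q%:R^-1)%:C * \sum_(y \in p @^-1` [set x]) f y.

Lemma in_fibre x y : (y \in fset_set (p @^-1` [set x])) = (p y == x).
Proof.
have [fin _] := fibreP x; rewrite in_fset_set //.
by apply/idP/eqP => [/set_mem//|yx]; apply/mem_set.
Qed.

Lemma fibre_sum (U : nmodType) (F : V -> U) x :
  \sum_(y \in p @^-1` [set x]) F y = \sum_(y <- fset_set (p @^-1` [set x])) F y.
Proof. by rewrite fsbig_finite //; case: (fibreP x). Qed.

Lemma avgE f x :
  avg f x = (q%:R^-1)%:C * \sum_(y <- fset_set (p @^-1` [set x])) f y.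
Proof. by rewrite /avg fibre_sum. Qed.

Lemma avg_mul_pull g u x : avg (fun y => g y * u (p y)) x = avg g x * u x.
Proof.
rewrite !avgE -mulrA; congr (_ * _); rewrite big_distrl /=.
by apply: eq_big_seq => y; rewrite in_fibre => /eqP ->.
Qed.

Lemma avg1 x : avg (fun=> 1) x = 1.
Proof.
rewrite avgE big_const_seq count_predT iter_addr_0.
have [_ ->] := fibreP x.
by rewrite -(rmorph_nat (real_complex R)) -rmorphM mulVf.
Qed.

Lemma avg_pull u : avg (pull u) = u.
Proof.
apply/funext => x; rewrite -[RHS]mul1r -(avg1 x) -avg_mul_pull.
by congr avg; apply/funext => y; rewrite mul1r.
Qed.

Lemma avgD f g : avg (f + g) = avg f + avg g.
Proof.
by apply/funext => x; rewrite !fctE !avgE -mulrDr -big_split.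
Qed.

Lemma avgZ (a : C) f : avg (fun x => a * f x) = (fun x => a * avg f x).
Proof.
by apply/funext => x; rewrite !avgE -big_distrr /= mulrCA.
Qed.

Lemma avgB f g : avg (f - g) = avg f - avg g.
Proof. by rewrite avgD -!fctZN1 avgZ. Qed.

(** The mass of a point is split evenly among its successors, so that the value
    of a function may be replaced by its mean over each fibre. *)
Lemma esum_avg (F : V -> R) : (forall x, 0 <= F x) ->
  \esum_(z in [set: V]) (F z * w z)%:E =
  \esum_(x in [set: V])
    ((q%:R^-1 * \sum_(z <- fset_set (p @^-1` [set x])) F z) * w x)%:E.
Proof.
move=> F0; rewrite (esum_fibre p); last by move=> z; rewrite lee_fin mulr_ge0.
apply: eq_esum => x _; have [fin _] := fibreP x.
rewrite esum_fset // ?fibre_sum //; last by move=> i _; rewrite lee_fin mulr_ge0.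
rewrite sumEFin; congr (_%:E); rewrite mulrAC big_distrr /=.
apply: eq_big_seq => y; rewrite in_fibre => /eqP <-; rewrite w_pred.
by field.
Qed.

Lemma esum_pull (F : V -> R) : (forall x, 0 <= F x) ->
  \esum_(z in [set: V]) (F (p z) * w z)%:E = \esum_(x in [set: V]) (F x * w x)%:E.
Proof.
move=> F0; rewrite esum_avg; last by move=> x; exact: F0.
apply: eq_esum => x _; congr (_%:E); congr (_ * _).
rewrite (eq_big_seq (fun=> F x)); last by move=> y; rewrite in_fibre => /eqP ->.
rewrite big_const_seq count_predT iter_addr_0; have [_ ->] := fibreP x.
by rewrite -[F x *+ q]mulr_natl mulrA mulVf // mul1r.
Qed.

Lemma esum_iter_pull n (F : V -> R) : (forall x, 0 <= F x) ->
  \esum_(z in [set: V]) (F (iter n p z) * w z)%:E =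
  \esum_(x in [set: V]) (F x * w x)%:E.
Proof.
move=> F0; elim: n => //= n IH; rewrite -IH.
by rewrite -(esum_pull (F := fun z => F (iter n p z))) //;
   apply: eq_esum => x _; rewrite -iterS iterSr.
Qed.

(** On each fibre the cross term is a constant times the sum of [f], which
    vanishes. *)
Lemma pythagoras f u : avg f = 0 -> N2 (f + pull u) = (N2 f + N2 u)%E.
Proof.
move=> f0; rewrite -[N2 u]esum_pull; last by move=> x; exact: sqr_ge0.
rewrite -esumD; try (by move=> x _; rewrite lee_fin mulr_ge0 ?sqr_ge0).
rewrite {1}/norm2sq esum_avg; last by move=> x; exact: sqr_ge0.
under [in RHS]eq_esum => x _ do rewrite -EFinD -mulrDl.
rewrite [RHS]esum_avg; last by move=> x; rewrite addr_ge0 ?sqr_ge0.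
apply: eq_esum => x _; congr (_%:E); congr (_ * _ * _).
have := congr1 (fun h => h x) f0; rewrite avgE => /eqP.
rewrite mulf_eq0 fmorph_eq0 invr_eq0 (negPf qR_neq0) /= => /eqP sum0.
rewrite (eq_big_seq (fun z => (normc (f z) ^+ 2 + normc (u (p z)) ^+ 2) +
    2 * (complex.Re (f z) * complex.Re (u x) + complex.Im (f z) * complex.Im (u x))));
  last first.
  move=> z; rewrite in_fibre => /eqP <-; rewrite !normc_sq fctE /pull.
  by case: (f z) (u (p z)) => [a b] [c d] /=; ring.
rewrite [LHS]big_split /= -[RHS]addr0; congr (_ + _).
rewrite -big_distrr /= big_split /= -!big_distrl /=.
by rewrite -!raddf_sum sum0 !raddf0 !mul0r addr0 mulr0.
Qed.

Definition hor f := f - pull (avg f).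

Lemma norm2sq_split f : N2 f = (N2 (hor f) + N2 (avg f))%E.
Proof.
rewrite -{1}(subrK (pull (avg f)) f) pythagoras //.
by rewrite avgB avg_pull subrr.
Qed.

Lemma norm2sq_pull u : N2 (pull u) = N2 u.
Proof.
have avg0 : avg 0 = 0 by apply/funext => x; rewrite avgE big1 ?mulr0.
by rewrite -[pull u]add0r pythagoras // norm2sq0 add0e.
Qed.

Lemma norm2sq_avg f : (N2 (avg f) <= N2 f)%E.
Proof. by rewrite [leRHS]norm2sq_split leeDr // norm2sq_ge0. Qed.

Lemma L2_pull f : L2 f -> L2 (pull f).
Proof. by rewrite /Defs.L2 norm2sq_pull. Qed.

Lemma L2_avg f : L2 f -> L2 (avg f).
Proof. by apply: le_lt_trans; exact: norm2sq_avg. Qed.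

Lemma L2_iter_avg n f : L2 f -> L2 (iter n avg f).
Proof. by move=> fL; elim: n => //= n; exact: L2_avg. Qed.

Lemma nrm_pull f : nrm (pull f) = nrm f.
Proof. by rewrite /nrm norm2sq_pull. Qed.

Lemma nrm_avg f : L2 f -> nrm (avg f) <= nrm f.
Proof.
by move=> fL; apply: (nrmP w_gt0 _ _).2; rewrite ?nrm_ge0 // -norm2sqE // norm2sq_avg.
Qed.

Definition halve f : fct := fun x => (2^-1)%:C * f x.

Lemma halveD f g : halve (f + g) = halve f + halve g.
Proof. by apply/funext => x; rewrite !fctE /halve mulrDr. Qed.

Lemma halveDD f : halve (f + f) = f.
Proof.
apply/funext => x; rewrite /halve !fctE mulrDr -mulrDl -rmorphD.
by rewrite (_ : _ + _ = 1) ?mul1r //; field.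
Qed.

Lemma nrm_halve f : L2 f -> nrm (halve f) = 2^-1 * nrm f.
Proof. by move=> fL; rewrite nrmZ // normc_real ger0_norm // invr_ge0. Qed.

(** The averaging part of the flow Laplacian, which is [1 - avgop]. *)
Definition avgop f := halve (pull f + avg f).

Lemma L2_avgop f : L2 f -> L2 (avgop f).
Proof. by move=> fL; apply/L2Z/L2D => //; [exact: L2_pull|exact: L2_avg]. Qed.

Lemma nrm_avgop f : L2 f -> nrm (avgop f) <= nrm f.
Proof.
move=> fL; have lL := L2_pull fL; have aL := L2_avg fL.
rewrite nrm_halve; last exact: L2D.
have := nrm_triangle w_gt0 lL aL; rewrite nrm_pull.
have := nrm_avg fL; lra.
Qed.

Lemma avgopD f g : avgop (f + g) = avgop f + avgop g.
Proof. by rewrite /avgop avgD -halveD addrACA. Qed.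

(** As [pull f] and [avg f] have norm at most that of [f], their mean, the
    parallelogram law makes them equal. So [f] is constant along the iterates of
    [p], along which the mass grows geometrically. *)
Lemma avgop_fixed f : (2 <= q)%N -> L2 f -> avgop f = f -> f = 0.
Proof.
move=> q2 fL fix_f; have lL := L2_pull fL; have aL := L2_avg fL.
have sumE : pull f + avg f = f + f by rewrite -[in RHS]fix_f -halveD halveDD.
have par : N2 (pull f - avg f) = 0%E.
  have : (N2 (f + f)%R + N2 (pull f - avg f)%R =
      2%:E * N2 (pull f) + 2%:E * N2 (avg f))%E.
    rewrite -sumE -(esumZ (ler0n _ 2)); last by move=> x _; exact: mass_ge0.
    rewrite -(esumZ (ler0n _ 2)); last by move=> x _; exact: mass_ge0.
    rewrite -!esumD; try (by move=> x _; rewrite ?mule_ge0 ?mass_ge0).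
    apply: eq_esum => x _; rewrite -!EFinM -!EFinD; congr (_%:E).
    rewrite !normc_sq !fctE; case: (pull f x) (avg f x) => [a b] [c d] /=; ring.
  have ffL := L2D w_gt0 fL fL; have dL := L2B w_gt0 lL aL.
  rewrite (norm2sqE w_gt0 ffL) (norm2sqE w_gt0 dL) (norm2sqE w_gt0 lL).
  rewrite (norm2sqE w_gt0 aL) -!EFinM -!EFinD => -[].
  have -> : nrm (f + f) = 2 * nrm f.
    by rewrite -[in RHS](halveDD f) nrm_halve ?L2D // mulrA divff ?mul1r ?pnatr_eq0.
  rewrite nrm_pull => h; congr (_%:E); apply/le_anti; rewrite sqr_ge0 andbT.
  have := nrm_avg fL; rewrite -(ler_pXn2r (n := 2)) ?nnegrE ?nrm_ge0 //; lra.
have lfE : pull f = avg f.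
  apply/eqP; rewrite -subr_eq0; apply/eqP/(nrm_eq0 w_gt0); first exact: L2B.
  by rewrite /nrm par sqrtr0.
have up x : f (p x) = f x by rewrite -[RHS](congr1 (fun h => h x) fix_f) /avgop -lfE halveDD.
have upn n x : f (iter n p x) = f x by elim: n => //= n <-; rewrite up.
apply/funext => x; apply: Normc.eq0_normc; apply/eqP/negPn/negP => fx0.
pose c := normc (f x) ^+ 2 * w x.
have c0 : 0 < c by rewrite mulr_gt0 // exprn_gt0 // lt_def fx0 normc_ge0.
have bnd n : n%:R * c <= nrm f ^+ 2.
  apply: le_trans (nrm_pointwise w_gt0 (iter n p x) fL); rewrite upn w_iter.
  by rewrite [leRHS]mulrCA ler_pM2r // -natrX ler_nat ltnW // ltn_expl.
have := bnd (Num.bound (nrm f ^+ 2 / c)); rewrite -ler_pdivlMr // leNgt.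
by rewrite archi_boundP // divr_ge0 ?sqr_ge0 ?ltW.
Qed.

End Flow.

(** * Ballot numbers *)

Section Ballot.
Variable R : realType.

(** Twice the probability that the simple random walk first reaches level
    [n.+1] at time [k.+1]. *)
Fixpoint ballot (k n : nat) : R :=
  if k is k'.+1 then
    2^-1 * ((if n is n'.+1 then ballot k' n' else 0) + ballot k' n.+1)
  else (n == 0%N)%:R.

Lemma ballot_ge0 k n : 0 <= ballot k n.
Proof.
elim: k n => [|k IH] n /=; first by rewrite ler0n.
by rewrite mulr_ge0 ?invr_ge0 ?addr_ge0 //; case: n.
Qed.

Lemma ballot_gt k n : (k < n)%N -> ballot k n = 0.
Proof.
elim: k n => [|k IH] [|n] //= kn.
by rewrite (IH n) // (IH n.+2) ?addr0 ?mulr0 //; lia.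
Qed.

(** Maximum principle: a supersolution of the heat equation dominates the
    weighted hitting probabilities. *)
Lemma ballot_sum_le (a : nat -> R) (Psi : nat -> nat -> R) :
  (forall m n, 0 <= Psi m n) ->
  (forall m, a m + 2^-1 * Psi m.+1 1%N <= Psi m 0%N) ->
  (forall m n, 2^-1 * (Psi m.+1 n + Psi m.+1 n.+2) <= Psi m n.+1) ->
  forall K m n, \sum_(k < K) a (m + k)%N * ballot k n <= Psi m n.
Proof.
move=> Psi0 bd step; elim=> [|K IH] m n; first by rewrite big_ord0.
rewrite big_ord_recl /= addn0.
have -> : \sum_(i < K) a (m + bump 0 i)%N * (2^-1 *
    ((if n is n'.+1 then ballot i n' else 0) + ballot i n.+1)) =
  2^-1 * (\sum_(i < K) a (m.+1 + i)%N * (if n is n'.+1 then ballot i n' else 0) +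
    \sum_(i < K) a (m.+1 + i)%N * ballot i n.+1).
  rewrite -big_split big_distrr /=; apply: eq_bigr => i _.
  by rewrite /bump add1n addnS addSn mulrCA mulrDr.
case: n => [|n] /=.
  rewrite mulr1 big1 ?add0r; last by move=> i _; rewrite mulr0.
  apply: le_trans (bd m); rewrite lerD2l ler_wpM2l ?invr_ge0 //; exact: IH.
rewrite mulr0 add0r; apply: le_trans (step m n).
by rewrite ler_wpM2l ?invr_ge0 // lerD ?IH.
Qed.

Lemma ballot_sum1 K n : \sum_(k < K) ballot k n <= 2.
Proof.
have := @ballot_sum_le (fun=> 1) (fun _ _ => 2) _ _ _ K 0%N n.
under eq_bigr do rewrite mul1r; apply => *; lra.
Qed.

(** The function [6 / (n.+1 ^ 2 + 3 m)] is a supersolution for the source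
    [1 / (2 m + 1)]: it has the parabolic scaling in which time is the square
    of space. *)
Lemma ballot_sum_harmonic K n :
  \sum_(k < K) (2 * k%:R + 1)^-1 * ballot k n <= 6 / n.+1%:R ^+ 2.
Proof.
have := @ballot_sum_le (fun k => (2 * k%:R + 1)^-1)
  (fun m n => 6 / (n.+1%:R ^+ 2 + 3 * m%:R)) _ _ _ K 0%N n.
rewrite mulr0 addr0; apply.
- by move=> m k; rewrite divr_ge0 ?addr_ge0 ?sqr_ge0 ?mulr_ge0.
- move=> m; rewrite -!natr1; have : 0 <= m%:R :> R by [].
  move: m%:R => x x0; rewrite -subr_ge0.
  rewrite (_ : _ - _ = (9 * x ^+ 2 + 63 * x + 32) /
      ((2 * x + 1) * (3 * x + 1) * (3 * x + 7))).
    by rewrite divr_ge0 // ?mulr_ge0 //; nra.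
  by field; repeat (apply/andP; split); rewrite ?gt_eqF //; lra.
- move=> m k; rewrite -!natr1.
  have : 0 <= k%:R :> R by []. have : 0 <= m%:R :> R by [].
  move: m%:R k%:R => x y x0 y0; rewrite -subr_ge0.
  set z := y + 1 + 1; have z2 : 2 <= z by rewrite /z; lra.
  rewrite (_ : y + 1 = z - 1); last by rewrite /z; ring.
  have d1 : 0 < (z - 1) ^+ 2 + 3 * (x + 1) by nra.
  have d2 : 0 < (z + 1) ^+ 2 + 3 * (x + 1) by nra.
  have d3 : 0 < z ^+ 2 + 3 * x by nra.
  rewrite (_ : _ - _ = (24 * (3 * x) + 96) / ((z ^+ 2 + 3 * x) *
      ((z - 1) ^+ 2 + 3 * (x + 1)) * ((z + 1) ^+ 2 + 3 * (x + 1)))).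
    by rewrite divr_ge0 ?mulr_ge0 ?(ltW d1) ?(ltW d2) ?(ltW d3) //; lra.
  by field; rewrite !gt_eqF.
Qed.

(** The weight with which a polynomial of the averaging operator involves the
    oscillation at depth [n.+1]; see [tower_polyop]. *)
Definition ballot_coef (P : {poly R}) n : R :=
  \sum_(k < size P) P`_k * ballot k n.

(** By the arithmetic-geometric mean inequality, coefficients of the size of
    those of [(1 - x)^(-1/2)] produce a kernel of the size of [1 / n]. *)
Lemma ballot_coef_bound (P : {poly R}) n : (forall k, 0 <= P`_k) ->
  (forall k, P`_k ^+ 2 * (2 * k%:R + 1) <= 1) ->
  0 <= ballot_coef P n <= 4 / n.+1%:R.
Proof.
move=> P0 P1; rewrite sumr_ge0 => [|k _]; last by rewrite mulr_ge0 ?ballot_ge0.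
have n0 : 0 < n.+1%:R :> R by [].
have n1 : n.+1%:R * n.+1%:R^-1 = 1 :> R by rewrite divff ?gt_eqF.
have s1 := ballot_sum1 (size P) n; have s2 := ballot_sum_harmonic (size P) n.
set N := n.+1%:R in n0 n1 s2 *; clearbody N.
apply: (@le_trans _ _ (2^-1 * N^-1 * (\sum_(k < size P) ballot k n) + 2^-1 * N *
   (\sum_(k < size P) (2 * k%:R + 1)^-1 * ballot k n))).
  rewrite !big_distrr -big_split /=; apply: ler_sum => k _.
  rewrite [X in _ <= _ + X]mulrA -mulrDl ler_wpM2r ?ballot_ge0 //.
  have k0 : 0 < 2 * k%:R + 1 :> R by rewrite ltr_wpDl ?mulr_ge0.
  have : P`_k ^+ 2 <= (2 * k%:R + 1)^-1 by rewrite -[leRHS]mul1r ler_pdivlMr.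
  move=> h; apply: (@le_trans _ _ (2^-1 * N^-1 + 2^-1 * N * P`_k ^+ 2)).
    have : 0 <= N^-1 * (1 - N * P`_k) ^+ 2 by rewrite mulr_ge0 ?invr_ge0 ?sqr_ge0 ?ltW.
    rewrite (_ : _ * _ = N^-1 - (N * N^-1) * (2 * P`_k) + (N * N^-1) * (N * P`_k ^+ 2));
      last by ring.
    by rewrite n1; lra.
  by rewrite lerD2l ler_wpM2l // mulr_ge0 ?invr_ge0 ?ltW.
apply: (@le_trans _ _ (2^-1 * N^-1 * 2 + 2^-1 * N * (6 / N ^+ 2))).
  by apply: lerD; apply: ler_wpM2l => //; rewrite mulr_ge0 ?invr_ge0 // ltW.
by rewrite le_eqVlt; apply/orP; left; apply/eqP; field; rewrite gt_eqF.
Qed.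

Lemma sum_inv_sq N : \sum_(n < N) (n.+1%:R ^+ 2)^-1 <= 2 :> R.
Proof.
suff : \sum_(n < N) (n.+1%:R ^+ 2)^-1 <= 2 - 2 / N.+1%:R :> R.
  by move/le_trans; apply; rewrite lerBlDr lerDl divr_ge0.
elim: N => [|N IH]; first by rewrite big_ord0 divr1 subrr.
rewrite big_ord_recr /=; apply: le_trans (lerD IH (lexx _)) _.
have -> : N.+2%:R = N%:R + 2 :> R by rewrite -addn2 natrD.
have -> : N.+1%:R = N%:R + 1 :> R by rewrite -addn1 natrD.
have : 0 <= N%:R :> R by [].
move: N%:R => x x0; rewrite -subr_ge0.
rewrite (_ : _ - _ = x / ((x + 1) ^+ 2 * (x + 2))); last first.
  by field; rewrite !gt_eqF //; lra.
by rewrite divr_ge0 // mulr_ge0 ?sqr_ge0 //; lra.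
Qed.

Lemma sum_steps (b : R) N : 0 <= b -> \sum_(n < N) (n.+1%:R <= b)%R%:R <= b.
Proof.
move=> b0; suff : \sum_(n < N) (n.+1%:R <= b)%R%:R <= b /\
  \sum_(n < N) (n.+1%:R <= b)%R%:R <= N%:R :> R by case.
elim: N => [|N [IHb IHN]]; first by rewrite big_ord0.
rewrite big_ord_recr /=; case: (lerP N.+1%:R b) => Nb /=; last first.
  by rewrite mulr0n addr0; split=> //; apply: le_trans IHN _; rewrite ler_nat.
have h : \sum_(n < N) (n.+1%:R <= b)%R%:R + 1 <= N.+1%:R :> R.
  by rewrite -natr1 lerD2r.
by split=> //; apply: le_trans h Nb.
Qed.

Lemma sum_tail (b : R) N : 0 <= b ->
  \sum_(n < N) (b < n.+1%:R)%R%:R * (b ^+ 2 / n.+1%:R ^+ 2) <= 4 * b.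
Proof.
rewrite le_eqVlt => /orP[/eqP <-|b0].
  by rewrite big1 ?mulr0 // => n _; rewrite expr0n mul0r mulr0.
suff : \sum_(n < N) (b < n.+1%:R)%R%:R * (b ^+ 2 / n.+1%:R ^+ 2) <=
    4 * b - 4 * b ^+ 2 / (N%:R + b).
  move/le_trans; apply; rewrite lerBlDr lerDl.
  by rewrite divr_ge0 ?addr_ge0 ?mulr_ge0 ?sqr_ge0 // ltW.
elim: N => [|N IH].
  by rewrite big_ord0 add0r subr_ge0 expr2 mulrA -mulrA divff ?mulr1 // gt_eqF.
rewrite big_ord_recr /=; apply: le_trans (lerD IH (lexx _)) _.
have -> : N.+1%:R = N%:R + 1 :> R by rewrite natr1.
have : 0 <= N%:R :> R by []; move: N%:R => x x0.
have d1 : 0 < x + b by rewrite ltr_wpDl.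
have d2 : 0 < x + 1 + b by lra.
have d3 : 0 < x + 1 by lra.
have -> : 4 * b - 4 * b ^+ 2 / (x + 1 + b) =
    4 * b - 4 * b ^+ 2 / (x + b) + b ^+ 2 * (4 / ((x + b) * (x + 1 + b))).
  by field; rewrite !gt_eqF.
rewrite lerD2l; case: (ltrP b (x + 1)) => bx /=; last first.
  by rewrite mulr0n mul0r mulr_ge0 ?sqr_ge0 // divr_ge0 // mulr_ge0 ?ltW.
rewrite mulr1n mul1r ler_wpM2l ?sqr_ge0 // ler_pdivlMr ?mulr_gt0 //.
rewrite mulrC ler_pdivrMr ?exprn_gt0 //; nra.
Qed.

End Ballot.

(** * Oscillations along the flow and their weak type estimate *)

Section WeakType.
Variables (R : realType) (V : choiceType) (q : nat) (p : V -> V) (w : V -> R).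
Hypothesis q_gt0 : (0 < q)%N.
Hypothesis w_gt0 : forall x, 0 < w x.
Hypothesis w_pred : forall x, w (p x) = q%:R * w x.
Hypothesis fibreP : forall x,
  finite_set (p @^-1` [set x]) /\ #|` fset_set (p @^-1` [set x])| = q.
Local Notation normc := Normc.normc.
Local Notation C := R[i].
Local Notation fct := (V -> C).
Variables (eps : fct) (M : R).
Hypothesis M_ge0 : 0 <= M.
Hypothesis eps_le : forall x, normc (eps x) <= M.
Hypothesis eps_sum : forall x, \sum_(y \in p @^-1` [set x]) eps y = 0.
Implicit Types f g h u : fct.
Local Notation N2 := (norm2sq w).
Local Notation L2 := (L2 w).
Local Notation nrm := (nrm w).
Local Notation pull := (pull p).
Local Notation avg := (avg q p).
Local Notation hor := (hor q p).
Local Notation avgop := (avgop q p).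

Let w_ge0 x : 0 <= w x. Proof. exact: ltW. Qed.

(** [tower n] detects the oscillation along the [eps]-direction at depth [n.+1]
    below a vertex; [tower 0] is the horizontal gradient. *)
Definition tower n f := avg (fun x => eps x * iter n avg f x).

Lemma avg_eps : avg eps = 0.
Proof. by apply/funext => x; rewrite /avg eps_sum mulr0. Qed.

Lemma tower0_pull u : tower 0 (pull u) = 0.
Proof.
apply/funext => x; rewrite /tower /= (avg_mul_pull fibreP) //.
by rewrite avg_eps mul0r.
Qed.

Lemma iter_avgD n f g : iter n avg (f + g) = iter n avg f + iter n avg g.
Proof. by elim: n => //= n ->; rewrite (avgD fibreP). Qed.

Lemma iter_avgZ n a f :
  iter n avg (fun x => a * f x) = (fun x => a * iter n avg f x).
Proof. by elim: n => //= n ->; rewrite (avgZ fibreP). Qed.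

Lemma towerD n f g : tower n (f + g) = tower n f + tower n g.
Proof.
rewrite /tower iter_avgD -(avgD fibreP); congr avg; apply/funext => x.
by rewrite !fctE mulrDr.
Qed.

Lemma towerZ n a f : tower n (fun x => a * f x) = (fun x => a * tower n f x).
Proof.
rewrite /tower iter_avgZ -(avgZ fibreP); congr avg; apply/funext => x.
by rewrite mulrCA.
Qed.

Lemma towerS n f : tower n (avg f) = tower n.+1 f.
Proof. by rewrite /tower -iterSr. Qed.

(** The commutation relation behind the random walk: averaging moves the depth
    by one step in either direction, and depth zero is absorbing. *)
Lemma tower_avgop n f : tower n (avgop f) =
  halve ((if n is n'.+1 then tower n' f else 0) + tower n.+1 f).
Proof.
rewrite /avgop /halve towerZ; apply/funext => x; congr (_ * _).
rewrite towerD towerS; congr (_ + _); case: n => [|n]; first by rewrite tower0_pull.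
by rewrite -towerS (avg_pull q_gt0 fibreP).
Qed.

Lemma tower_iter_avgop k N f x : (k < N)%N ->
  tower 0 (iter k avgop f) x = \sum_(n < N) (ballot R k n)%:C * tower n f x.
Proof.
elim: k N f => [|k IH] [|N] f //.
  move=> _; rewrite big_ord_recl /= mul1r big1 ?addr0 // => i _.
  by rewrite /bump add1n /= mul0r.
rewrite ltnS => kN; rewrite iterSr (IH N.+1); last exact: ltnW.
under eq_bigr => n _.
  rewrite tower_avgop /halve fctE mulrCA mulrDr mulrDr; over.
rewrite big_split /= -!big_distrr /= -mulrDr.
have -> : \sum_(i < N.+1) (ballot R k i)%:C *
    (if val i is n'.+1 then tower n' f else 0) x =
    \sum_(i < N.+1) (ballot R k i.+1)%:C * tower i f x.
  rewrite big_ord_recl mulr0 add0r [RHS]big_ord_recr /= (@ballot_gt _ k N.+1).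
    by rewrite mul0r addr0; apply: eq_bigr => i _; rewrite /bump add1n.
  exact: leqW.
have -> : \sum_(i < N.+1) (ballot R k i)%:C * tower i.+1 f x =
    \sum_(i < N.+1) (if val i is n'.+1 then ballot R k n' else 0)%:C * tower i f x.
  rewrite big_ord_recr /= (@ballot_gt _ k N) // mul0r addr0.
  rewrite [RHS]big_ord_recl mul0r add0r; apply: eq_bigr => i _.
  by [].
rewrite addrC -big_split big_distrr /=; apply: eq_bigr => i _.
by rewrite -mulrDl mulrA -!rmorphD -rmorphM.
Qed.

Lemma tower_polyop (P : {poly R}) f x : tower 0 (polyop avgop P f) x =
  \sum_(n < size P) (ballot_coef P n)%:C * tower n f x.
Proof.
have tower_sum : tower 0 (polyop avgop P f) =
    \sum_(k < size P) (fun x => (P`_k)%:C * tower 0 (iter k avgop f) x).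
  rewrite (big_morph (tower 0) (towerD 0) (_ : _ = 0)); last first.
    exact: (tower0_pull 0).
  by apply: eq_bigr => k _; rewrite towerZ.
rewrite tower_sum fct_sumE.
under eq_bigr => k _ do
  rewrite (tower_iter_avgop f x (ltn_ord k)) big_distrr /=.
rewrite exchange_big /=; apply: eq_bigr => n _.
rewrite /ballot_coef rmorph_sum big_distrl /=.
by apply: eq_bigr => k _; rewrite mulrA -rmorphM.
Qed.

Lemma norm2sq_eps u : (N2 (fun x => (eps x * u x)%R) <= (M ^+ 2)%:E * N2 u)%E.
Proof.
have -> : ((M ^+ 2)%:E * N2 u)%E = N2 (fun x => M%:C * u x).
  by rewrite (norm2sqZ w_gt0) normc_real real_normK ?num_real.
apply: (le_norm2sq w_gt0) => x; rewrite !Normc.normcM ler_wpM2r ?normc_ge0 //.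
by rewrite normc_real ger0_norm.
Qed.

Lemma L2_tower n f : L2 f -> L2 (tower n f).
Proof.
move=> fL; apply: (L2_avg q_gt0 w_gt0 w_pred fibreP); apply: le_lt_trans (norm2sq_eps _) _.
by rewrite (norm2sqE w_gt0 (L2_iter_avg q_gt0 w_gt0 w_pred fibreP n fL)) -EFinM ltry.
Qed.

(** Only the oscillation of the [n]-fold average at its own scale survives. *)
Lemma nrm_tower n f : L2 f ->
  nrm (tower n f) ^+ 2 <= M ^+ 2 * (nrm (iter n avg f) ^+ 2 - nrm (iter n.+1 avg f) ^+ 2).
Proof.
move=> fL; pose v := iter n avg f.
have L2avg := L2_avg q_gt0 w_gt0 w_pred fibreP.
have vL : L2 v by exact: (L2_iter_avg q_gt0 w_gt0 w_pred fibreP).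
have hL : L2 (hor v).
  apply: (L2B w_gt0) => //; apply: (L2_pull q_gt0 w_gt0 w_pred fibreP); exact: L2avg.
have -> : tower n f = avg (fun x => eps x * hor v x).
  transitivity (tower 0 (hor v)); last by [].
  by rewrite -[RHS]addr0 -(tower0_pull (avg v)) -towerD /hor subrK.
have <- : nrm (hor v) ^+ 2 = nrm v ^+ 2 - nrm (avg v) ^+ 2.
  have := norm2sq_split q_gt0 w_gt0 w_pred fibreP v.
  rewrite (norm2sqE w_gt0 vL) (norm2sqE w_gt0 hL) (norm2sqE w_gt0 (L2avg _ vL)).
  by rewrite -EFinD => -[->]; rewrite addrK.
have eL : L2 (fun x => eps x * hor v x).
  apply: le_lt_trans (norm2sq_eps _) _.
  by rewrite (norm2sqE w_gt0 hL) -EFinM ltry.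
have : (N2 (avg (fun x => eps x * hor v x)%R) <= (M ^+ 2)%:E * N2 (hor v))%E.
  by apply: le_trans (norm2sq_eps _); exact: (norm2sq_avg q_gt0 w_gt0 w_pred fibreP).
by rewrite (norm2sqE w_gt0 (L2avg _ eL)) (norm2sqE w_gt0 hL) -EFinM lee_fin.
Qed.

(** The weights are square summable and, by [nrm_tower], the squared norms of the
    towers telescope; hence the bound depends neither on [N] nor on [c]. *)
Lemma nrm_sum_tower (N : nat) (c : nat -> R) f : L2 f ->
  (forall n, 0 <= c n <= 4 / n.+1%:R) ->
  nrm (\sum_(n < N) (fun x => (c n)%:C * tower n f x)) <= (16 + M ^+ 2) * nrm f.
Proof.
move=> fL cP; apply: le_trans (nrm_sum w_gt0 _ _) _.
  by move=> n; apply/(L2Z w_gt0)/L2_tower.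
have cE n : nrm (fun x => (c n)%:C * tower n f x) = c n * nrm (tower n f).
  by rewrite (nrmZ w_gt0 _ (L2_tower n fL)) normc_real ger0_norm ?(andP (cP n)).1.
under eq_bigr => n _ do rewrite cE.
apply/ler_addgt0Pr => e e0.
pose t := nrm f + e / (16 + M ^+ 2).
have K0 : 0 < 16 + M ^+ 2 by rewrite ltr_wpDr ?sqr_ge0.
have t0 : 0 < t by rewrite ltr_wpDl ?nrm_ge0 // divr_gt0.
have c2 : \sum_(n < N) c n ^+ 2 <= 32.
  apply: (@le_trans _ _ (16 * \sum_(n < N) (n.+1%:R ^+ 2)^-1)); last first.
    by have := sum_inv_sq R N; lra.
  rewrite big_distrr /=; apply: ler_sum => n _.
  have /andP[c0 c4] := cP n; have := lerXn2r 2 _ _ c4.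
  rewrite !nnegrE c0 (le_trans c0 c4) expr_div_n => /(_ isT isT).
  by rewrite (_ : 4 ^+ 2 = 16 :> R) //; ring.
have tel : \sum_(n < N) nrm (tower n f) ^+ 2 <= M ^+ 2 * nrm f ^+ 2.
  apply: (@le_trans _ _ (M ^+ 2 * (nrm f ^+ 2 - nrm (iter N avg f) ^+ 2))); last first.
    by rewrite ler_wpM2l ?sqr_ge0 // lerBlDr lerDl sqr_ge0.
  elim: N {c2} => [|N IH]; first by rewrite big_ord0 subrr mulr0.
  by rewrite big_ord_recr /=; have := nrm_tower N fL; lra.
have -> : (16 + M ^+ 2) * nrm f + e = (16 + M ^+ 2) * t.
  by rewrite /t mulrDr mulrCA divff ?mulr1 // gt_eqF.
apply: (@le_trans _ _ (2^-1 * (t * \sum_(n < N) c n ^+ 2) +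
    2^-1 * (t^-1 * \sum_(n < N) nrm (tower n f) ^+ 2))).
  rewrite !big_distrr -big_split /=; apply: ler_sum => n _.
  set a := c n; set b := nrm _.
  have : 0 <= t^-1 * (t * a - b) ^+ 2 by rewrite mulr_ge0 ?sqr_ge0 ?invr_ge0 ?ltW.
  have tt : t * t^-1 = 1 by rewrite divff ?gt_eqF.
  have -> : t^-1 * (t * a - b) ^+ 2 =
      (t * t^-1) * (t * a ^+ 2) - (t * t^-1) * (2 * (a * b)) + t^-1 * b ^+ 2.
    by clearbody a b t; ring.
  by rewrite tt; clearbody a b t; lra.
have h1 : t * \sum_(n < N) c n ^+ 2 <= t * 32 := ler_wpM2l (ltW t0) c2.
have h2 : t^-1 * \sum_(n < N) nrm (tower n f) ^+ 2 <= M ^+ 2 * t.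
  rewrite mulrC ler_pdivrMr // -mulrA -expr2; apply: le_trans tel _.
  rewrite ler_wpM2l ?sqr_ge0 // ler_pXn2r ?nnegrE ?nrm_ge0 ?(ltW t0) //.
  by rewrite /t lerDl divr_ge0 // ltW.
have : 0 <= M ^+ 2 * t by rewrite mulr_ge0 ?sqr_ge0 // ltW.
clearbody t; lra.
Qed.

(** The adjoint of the sum of the towers with weights [c]. *)
Definition cotower (c : nat -> R) N g : fct := fun z =>
  \sum_(n < N) (c n)%:C * ((eps (iter n p z))^* * g (iter n.+1 p z)).

Lemma iter_pull n f x : iter n pull f x = f (iter n p x).
Proof. by elim: n x => // n IH x; rewrite iterS /pull IH -iterSr. Qed.

Lemma pythagoras_sum N (D : nat -> fct) : (forall n, avg (D n) = 0) ->
  N2 (\sum_(n < N) iter n pull (D n)) = (\sum_(n < N) N2 (D n))%E.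
Proof.
elim: N D => [|N IH] D D0; first by rewrite !big_ord0 norm2sq0.
rewrite !big_ord_recl /= -(IH (fun n => D n.+1)) //.
rewrite -(pythagoras q_gt0 w_gt0 w_pred fibreP) //; congr (N2 (_ + _)).
rewrite (big_morph pull (_ : {morph pull : f g / f + g}) (_ : pull 0 = 0)) //.
Qed.

Lemma wmeasureE (A : V -> bool) :
  wmeasure w [set x | A x] = \esum_(x in [set: V]) ((A x)%:R * w x)%:E.
Proof.
rewrite /wmeasure esum_mkcond; apply: eq_esum => x _.
rewrite (_ : (x \in _) = A x); first by case: (A x); rewrite ?mul1r ?mul0r.
by apply/idP/idP => [/set_mem//|Ax]; apply/mem_set.
Qed.

Lemma esum_addw (F G : V -> R) : (forall x, 0 <= F x) -> (forall x, 0 <= G x) ->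
  (\esum_(x in [set: V]) ((F x + G x) * w x)%:E =
   \esum_(x in [set: V]) (F x * w x)%:E + \esum_(x in [set: V]) (G x * w x)%:E)%E.
Proof.
move=> F0 G0; rewrite -esumD; try by (move=> x _; rewrite lee_fin mulr_ge0).
by apply: eq_esum => x _; rewrite mulrDl.
Qed.

Lemma esum_scalew (k : R) (F : V -> R) : 0 <= k -> (forall x, 0 <= F x) ->
  (\esum_(x in [set: V]) (k * F x * w x)%:E =
   k%:E * \esum_(x in [set: V]) (F x * w x)%:E)%E.
Proof.
move=> k0 F0; rewrite -esumZ //; last by move=> x _; rewrite lee_fin mulr_ge0.
by apply: eq_esum => x _; rewrite -EFinM mulrA.
Qed.

Lemma esum_sumw N (F : nat -> V -> R) : (forall n x, 0 <= F n x) ->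
  (\sum_(n < N) \esum_(x in [set: V]) (F n x * w x)%:E =
   \esum_(x in [set: V]) ((\sum_(n < N) F n x) * w x)%:E)%E.
Proof.
move=> F0; rewrite -esum_sum; last by move=> x n _ _; rewrite lee_fin mulr_ge0.
by apply: eq_esum => x _; rewrite sumEFin big_distrl.
Qed.

(** The weak type estimate. The [n]-th term of the kernel is discarded where
    the ancestor at height [n.+1] carries a value above [n.+1] times the level:
    there are few such points. The truncation of a term depends on the ancestor
    only, so that the remaining terms stay orthogonal and are controlled in
    quadratic mean. *)
Lemma cotower_weak_type (c : nat -> R) N (lambda : R) g : 0 < lambda ->
  (forall n, 0 <= c n <= 4 / n.+1%:R) ->
  (wmeasure w [set z | (lambda < normc (cotower c N g z))%R] <=
    ((1 + 64 * M ^+ 2) * lambda^-1)%:E * norm1 w g)%E.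
Proof.
move=> l0 cP; have li0 : 0 <= lambda^-1 by rewrite invr_ge0 ltW.
pose gn (n : nat) x := if normc (g x) < n.+1%:R * lambda then g x else 0.
pose D n y := (c n)%:C * ((eps y)^* * gn n (p y)).
pose h := \sum_(n < N) iter n pull (D n).
pose big (n : nat) x : R := (n.+1%:R * lambda <= normc (g x))%R%:R.
have big0 n x : 0 <= big n x by rewrite ler0n.
have D0 n : avg (D n) = 0.
  apply/funext => x; rewrite (_ : D n = fun y => ((c n)%:C * (eps y)^*) * gn n (p y)).
    rewrite (avg_mul_pull fibreP) (avgZ fibreP) (avgE fibreP) -rmorph_sum.
    by rewrite -(fibre_sum fibreP) eps_sum rmorph0 !mulr0 mul0r.
  by apply/funext => y; rewrite /D mulrA.
have pointwise z : (lambda < normc (cotower c N g z))%R%:R <=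
    \sum_(n < N) big n (iter n.+1 p z) + lambda^-1 ^+ 2 * normc (h z) ^+ 2.
  have r0 : 0 <= lambda^-1 ^+ 2 * normc (h z) ^+ 2 by rewrite mulr_ge0 ?sqr_ge0.
  have [[n bign]|small] := pselect (exists n : 'I_N, big n (iter n.+1 p z) = 1).
    apply: (@le_trans _ _ 1); first by rewrite lern1; case: (_ < _).
    rewrite (bigD1 n) //= bign -addrA lerDl addr_ge0 // sumr_ge0 // => *; exact: big0.
  have hE : h z = cotower c N g z.
    rewrite /h fct_sumE; apply: eq_bigr => n _; rewrite iter_pull /D -iterS.
    congr (_ * (_ * _)); rewrite /gn; case: ifPn => //; rewrite -leNgt => bg.
    by case: small; exists n; rewrite /big bg.
  rewrite -hE; apply: (@le_trans _ _ (lambda^-1 ^+ 2 * normc (h z) ^+ 2)); last first.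
    by rewrite lerDr sumr_ge0.
  case: (ltrP lambda) => //= hz; rewrite -exprMn exprn_ege1 //.
  by rewrite mulrC ler_pdivlMr ?mul1r // ltW.
rewrite wmeasureE; apply: (@le_trans _ _ (\esum_(x in [set: V])
    (((\sum_(n < N) big n x) + lambda^-1 ^+ 2 * \sum_(n < N)
      (4 / n.+1%:R) ^+ 2 * M ^+ 2 * normc (gn n x) ^+ 2) * w x)%:E)%E).
  have T0 n x : 0 <= (4 / n.+1%:R) ^+ 2 * M ^+ 2 * normc (gn n x) ^+ 2.
    by apply: mulr_ge0; [apply: mulr_ge0|]; exact: sqr_ge0.
  have h0 z : 0 <= lambda^-1 ^+ 2 * normc (h z) ^+ 2.
    by apply: mulr_ge0; exact: sqr_ge0.
  apply: (@le_trans _ _ (\esum_(z in [set: V])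
      ((\sum_(n < N) big n (iter n.+1 p z) + lambda^-1 ^+ 2 * normc (h z) ^+ 2) *
        w z)%:E)).
    by apply: le_esum => z _; rewrite lee_fin ler_wpM2r.
  rewrite esum_addw //; last by move=> z; rewrite sumr_ge0.
  rewrite [leRHS]esum_addw; last 2 first.
  - by move=> x; rewrite sumr_ge0.
  - by move=> x; rewrite mulr_ge0 ?sqr_ge0 // sumr_ge0.
  apply: leeD.
    rewrite -[leRHS](esum_sumw N big0).
    rewrite -(esum_sumw N (F := fun n z => big n (iter n.+1 p z))) //.
    by apply: lee_sum => n _; rewrite (esum_iter_pull q_gt0 w_gt0 w_pred fibreP n.+1 (big0 n)).
  rewrite !esum_scalew ?sqr_ge0 //; try by (move=> x; rewrite ?sqr_ge0 ?sumr_ge0).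
  apply: lee_wpmul2l; first by rewrite lee_fin sqr_ge0.
  rewrite -[leRHS](esum_sumw N T0).
  rewrite [leLHS](pythagoras_sum N D0); apply: lee_sum => n _.
  rewrite -(esum_pull q_gt0 w_gt0 w_pred fibreP) //.
  apply: le_esum => y _; rewrite lee_fin ler_wpM2r // /D !Normc.normcM !exprMn mulrA.
  have /andP[c0 c4] := cP n.
  rewrite ler_wpM2r ?sqr_ge0 // ler_pM ?sqr_ge0 //.
    by rewrite normc_real ger0_norm // -exprMn lerXn2r ?nnegrE // (le_trans c0 c4).
  by rewrite normc_conj lerXn2r ?nnegrE ?normc_ge0.
rewrite /norm1 -esumZ; last 2 first.
- by rewrite mulr_ge0 ?addr_ge0 ?mulr_ge0 ?sqr_ge0.
- by move=> x _; rewrite lee_fin mulr_ge0 ?normc_ge0.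
apply: le_esum => x _; rewrite -EFinM lee_fin mulrA ler_wpM2r //.
set a := normc (g x); have a0 : 0 <= a by exact: normc_ge0.
pose b := a / lambda; have b0 : 0 <= b by rewrite divr_ge0 // ltW.
have -> : \sum_(n < N) big n x = \sum_(n < N) (n.+1%:R <= b)%R%:R.
  by apply: eq_bigr => n _; rewrite /big /b ler_pdivlMr.
have -> : lambda^-1 ^+ 2 * (\sum_(n < N) (4 / n.+1%:R) ^+ 2 * M ^+ 2 *
      normc (gn n x) ^+ 2) =
    16 * M ^+ 2 * \sum_(n < N) (b < n.+1%:R)%R%:R * (b ^+ 2 / n.+1%:R ^+ 2).
  rewrite !big_distrr /=; apply: eq_bigr => n _.
  rewrite /gn /b -/a ltr_pdivrMr //; case: ifP => _.
    by rewrite /= mulr1n mul1r -/a; field; rewrite !gt_eqF.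
  by rewrite Normc.normc0 expr0n /= mul0r !mulr0.
have s1 := sum_steps N b0; have s2 := sum_tail N b0.
have : 16 * M ^+ 2 * (\sum_(n < N) (b < n.+1%:R)%R%:R * (b ^+ 2 / n.+1%:R ^+ 2)) <=
    16 * M ^+ 2 * (4 * b) by rewrite ler_wpM2l // mulr_ge0 ?sqr_ge0.
have -> : (1 + 64 * M ^+ 2) / lambda * a = b + 16 * M ^+ 2 * (4 * b).
  by rewrite /b; ring.
by clearbody b; lra.
Qed.

End WeakType.

(** * Newton approximation of the inverse square root *)

Section Newton.
Variable R : realType.
Implicit Types (x t a : R) (j k : nat).

(** Newton's iteration for [(1 - x)^(-1/2)], together with the residuals
    [1 - (1 - x) P^2]. Compared with the partial sums of the binomial series, it
    has explicit residuals, from which both the size of the coefficients and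
    the convergence are read off. *)
Fixpoint newton j : {poly R} * {poly R} :=
  if j is j'.+1 then
    let: (P, E) := newton j' in
    (P * (1 + (2^-1)%:P * E), (2^-1)%:P ^+ 2 * (E ^+ 2 * (3 + E)))
  else (1, 'X).

Local Notation invsqrt j := (newton j).1.
Local Notation resid j := (newton j).2.

Lemma newtonS j : invsqrt j.+1 = invsqrt j * (1 + (2^-1)%:P * resid j) /\
  resid j.+1 = (2^-1)%:P ^+ 2 * (resid j ^+ 2 * (3 + resid j)).
Proof. by rewrite /=; case: (newton j). Qed.

Let half2 : 2 * (2^-1)%:P = 1 :> {poly R}.
Proof. by rewrite -[2]polyC_natr -polyCM divff. Qed.

Lemma newton_resid j : (1 - 'X) * invsqrt j ^+ 2 = 1 - resid j.
Proof.
elim: j => [|j IH]; first by rewrite /= expr1n mulr1.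
have [-> ->] := newtonS j.
rewrite exprMn mulrA IH; move: (resid j) half2 => E; set h := _%:P => h2.
apply/eqP; rewrite -subr_eq0; apply/eqP.
have -> : (1 - E) * (1 + h * E) ^+ 2 - (1 - h ^+ 2 * (E ^+ 2 * (3 + E))) =
  (2 * h - 1) * (E + 2 * h * E ^+ 2) by ring.
by rewrite h2 subrr mul0r.
Qed.

Definition poly_nneg (P : {poly R}) := forall k, 0 <= P`_k.

Lemma poly_nnegM P Q : poly_nneg P -> poly_nneg Q -> poly_nneg (P * Q).
Proof. by move=> P0 Q0 k; rewrite coefM sumr_ge0 // => i _; rewrite mulr_ge0. Qed.

Lemma poly_nnegD P Q : poly_nneg P -> poly_nneg Q -> poly_nneg (P + Q).
Proof. by move=> P0 Q0 k; rewrite coefD addr_ge0. Qed.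

Lemma poly_nnegC a : 0 <= a -> poly_nneg a%:P.
Proof. by move=> a0 k; rewrite coefC; case: eqP. Qed.

Lemma newton_nneg j : poly_nneg (invsqrt j) /\ poly_nneg (resid j).
Proof.
elim: j => [|j [P0 E0]].
  by split=> k /=; rewrite ?coef1 ?coefX ler0n.
have h0 : poly_nneg (2^-1)%:P by apply: poly_nnegC; rewrite invr_ge0.
have n0 (n : nat) : poly_nneg n%:R by rewrite -polyC_natr; exact: poly_nnegC.
have [-> ->] := newtonS j; split.
  apply: poly_nnegM => //; apply: poly_nnegD; first exact: (n0 1%N).
  exact: poly_nnegM.
rewrite !expr2; do 2 apply: poly_nnegM => //; try exact: poly_nnegM.
by apply: poly_nnegD => //; exact: (n0 3).
Qed.

Lemma newton_coef0 j : (invsqrt j)`_0 = 1 /\ (resid j)`_0 = 0.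
Proof.
elim: j => [|j [P0 E0]]; first by rewrite coef1 coefX.
have [-> ->] := newtonS j.
by rewrite !expr2 !coef0M coefD coef1 !coef0M E0 P0 !mulr0 addr0 mulr1 mul0r mulr0.
Qed.

(** The derivative of [E^2 (3 + E) / 4] in [E] is [(3/2) E (1 + E/2)], and the
    factor [1 + E/2] is the ratio of two consecutive approximants. *)
Lemma newton_deriv_resid j : exists2 H : {poly R}, poly_nneg H &
  (resid j)^`() = invsqrt j * H.
Proof.
elim: j => [|j [H H0 dE]].
  by exists 1; rewrite ?mulr1 ?derivX //; exact: poly_nnegC.
have [_ E0] := newton_nneg j.
exists ((2^-1)%:P * 3 * (resid j * H)).
  apply: poly_nnegM; last exact: poly_nnegM.
  by apply: poly_nnegM; rewrite -?polyC_natr; apply: poly_nnegC; rewrite ?invr_ge0.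
have [-> ->] := newtonS j.
have d3 : 3^`() = 0 :> {poly R} by rewrite -polyC_natr derivC.
rewrite !(expr2, derivM, derivD, derivC, d3, dE).
move: (resid j) (invsqrt j) half2 => E P; set h := _%:P => h2.
apply/eqP; rewrite -subr_eq0; apply/eqP.
rewrite [LHS](_ : _ = (2 * h - 1) * (3 * h * (E * P * H))); first by rewrite h2 subrr mul0r.
ring.
Qed.

(** The approximant satisfies the differential equation [2 (1 - x) P' = P] of
    [(1 - x)^(-1/2)] up to a term of constant sign, so that the ratio of two
    consecutive coefficients is at most that of the binomial series. *)
Lemma newton_coef_le j k : (invsqrt j)`_k ^+ 2 * (2 * k%:R + 1) <= 1.
Proof.
set P := invsqrt j; have P0 : poly_nneg P := (newton_nneg j).1.
have [H H0 dE] := newton_deriv_resid j.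
have Pn0 : P != 0.
  by apply/eqP => P00; have := (newton_coef0 j).1; rewrite -/P P00 coef0 => /eqP;
    rewrite eq_sym oner_eq0.
have ode : 2 * ((1 - 'X) * P^`()) = P - H.
  apply: (mulfI Pn0); have := congr1 (@deriv R) (newton_resid j).
  rewrite -/P derivM !derivB derivC derivX dE -/P expr2 derivM !sub0r => h.
  have {}h : (1 - 'X) * (P^`() * P + P * P^`()) = P * P - P * H.
    by rewrite -[P * H]opprK -h; move: P^`() => D; clearbody P; ring.
  have -> : P * (2 * ((1 - 'X) * P^`())) = (1 - 'X) * (P^`() * P + P * P^`()).
    by move: P^`() => D; clearbody P; ring.
  by rewrite h mulrBr.
have step i : P`_i.+1 * (2 * i%:R + 2) <= P`_i * (2 * i%:R + 1).
  have := congr1 (fun Q : {poly R} => Q`_i) ode.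
  rewrite -[2]polyC_natr coefCM mulrBl mul1r !coefB coefXM coef_deriv.
  have -> : (if i == 0%N then 0 else P^`()`_i.-1) = i%:R * P`_i.
    by case: i => [|i] /=; rewrite ?mul0r // coef_deriv mulr_natl.
  have -> : P`_i.+1 *+ i.+1 = (i%:R + 1) * P`_i.+1 by rewrite natr1 mulr_natl.
  have := H0 i; move: (P`_i) (P`_i.+1) (H`_i) i%:R => u v h x; clear; lra.
elim: k => [|k IH].
  by rewrite (newton_coef0 j).1 mulr0 add0r expr1n mul1r.
have := step k; rewrite -[k.+1%:R]natr1; have := P0 k; have := P0 k.+1.
have : 0 <= k%:R :> R by [].
move: IH; move: (P`_k) (P`_k.+1) k%:R => u v x IH x0 v0 u0 h.
have d0 : 0 < 2 * x + 2 by lra.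
have h2 : (v * (2 * x + 2)) ^+ 2 <= (u * (2 * x + 1)) ^+ 2.
  by rewrite lerXn2r // nnegrE mulr_ge0 //; lra.
have h3 : u ^+ 2 * (2 * x + 1) * ((2 * x + 1) * (2 * (x + 1) + 1)) <=
    (2 * x + 1) * (2 * (x + 1) + 1).
  by rewrite -[leRHS]mul1r ler_wpM2r // mulr_ge0 //; lra.
have h4 : (v * (2 * x + 2)) ^+ 2 * (2 * (x + 1) + 1) <= (u * (2 * x + 1)) ^+ 2 * (2 * (x + 1) + 1).
  by rewrite ler_wpM2r //; lra.
rewrite -(ler_pM2r (_ : 0 < (2 * x + 2) ^+ 2)) ?exprn_gt0 //.
nra.
Qed.

Lemma newton_horner j x : (1 - x) * (invsqrt j).[x] ^+ 2 = 1 - (resid j).[x].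
Proof. by have := congr1 (horner^~ x) (newton_resid j); rewrite !hornerE. Qed.

Lemma newton_value j a x : 0 < a <= 4^-1 -> -1 <= x <= 1 - a ->
  [/\ 0 <= (invsqrt j).[x], -1 <= (resid j).[x] &
    0 <= (resid j.+1).[x] <= (1 - a) ^+ j.+1].
Proof.
move=> /andP[a0 a4] /andP[x1 xa].
have h3 : (3 : {poly R}).[x] = 3 by rewrite -polyC_natr hornerC.
have step i : (resid i.+1).[x] = 4^-1 * ((resid i).[x] ^+ 2 * (3 + (resid i).[x])).
  rewrite (newtonS i).2 !(hornerM, hornerD, hornerC, horner_exp, h3).
  by congr (_ * _); field.
elim: j => [|j [p0 e e'] ].
  rewrite step hornerX hornerC; split=> //; rewrite expr1; apply/andP; split.
    by rewrite mulr_ge0 ?invr_ge0 // mulr_ge0 ?sqr_ge0 //; lra.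
  by have [x0|x0] := leP 0 x; nra.
case/andP: e' => e0 e1.
split; [|by lra|].
  by rewrite (newtonS j).1 !hornerE mulr_ge0 //; lra.
rewrite step; set y := (resid j.+1).[x] in e0 e1 *.
have ya : y <= 1 - a.
  apply: le_trans e1 _; rewrite exprS ler_piMr //; first by lra.
  by rewrite exprn_ile1 //; lra.
rewrite [_ ^+ j.+2]exprS; apply/andP; split.
  by rewrite mulr_ge0 ?invr_ge0 // mulr_ge0 ?sqr_ge0 //; lra.
apply: (@le_trans _ _ ((1 - a) * y)); last by rewrite ler_wpM2l //; lra.
clearbody y; nra.
Qed.

(** Each step multiplies the residual by a factor of at most [1 - a]. *)
Lemma newton_cvg j a t : 0 < a <= 4^-1 -> a <= t <= 2 ->
  `|(invsqrt j.+1).[1 - t] - (Num.sqrt t)^-1| <= (1 - a) ^+ j.+1 / Num.sqrt a.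
Proof.
move=> aP /andP[ta t2]; have /andP[a0 a4] := aP.
have xP : -1 <= 1 - t <= 1 - a by apply/andP; split; lra.
have [_ _ /andP[e0 e1]] := newton_value j aP xP.
have [p0 _ _] := newton_value j.+1 aP xP.
have := newton_horner j.+1 (1 - t); rewrite (_ : 1 - (1 - t) = t); last by ring.
move: ((invsqrt j.+1).[_]) ((resid j.+1).[_]) p0 e0 e1 => u e u0 e0 e1 ue.
have t0 : 0 < t by lra.
have s0 : 0 < Num.sqrt t by rewrite sqrtr_gt0.
have sa : 0 < Num.sqrt a by rewrite sqrtr_gt0.
have sas : Num.sqrt a <= Num.sqrt t by apply: ler_wsqrtr.
have tE : t = Num.sqrt t ^+ 2 by rewrite sqr_sqrtr ?ltW.
set s := Num.sqrt t in s0 sas tE *.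
have e_le1 : e <= 1 by have := mulr_ge0 (ltW t0) (sqr_ge0 u); lra.
(* [s * u] is the square root of [1 - e], which lies between [1 - e] and [1] *)
have su2 : (s * u) ^+ 2 = 1 - e by rewrite -ue tE exprMn.
have su0 : 0 <= s * u by rewrite mulr_ge0 // ltW.
have su1 : s * u <= 1 by nra.
have sue : 1 - e <= s * u by nra.
rewrite (_ : u - s^-1 = - (1 - s * u) / s); last by field; rewrite gt_eqF.
rewrite normrM normfV normrN (gtr0_norm s0) ger0_norm ?subr_ge0 //.
rewrite ler_pM ?invr_ge0 ?subr_ge0 ?(ltW s0) // ?lef_pV2 ?posrE //; lra.
Qed.

End Newton.

(** * Projection-valued measures and simple functions *)

Lemma cvge0_le (R : realType) (u : nat -> \bar R) (e : R) : 0 < e ->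
  u @ \oo --> 0%E -> \forall n \near \oo, (u n <= e%:E)%E.
Proof.
move=> e0 /fine_cvgP[fin cv].
have /cvgr0_norm_le/(_ e e0) small := cv.
near=> n; have un : u n \is a fin_num by near: n.
rewrite -(fineK un) lee_fin; apply: le_trans (ler_norm _) _.
by near: n.
Unshelve. all: by end_near.
Qed.

Section ProjectionValued.
Variables (R : realType) (V : choiceType) (w : V -> R).
Hypothesis w_gt0 : forall x, 0 < w x.
Local Notation normc := Normc.normc.
Local Notation C := R[i].
Local Notation fct := (V -> C).
Implicit Types f g h : fct.
Local Notation N2 := (norm2sq w).
Local Notation L2 := (L2 w).
Local Notation nrm := (nrm w).
Local Notation RM := (measurableTypeR R).
Variable E : opmeasure R V.
Hypothesis pvm : projection_valued_measure w E.
Implicit Types A B : set RM.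

Let E_proj A : measurable A -> orthogonal_projection w (E A).
Proof. by case: pvm => h _ _ _ /h. Qed.

Lemma bounded_L2 (T : fct -> fct) f : bounded_operator w T -> L2 f -> L2 (T f).
Proof.
case=> _ [M TM] fL; apply: le_lt_trans (TM f fL) _.
by rewrite (norm2sqE w_gt0 fL) -EFinM ltry.
Qed.

Lemma bounded_opD (T : fct -> fct) f g : bounded_operator w T -> L2 f -> L2 g ->
  T (f + g) = T f + T g.
Proof.
case=> lin _ fL gL; have := lin 1 f g fL gL.
have -> : (fun x => 1 * f x + g x) = f + g by apply/funext => x; rewrite mul1r.
by move=> ->; apply/funext => x; rewrite mul1r.
Qed.

Lemma bounded_op0 (T : fct -> fct) : bounded_operator w T -> T 0 = 0.
Proof.
move=> bT; have := bounded_opD bT (L20 w) (L20 w); rewrite addr0 => /eqP.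
by rewrite -[X in X == _]addr0 (inj_eq (addrI _)) eq_sym => /eqP.
Qed.

Lemma bounded_opZ (T : fct -> fct) a f : bounded_operator w T -> L2 f ->
  T (fun x => a * f x) = (fun x => a * T f x).
Proof.
move=> bT fL; have := bT.1 a f 0 fL (L20 w); rewrite bounded_op0 //.
have -> : (fun x => a * f x + (0 : fct) x) = (fun x => a * f x).
  by apply/funext => x; rewrite addr0.
by move=> ->; apply/funext => x; rewrite addr0.
Qed.

Lemma bounded_opB (T : fct -> fct) f g : bounded_operator w T -> L2 f -> L2 g ->
  T (f - g) = T f - T g.
Proof.
move=> bT fL gL; rewrite (bounded_opD bT fL (L2N w_gt0 gL)); congr (_ + _).
by rewrite -!fctZN1 bounded_opZ.
Qed.

Let E_bdd A : measurable A -> bounded_operator w (E A).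
Proof. by case/E_proj. Qed.

Lemma pvm_L2 A f : measurable A -> L2 f -> L2 (E A f).
Proof. by move=> mA; apply: bounded_L2; exact: E_bdd. Qed.

Lemma pvm_setI A B f : measurable A -> measurable B -> L2 f ->
  E A (E B f) = E (A `&` B) f.
Proof. by case: pvm => _ _ h _ mA mB fL; rewrite h. Qed.

Lemma pvm_setT f : L2 f -> E setT f = f.
Proof. by case: pvm => _ h _ _ /h. Qed.

(** Applied to the constant sequence of empty sets, additivity forces their
    common measure to vanish. *)
Lemma pvm_norm2sq_set0 f : L2 f -> N2 (E set0 f) = 0%E.
Proof.
move=> fL; have [_ _ _ /(_ f fL)] := pvm => /(_ (fun=> set0)).
rewrite bigcup0 // => /(_ (fun=> measurable0) _ measurable0).
have fin := norm2sqE w_gt0 (pvm_L2 measurable0 fL).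
rewrite /scalar_measure fin => cv; have {}cv := cv (@trivIset_set0 _ _ _).
set c := nrm _ ^+ 2 in fin cv *.
have {}cv : (fun n : nat => (n%:R * c)%:E) @ \oo --> c%:E.
  apply: cvg_trans cv; apply: near_eq_cvg; near=> n.
  by rewrite big_mkord sumEFin sumr_const card_ord mulr_natl.
have c0 : 0 <= c by rewrite sqr_ge0.
have cv2 : (fun n : nat => (n.+1%:R * c)%:E) @ \oo --> c%:E.
  by rewrite (cvg_shiftS (fun n : nat => (n%:R * c)%:E)).
have : ((fun n : nat => (n%:R * c)%:E + c%:E) @ \oo --> (c%:E + c%:E))%E.
  by apply: cvgeD => //; exact: cvg_cst.
rewrite (_ : (fun n : nat => _) = fun n : nat => (n.+1%:R * c)%:E); last first.
  by apply/funext => n; rewrite -EFinD -natr1 mulrDl mul1r.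
move/(cvg_unique (@ereal_hausdorff R) cv2) => [/eqP].
by rewrite -[X in X == _]addr0 (inj_eq (addrI _)) => /eqP <-.
Unshelve. all: by end_near.
Qed.

Section ScalarMeasure.
Variables (f : fct) (fL : L2 f).

(* the proofs are arguments, from which the measure structure is inferred *)
Definition spectral_measure of (forall x, 0 < w x) &
  projection_valued_measure w E & L2 f : set RM -> \bar R := scalar_measure w E f.
Local Notation nu := (spectral_measure w_gt0 pvm fL).

Let nu0 : nu set0 = 0%E. Proof. exact: pvm_norm2sq_set0. Qed.
Let nu_ge0 A : (0 <= nu A)%E. Proof. exact: norm2sq_ge0. Qed.
Let nu_sigma : semi_sigma_additive nu.
Proof. by have [_ _ _] := pvm; apply. Qed.

HB.instance Definition _ := isMeasure.Build _ _ _ nu nu0 nu_ge0 nu_sigma.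

End ScalarMeasure.
Local Notation nu := (spectral_measure w_gt0 pvm).

Lemma pvm_contraction A f : measurable A -> L2 f -> (N2 (E A f) <= N2 f)%E.
Proof.
move=> mA fL; rewrite -[in leRHS](pvm_setT fL).
by apply: (le_measure (nu fL)) => //; apply/mem_set.
Qed.

Lemma pvm_set0 f : L2 f -> E set0 f = 0.
Proof.
move=> fL; apply: (nrm_eq0 w_gt0); first exact: pvm_L2.
by rewrite /nrm pvm_norm2sq_set0 // sqrtr0.
Qed.

Lemma pvm_disjoint A B f : measurable A -> measurable B -> A `&` B = set0 ->
  L2 f -> E A (E B f) = 0.
Proof. by move=> mA mB AB fL; rewrite pvm_setI // AB pvm_set0. Qed.

Implicit Types (s : {sfun RM >-> R}) (phi psi : R -> R).

(** The orthogonal decomposition along the level sets of a simple function. *)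
Lemma pvm_partition s f : L2 f ->
  N2 f = (\sum_(c \in range s) N2 (E (s @^-1` [set c]) f))%E.
Proof.
move=> fL; rewrite -[in LHS](pvm_setT fL).
rewrite -(measure_fin_bigcup (nu fL)) //.
- congr (nu _ _); apply/seteqP; split=> // t _; exists (s t) => //.
- exact: trivIset_preimage1.
Qed.

Lemma pvm_ext0 s f : L2 f -> (forall c, E (s @^-1` [set c]) f = 0) -> f = 0.
Proof.
move=> fL f0; apply: (nrm_eq0 w_gt0) => //.
rewrite /nrm (pvm_partition s fL) fsbig1 ?sqrtr0 // => c _.
by rewrite f0 norm2sq0.
Qed.

(** The simple functional calculus, with the values of [phi] on the range of
    [s]; for [phi = id] this is the integral of a simple function. *)
Definition fcalc s phi f : fct := fun x =>
  \sum_(c \in range s) (phi c)%:C * E (s @^-1` [set c]) f x.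

Lemma fcalcE s phi f : fcalc s phi f =
  \sum_(c <- fset_set (range s)) (fun x => (phi c)%:C * E (s @^-1` [set c]) f x).
Proof.
by apply/funext => x; rewrite /fcalc fsbig_finite // fct_sumE.
Qed.

Lemma L2_fcalc s phi f : L2 f -> L2 (fcalc s phi f).
Proof.
by move=> fL; rewrite fcalcE; apply: (L2_sum w_gt0) => c; apply/(L2Z w_gt0)/pvm_L2.
Qed.

Lemma bounded_op_sum (T : fct -> fct) (I : Type) (r : seq I) (F : I -> fct) :
  bounded_operator w T -> (forall i, L2 (F i)) ->
  T (\sum_(i <- r) F i) = \sum_(i <- r) T (F i).
Proof.
move=> bT FL; elim: r => [|i r IH]; first by rewrite !big_nil bounded_op0.
by rewrite !big_cons bounded_opD ?IH //; exact: (L2_sum w_gt0).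
Qed.

Lemma pvm_fcalc_comm A s phi f : measurable A -> L2 f ->
  E A (fcalc s phi f) = fcalc s phi (E A f).
Proof.
move=> mA fL; rewrite !fcalcE bounded_op_sum; last 2 first.
- exact: E_bdd.
- by move=> c; apply/(L2Z w_gt0)/pvm_L2.
apply: eq_bigr => c _; rewrite bounded_opZ; last 2 first.
- exact: E_bdd.
- exact: pvm_L2.
by rewrite !pvm_setI // setIC.
Qed.

Lemma pvm_fcalc s phi f c : L2 f -> E (s @^-1` [set c]) (fcalc s phi f) =
  (fun x => (phi c)%:C * E (s @^-1` [set c]) f x).
Proof.
move=> fL; rewrite pvm_fcalc_comm //; apply/funext => x; rewrite /fcalc.
have disj d : d != c -> E (s @^-1` [set d]) (E (s @^-1` [set c]) f) = 0.
  move=> dc; apply: pvm_disjoint => //; apply/seteqP; split=> // t [/= sd sc].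
  by move: dc; rewrite -sd sc eqxx.
have [cs|cs] := pselect (range s c).
  rewrite (fsbigD1 c) //= fsbig1 ?addr0.
    by rewrite pvm_setI // setIid.
  by move=> d [_ /eqP dc]; rewrite disj // mulr0.
rewrite preimage10 // pvm_set0 // mulr0 fsbig1 // => d _.
by rewrite bounded_op0 ?mulr0 //; exact: E_bdd.
Qed.

Lemma norm2sq_fcalc s phi f : L2 f -> N2 (fcalc s phi f) =
  (\sum_(c \in range s) (phi c ^+ 2)%:E * N2 (E (s @^-1` [set c]) f))%E.
Proof.
move=> fL; rewrite (pvm_partition s (L2_fcalc _ _ fL)); apply: eq_fsbigr => c _.
by rewrite pvm_fcalc // norm2sqZ // normc_real real_normK ?num_real.
Qed.

Lemma fcalc1 s f : L2 f -> fcalc s (fun=> 1) f = f.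
Proof.
move=> fL; apply/eqP; rewrite -subr_eq0; apply/eqP/(pvm_ext0 (s := s)).
  by apply: (L2B w_gt0) => //; exact: L2_fcalc.
move=> c; rewrite (bounded_opB (E_bdd _) (L2_fcalc _ _ fL) fL) // pvm_fcalc //.
by apply/funext => x; rewrite !fctE mul1r subrr.
Qed.

Lemma fcalcB s phi psi f :
  fcalc s phi f - fcalc s psi f = fcalc s (fun t => phi t - psi t) f.
Proof.
rewrite !fcalcE -sumrB; apply: eq_bigr => c _.
by apply/funext => x; rewrite !fctE rmorphB mulrBl.
Qed.

Lemma fcalcM s phi psi f : L2 f ->
  fcalc s phi (fcalc s psi f) = fcalc s (fun t => phi t * psi t) f.
Proof.
move=> fL; rewrite [LHS]fcalcE [RHS]fcalcE; apply: eq_bigr => c _.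
rewrite pvm_fcalc //.
by apply/funext => x; rewrite rmorphM mulrA.
Qed.

(** The two sides may be compared on each level set of [s], which is contained
    in a level set of [r]. *)
Lemma simple_integral_comp s phi (r : {sfun RM >-> R}) f : L2 f ->
  (forall t, r t = phi (s t)) -> simple_integral E r f = fcalc s phi f.
Proof.
move=> fL rE; have rid : simple_integral E r f = fcalc r id f by [].
rewrite rid; apply/eqP; rewrite -subr_eq0; apply/eqP/(pvm_ext0 (s := s)).
  by apply: (L2B w_gt0); exact: L2_fcalc.
move=> c; rewrite (bounded_opB (E_bdd _) (L2_fcalc _ _ fL) (L2_fcalc _ _ fL)) //.
rewrite (pvm_fcalc s) //.
have -> : E (s @^-1` [set c]) (fcalc r id f) =
    E (s @^-1` [set c]) (E (r @^-1` [set phi c]) (fcalc r id f)).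
  rewrite pvm_setI //; last exact: L2_fcalc.
  by congr E; apply/seteqP; split=> [t /= st|t [//]]; rewrite rE st.
rewrite pvm_fcalc // bounded_opZ; last 2 first.
- exact: E_bdd.
- exact: pvm_L2.
rewrite pvm_setI // (_ : _ `&` _ = s @^-1` [set c]) ?subrr //.
by apply/seteqP; split=> [t [//]|t /= st]; rewrite rE st.
Qed.

(** On the range of [E A], only the values on [A] matter. *)
Lemma nrm_fcalc_le A s phi f (K : R) : measurable A -> L2 f -> E A f = f ->
  0 <= K -> (forall t, A t -> `|phi (s t)| <= K) ->
  nrm (fcalc s phi f) <= K * nrm f.
Proof.
move=> mA fL EAf K0 le_K; apply: (nrmP w_gt0 _ _).2.
  by rewrite mulr_ge0 ?nrm_ge0.
rewrite norm2sq_fcalc // exprMn EFinM -norm2sqE // (pvm_partition s fL).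
rewrite !fsbig_finite //= ge0_sume_distrr; last by move=> c _; exact: norm2sq_ge0.
apply: lee_sum => c _; have [[t [At st]]|no] := pselect (exists t, A t /\ s t = c).
  apply: lee_wpmul2r; first exact: norm2sq_ge0.
  rewrite lee_fin -real_normK ?num_real // lerXn2r ?nnegrE //.
  by rewrite -st; exact: le_K.
rewrite -EAf pvm_setI // (_ : _ `&` _ = set0) ?pvm_norm2sq_set0 ?mule0 //.
by apply/seteqP; split=> // t [/= st At]; case: no; exists t.
Qed.

Lemma measurable_sqr_sub (u v : RM -> R) : measurable_fun setT u ->
  measurable_fun setT v ->
  measurable_fun setT (EFin \o (fun t : RM => (u t - v t) ^+ 2)).
Proof.
move=> mu mv; apply/measurable_EFinP.
by apply: measurable_funX; exact: measurable_funB.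
Qed.

Lemma integral_fcalc s phi f (fL : L2 f) :
  (\int[nu fL]_(t in [set: RM]) (phi (s t) ^+ 2)%:E)%E = N2 (fcalc s phi f).
Proof.
rewrite norm2sq_fcalc //.
transitivity (\int[nu fL]_(t in [set: RM])
    (\sum_(c \in range s) (phi c ^+ 2)%:E * (\1_(s @^-1` [set c]) t)%:E))%E.
  apply: eq_integral => t _; rewrite (fsbigD1 (s t)) //=; last by exists t.
  rewrite fsbig1 ?adde0; first by rewrite indicE mem_set // mule1.
  move=> c [_ /= ct]; rewrite indicE memNset ?mule0 //= => st.
  by apply: ct.
rewrite ge0_integral_fsum //; last 2 first.
- move=> c; apply: measurable_funeM; apply/measurable_EFinP.
  exact: measurable_indic.
- by move=> c t _; rewrite -EFinM lee_fin mulr_ge0 ?sqr_ge0.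
apply: eq_fsbigr => c _; rewrite ge0_integralZl_EFin ?sqr_ge0 //.
- by rewrite integral_indic // setIT.
- by apply/measurable_EFinP; exact: measurable_indic.
Qed.

Lemma integral_sqrD (u v x : RM -> R) (k : R) f (fL : L2 f) : 0 < k ->
  measurable_fun setT u -> measurable_fun setT v -> measurable_fun setT x ->
  (\int[nu fL]_(t in [set: RM]) ((u t - x t) ^+ 2)%:E <=
   (1 + k)%:E * \int[nu fL]_(t in [set: RM]) ((v t - x t) ^+ 2)%:E +
   (1 + k^-1)%:E * \int[nu fL]_(t in [set: RM]) ((u t - v t) ^+ 2)%:E)%E.
Proof.
move=> k0 mu mv mx.
have k1 : 0 <= 1 + k by rewrite addr_ge0 // ltW.
have k2 : 0 <= 1 + k^-1 by rewrite addr_ge0 // invr_ge0 ltW.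
have mvx := measurable_sqr_sub mv mx; have muv := measurable_sqr_sub mu mv.
rewrite -!ge0_integralZl_EFin //; try by move=> t _; rewrite lee_fin sqr_ge0.
rewrite -ge0_integralD //; last 4 first.
- by move=> t _; rewrite -EFinM lee_fin mulr_ge0 ?sqr_ge0.
- exact: measurable_funeM.
- by move=> t _; rewrite -EFinM lee_fin mulr_ge0 ?sqr_ge0.
- exact: measurable_funeM.
apply: ge0_le_integral => //.
- by move=> t _; rewrite lee_fin sqr_ge0.
- exact: measurable_sqr_sub.
- by apply: emeasurable_funD; exact: measurable_funeM.
move=> t _; rewrite -!EFinM -EFinD lee_fin.
have := normc_sqD ((v t - x t)%:C) ((u t - v t)%:C) k0.
rewrite -rmorphD !normc_real !real_normK ?num_real //.
by rewrite (_ : v t - x t + (u t - v t) = u t - x t) //; ring.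
Qed.

End ProjectionValued.

(** * The spectral resolution of the Laplacian of a contraction *)

Lemma cvge0 (R : realType) (u : nat -> \bar R) : (forall n, 0 <= u n)%E ->
  (forall e : R, 0 < e -> \forall n \near \oo, (u n <= e%:E)%E) -> u @ \oo --> 0%E.
Proof.
move=> u0 small; have fin : \forall n \near \oo, u n \is a fin_num.
  apply: filterS (small 1 ltr01) => n un.
  by rewrite ge0_fin_numE //; apply: le_lt_trans un (ltry _).
apply/fine_cvgP; split=> //; apply/cvgr0Pnorm_le => e e0.
apply: filterS2 fin (small e e0) => n fn un /=.
by rewrite ger0_norm ?fine_ge0 // -lee_fin fineK.
Qed.

Lemma cvg_div_succ (R : realType) (c : R) :
  (fun n : nat => c / n.+1%:R) @ \oo --> (0 : R).
Proof.
rewrite -[X in _ --> X](mulr0 c); apply: cvgM; first exact: cvg_cst.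
exact: cvg_harmonic.
Qed.

Lemma near_div_succ (R : realType) (c e : R) : 0 < e ->
  \forall n \near \oo, c / n.+1%:R <= e.
Proof.
move=> e0; have /cvgr0_norm_le/(_ e e0) := @cvg_div_succ R c.
by apply: filterS => n; apply: le_trans; exact: ler_norm.
Qed.

Lemma three_quarters (R : realFieldType) (x y e : R) :
  0 < e -> x <= e / 4 -> y <= e / 4 -> x + y + x <= e.
Proof. by move=> *; lra. Qed.

Lemma sum_indicator_le (R : realDomainType) (P : nat -> bool) m :
  \sum_(k < m) (P k)%:R <= m%:R :> R.
Proof.
elim: m => [|m IH]; first by rewrite big_ord0.
by rewrite big_ord_recr /= -natr1 lerD // lern1 leq_b1.
Qed.

Lemma count_below (R : realDomainType) (y : R) m : 0 <= y <= m%:R ->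
  y <= \sum_(k < m) (k%:R < y)%R%:R <= y + 1.
Proof.
move=> /andP[y0 ym].
have ub n := sum_indicator_le R (fun k => (k%:R < y)%R) n.
suff h n : Num.min y n%:R <= \sum_(k < n) (k%:R < y)%R%:R <= y + 1.
  by have := h m; rewrite min_l.
elim: n => [|n /andP[lo hi]].
  by rewrite big_ord0 min_r // lexx addr_ge0.
rewrite big_ord_recr /=; case: (ltrP n%:R y) => ny /=.
  have e : \sum_(k < n) (k%:R < y)%R%:R = n%:R :> R.
    by apply/le_anti; rewrite ub /=; move: lo; rewrite min_r // ltW.
  by rewrite e natr1 ge_min lexx orbT /= -natr1 lerD2r ltW.
move: lo; rewrite addr0 min_l // hi andbT; apply: le_trans.
by rewrite ge_min lexx.
Qed.

(** Simple functions uniformly close to the identity on [[0, 2]], rounding up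
    so as to stay away from 0. *)
Lemma cells (R : realType) (n : nat) :
  exists s : {sfun (measurableTypeR R) >-> R},
    (forall t, 0 <= s t <= 2) /\
    forall t, 0 <= t <= 2 -> t <= s t <= t + n.+1%:R^-1.
Proof.
have N0 : 0 < n.+1%:R :> R by [].
pose I k : set (measurableTypeR R) := `]k%:R / n.+1%:R, +oo[%classic.
have mI k : measurable (I k) by exact: measurable_itv.
pose s : {sfun (measurableTypeR R) >-> R} :=
  \sum_(k < 2 * n.+1) scale_sfun n.+1%:R^-1 (indic_sfun (I k) (mI k)).
have sE t : s t = n.+1%:R^-1 * \sum_(k < 2 * n.+1) (k%:R < n.+1%:R * t)%R%:R.
  rewrite /s sfun_sum big_distrr /=; apply: eq_bigr => k _.
  rewrite /scale_sfun /= mulrC; congr (_ * _); rewrite /mindic indicE.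
  congr ((nat_of_bool _)%:R); rewrite mulrC -ltr_pdivrMr //.
  by apply/idP/idP => [/set_mem|h]; rewrite /I /= ?in_itv /= ?andbT //;
    apply/mem_set; rewrite /= in_itv /= andbT.
exists s; split=> t.
  rewrite sE mulr_ge0 ?invr_ge0 ?sumr_ge0 //= ler_pdivrMl //.
  have -> : n.+1%:R * 2 = (2 * n.+1)%:R :> R by rewrite natrM mulrC.
  exact: (sum_indicator_le R (fun k => (k%:R < n.+1%:R * t)%R)).
move=> /andP[t0 t2]; rewrite sE.
have := @count_below R (n.+1%:R * t) (2 * n.+1).
rewrite mulr_ge0 // natrM [2 * _]mulrC ler_wpM2l // => /(_ isT)/andP[lo hi].
rewrite ler_pdivlMl // lo /= ler_pdivrMl // mulrDr divff ?gt_eqF //.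
Qed.

Section Resolution.
Variables (R : realType) (V : choiceType) (w : V -> R).
Hypothesis w_gt0 : forall x, 0 < w x.
Local Notation normc := Normc.normc.
Local Notation C := R[i].
Local Notation fct := (V -> C).
Implicit Types f g h : fct.
Local Notation N2 := (norm2sq w).
Local Notation L2 := (L2 w).
Local Notation nrm := (nrm w).
Local Notation RM := (measurableTypeR R).
Variables (E : opmeasure R V) (B : fct -> fct).
Hypothesis B_L2 : forall f, L2 f -> L2 (B f).
Hypothesis B_contr : forall f, L2 f -> nrm (B f) <= nrm f.
Hypothesis BD : forall f g, B (f + g) = B f + B g.
Hypothesis B_fixed : forall f, L2 f -> B f = f -> f = 0.
Variable Lap : fct -> fct.
Hypothesis LapE : forall f, Lap f = f - B f.
Hypothesis E_res : spectral_resolution w Lap E.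
Local Notation nu := (spectral_measure w_gt0 E_res.1).
Implicit Types A : set RM.
Implicit Types (s : {sfun RM >-> R}) (phi psi : R -> R).

Let pvm := E_res.1.
Let E_bdd A : measurable A -> bounded_operator w (E A).
Proof. by case: pvm => h _ _ _ /h[]. Qed.

Lemma L2_lap f : L2 f -> L2 (Lap f).
Proof. by move=> fL; rewrite LapE; apply: (L2B w_gt0) => //; exact: B_L2. Qed.

Lemma fcalc_cst s (c : R) f : L2 f -> fcalc E s (fun=> c) f = (fun x => c%:C * f x).
Proof.
move=> fL; rewrite -[in RHS](fcalc1 w_gt0 pvm s fL); apply/funext => x.
rewrite /fcalc mulr_fsumr; apply: eq_fsbigr => d _.
by rewrite mul1r.
Qed.

Lemma resolution_approx f (e : R) (fL : L2 f) : 0 < e -> exists s,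
  (\int[nu fL]_(t in [set: RM]) ((t - s t) ^+ 2)%:E <= e%:E)%E /\
  (N2 (fcalc E s id f - Lap f)%R <= e%:E)%E.
Proof.
move=> e0; have [_ _ [s [cv1 cv2]]] := E_res.2 f fL.
have near1 := cvge0_le e0 cv1; have near2 := cvge0_le e0 cv2.
have [n _ H] := filterI near1 near2.
by exists (s n); exact: (H n (leqnn n)).
Qed.

(** The quadratic mean of [t - c] measures how far [f] is from an eigenvector;
    the arbitrary loss [k] comes from the approximation by simple functions. *)
Lemma spectral_dist (k c : R) f (fL : L2 f) : 0 < k ->
  let F := N2 (Lap f - (fun x => c%:C * f x)) in
  let G := (\int[nu fL]_(t in [set: RM]) ((t - c) ^+ 2)%:E)%E in
  (G <= ((1 + k) ^+ 2)%:E * F)%E /\ (F <= ((1 + k) ^+ 2)%:E * G)%E.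
Proof.
move=> k0 F G.
have cL : L2 (fun x => c%:C * f x) by exact: L2Z.
have lL : L2 (Lap f) by exact: L2_lap.
have FL : L2 (Lap f - (fun x => c%:C * f x)) by exact: (L2B w_gt0).
have k1 : 0 <= 1 + k by rewrite addr_ge0 // ltW.
have k2 : 0 <= 1 + k^-1 by rewrite addr_ge0 // invr_ge0 ltW.
pose d := (1 + k) * (1 + k^-1) + (1 + k^-1).
have d0 : 0 < d by rewrite ltr_wpDl ?mulr_ge0 // ltr_pwDl // invr_ge0 ltW.
have sE s : (\int[nu fL]_(t in [set: RM]) ((s t - c) ^+ 2)%:E)%E =
    N2 (fcalc E s id f - (fun x => c%:C * f x)).
  rewrite -(fcalc_cst s c fL) (fcalcB E).
  exact: (integral_fcalc w_gt0 pvm s (fun t => t - c) fL).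
have combine (a b a' b' y : \bar R) (e : R) : 0 < e -> (0 <= a)%E -> (0 <= b)%E ->
    (y <= (1 + k)%:E * b + (1 + k^-1)%:E * a')%E ->
    (b <= (1 + k)%:E * a + (1 + k^-1)%:E * b')%E ->
    (a' <= (e / d)%:E)%E -> (b' <= (e / d)%:E)%E ->
    (y <= ((1 + k) ^+ 2)%:E * a + e%:E)%E.
  move=> e0 a0 b0 yb ba ae be; apply: le_trans yb _.
  apply: (@le_trans _ _ ((1 + k)%:E * ((1 + k)%:E * a + (1 + k^-1)%:E * (e / d)%:E)
      + (1 + k^-1)%:E * (e / d)%:E)%E).
    apply: leeD; apply: lee_wpmul2l; rewrite ?lee_fin //.
    by apply: le_trans ba _; rewrite leeD2l // lee_wpmul2l ?lee_fin.
  have ed0 : 0 <= e / d by rewrite divr_ge0 ?(ltW d0) ?(ltW e0).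
  rewrite -EFinM ge0_muleDr; last 2 first.
  - by apply: mule_ge0; rewrite ?lee_fin.
  - by rewrite lee_fin; apply: mulr_ge0.
  rewrite muleA -!EFinM -addeA -EFinD; apply: leeD => //.
  by rewrite lee_fin mulrA -mulrDl -/d mulrC divfK // gt_eqF.
have F0 : (0 <= F)%E by exact: norm2sq_ge0.
have G0 : (0 <= G)%E by apply: integral_ge0 => t _; rewrite lee_fin sqr_ge0.
split; apply/lee_addgt0Pr => e e0;
  have [s [ie ne]] := resolution_approx fL (divr_gt0 e0 d0).
  apply: (combine F (N2 (fcalc E s id f - (fun x => c%:C * f x))) _ _ G e e0 F0
    (norm2sq_ge0 w_gt0 _) _ _ ie ne).
    by rewrite -sE; exact: integral_sqrD.
  have -> : fcalc E s id f - (fun x => c%:C * f x) =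
      (Lap f - (fun x => c%:C * f x)) + (fcalc E s id f - Lap f).
    by rewrite [RHS]addrC addrA subrK.
  exact: norm2sqD.
have ie' : (\int[nu fL]_(t in [set: RM]) ((s t - t) ^+ 2)%:E <= (e / d)%:E)%E.
  by under eq_integral do rewrite -[X in (X ^+ 2)%:E]opprB sqrrN.
apply: (combine G (N2 (fcalc E s id f - (fun x => c%:C * f x))) _ _ F e e0 G0
    (norm2sq_ge0 w_gt0 _) _ _ ne ie').
  rewrite /F; have -> : Lap f - (fun x => c%:C * f x) =
      (fcalc E s id f - (fun x => c%:C * f x)) + (Lap f - fcalc E s id f).
    by rewrite [RHS]addrC addrA subrK.
  have -> : N2 (fcalc E s id f - Lap f) = N2 (Lap f - fcalc E s id f).
    by rewrite -norm2sqN opprB.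
  exact: norm2sqD.
by rewrite -sE; exact: integral_sqrD.
Qed.

Lemma integral_support A (u : RM -> R) f (fL : L2 f) : measurable A -> E A f = f ->
  measurable_fun setT u -> (forall t, 0 <= u t) ->
  (\int[nu fL]_(t in [set: RM]) (u t)%:E = \int[nu fL]_(t in A) (u t)%:E)%E.
Proof.
move=> mA EAf mu u0.
have mu' : measurable_fun setT (EFin \o u) by exact/measurable_EFinP.
have nuA : nu fL (~` A) = 0%E.
  change (N2 (E (~` A) f) = 0%E); rewrite -EAf (pvm_disjoint w_gt0 pvm) //.
  - exact: norm2sq0.
  - exact: measurableC.
  - exact: setICl.
rewrite (@ge0_negligible_integral _ _ _ (nu fL) _ (~` A)) //.
- by rewrite setTD setCK.
- exact: measurableC.
- by move=> t _; rewrite lee_fin.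
Qed.

Lemma measure_support A f (fL : L2 f) : measurable A -> E A f = f -> nu fL A = N2 f.
Proof. by move=> mA EAf; change (N2 (E A f) = N2 f); rewrite EAf. Qed.

(** Here [(t - c)^2] is integrated against a measure carried by [A]; the factor
    2 absorbs the loss in [spectral_dist]. *)
Lemma near_eigenvector A (c eta : R) f : measurable A -> L2 f -> E A f = f ->
  0 <= eta -> (forall t, A t -> `|t - c| <= eta) ->
  nrm (Lap f - (fun x => c%:C * f x)) <= 2 * eta * nrm f.
Proof.
move=> mA fL EAf eta0 near_c; apply: (nrmP w_gt0 _ _).2.
  by rewrite !mulr_ge0 ?nrm_ge0.
apply: le_trans (spectral_dist c fL ltr01).2 _.
rewrite (_ : (2 * eta * nrm f) ^+ 2 = (1 + 1) ^+ 2 * (eta ^+ 2 * nrm f ^+ 2)); last by ring.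
rewrite [leRHS]EFinM; apply: lee_wpmul2l; first by rewrite lee_fin sqr_ge0.
have mu : measurable_fun [set: RM] (fun t : RM => (t - c) ^+ 2).
  by apply: measurable_funX; exact: measurable_funB.
rewrite (integral_support fL mA EAf) //; last by move=> t; exact: sqr_ge0.
rewrite [leRHS]EFinM -(norm2sqE w_gt0 fL) -(measure_support fL mA EAf).
rewrite -(integral_cst (nu fL) mA) /=; apply: ge0_le_integral => //.
- by move=> t _; rewrite lee_fin sqr_ge0.
- by apply/measurable_EFinP; exact: measurable_funTS.
- move=> t At; rewrite lee_fin -[leLHS]real_normK ?num_real //.
  by rewrite lerXn2r ?nnegrE // near_c.
Qed.

(** Since [B] is a contraction, the spectrum lies within distance 1 of 1. *)
Lemma spectrum_bound A (d : R) f : measurable A -> L2 f -> E A f = f ->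
  0 < d -> (forall t, A t -> 1 + d <= `|t - 1|) -> f = 0.
Proof.
move=> mA fL EAf d0 far; apply: (nrm_eq0 w_gt0 fL); apply/eqP/negPn/negP => f0.
have fp : 0 < nrm f ^+ 2 by rewrite exprn_gt0 // lt_def f0 nrm_ge0.
have d2 : 0 < d / 2 by rewrite divr_gt0.
have BE : Lap f - (fun x => 1%:C * f x) = - B f.
  by apply/funext => x; rewrite LapE !fctE mul1r; ring.
have := (spectral_dist 1 fL d2).1; rewrite BE norm2sqN (norm2sqE w_gt0 (B_L2 fL)).
have mu : measurable_fun [set: RM] (fun t : RM => (t - 1) ^+ 2).
  by apply: measurable_funX; exact: measurable_funB.
rewrite (integral_support fL mA EAf) //; last by move=> t; exact: sqr_ge0.
have : (((1 + d) ^+ 2 * nrm f ^+ 2)%:E <=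
    \int[nu fL]_(t in A) ((t - 1) ^+ 2)%:E)%E.
  rewrite EFinM -(norm2sqE w_gt0 fL) -(measure_support fL mA EAf).
  rewrite -(integral_cst (nu fL) mA) /=; apply: ge0_le_integral => //.
  - by move=> t _; rewrite lee_fin sqr_ge0.
  - by apply/measurable_EFinP; exact: measurable_funTS.
  - move=> t At; rewrite lee_fin -[leRHS]real_normK ?num_real //.
    by rewrite lerXn2r ?nnegrE ?far // addr_ge0 // ltW.
move=> /le_trans h /h; rewrite -EFinM lee_fin.
have : (1 + d / 2) ^+ 2 * nrm (B f) ^+ 2 <= (1 + d / 2) ^+ 2 * nrm f ^+ 2.
  by rewrite ler_wpM2l ?sqr_ge0 // lerXn2r ?nnegrE ?nrm_ge0 ?B_contr.
move=> h1 h2; have := le_trans h2 h1; rewrite ler_pM2r // leNgt.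
by rewrite ltrXn2r // ?nnegrE; lra.
Qed.

Lemma pvm_idem A f : measurable A -> L2 f -> E A (E A f) = E A f.
Proof. by move=> mA fL; rewrite (pvm_setI pvm) // setIid. Qed.

Definition spectrum : set RM := [set t | 0 < t <= 2].

Lemma m_spectrum : measurable spectrum.
Proof.
by rewrite (_ : spectrum = `]0, 2]%classic) //; apply/seteqP; split => t; rewrite /= in_itv.
Qed.

(** The complement of the spectrum consists of points at distance more than 1
    from 1, dealt with by [spectrum_bound], and of the point 0, which is not an
    eigenvalue since [B] fixes no vector. *)
Lemma pvm_spectrum f : L2 f -> E (~` spectrum) f = 0.
Proof.
move=> fL; pose F n : set RM := [set t | 1 + n.+1%:R^-1 <= `|t - 1|].
have mF n : measurable (F n).
  have mu : measurable_fun [set: RM] (fun t : RM => `|t - 1|).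
    apply: (measurableT_comp (f := @Num.norm R R)); first exact: normr_measurable.
    exact: measurable_funB.
  have := mu measurableT `[1 + n.+1%:R^-1, +oo[%classic (measurable_itv _).
  rewrite setTI; congr measurable; apply/seteqP.
  by split => t; rewrite /= in_itv /= andbT.
have EF n : E (F n) f = 0.
  apply: (spectrum_bound (A := F n) (d := n.+1%:R^-1)) => //.
  - exact: (pvm_L2 w_gt0 pvm).
  - exact: pvm_idem.
have m0 : measurable ([set 0] : set RM) by exact: measurable_set1.
have E0 : E [set 0] f = 0.
  have eL := pvm_L2 w_gt0 pvm m0 fL.
  apply: B_fixed => //; have h : nrm (Lap (E [set 0] f) -
      (fun x => (0 : R)%:C * E [set 0] f x)) <= 2 * 0 * nrm (E [set 0] f).
    apply: (near_eigenvector (A := [set 0])) => //; first exact: pvm_idem.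
    by move=> t ->; rewrite subrr normr0.
  rewrite mulr0 mul0r in h.
  have : Lap (E [set 0] f) = 0.
    apply: (nrm_eq0 w_gt0); first exact: L2_lap.
    apply/le_anti; rewrite nrm_ge0 andbT; move: h; congr (nrm _ <= 0).
    by apply/funext => x; rewrite !fctE mul0r subr0.
  by rewrite LapE => /eqP; rewrite subr_eq0 => /eqP.
have neg : (nu fL).-negligible (~` spectrum).
  apply: (@negligibleS _ _ _ (nu fL) ([set 0] `|` \bigcup_n F n)); last first.
    apply: negligibleU.
      apply/negligibleP => //.
      by change (N2 (E [set 0] f) = 0%E); rewrite E0 norm2sq0.
    apply: negligible_bigcup => n; apply/negligibleP => //.
    by change (N2 (E (F n) f) = 0%E); rewrite EF norm2sq0.
  move=> t /= /negP; rewrite negb_and -leNgt -ltNge => t02.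
  have [->|t0] := eqVneq t 0; [by left|right].
  have h : 0 < `|t - 1| - 1.
    case/orP: t02 => t02; first by rewrite ltr0_norm; [lra|]; move/eqP: t0; lra.
    by rewrite gtr0_norm; lra.
  exists (Num.truncn (`|t - 1| - 1)^-1) => //=.
  rewrite /F /= -lerBrDl -[leRHS]invrK lef_pV2 ?posrE ?invr_gt0 //.
  by apply/ltW/truncnS_gt.
have mS : measurable (~` spectrum) by apply: measurableC; exact: m_spectrum.
have nu0 : nu fL (~` spectrum) = 0%E by apply: measure_negligible.
apply: (nrm_eq0 w_gt0); first exact: (pvm_L2 w_gt0 pvm).
by rewrite /nrm [N2 _]nu0 sqrtr0.
Qed.

Lemma pvm_split A f : measurable A -> L2 f -> f = E A f + E (~` A) f.
Proof.
move=> mA fL; have mC := measurableC mA.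
have aL := pvm_L2 w_gt0 pvm mA fL; have cL := pvm_L2 w_gt0 pvm mC fL.
pose u := f - (E A f + E (~` A) f).
have sL : L2 (E A f + E (~` A) f) by exact: L2D.
have uL : L2 u by exact: L2B.
have kill X : measurable X -> E X u = E X f - (E X (E A f) + E X (E (~` A) f)).
  move=> mX; rewrite (bounded_opB w_gt0 (E_bdd mX) fL sL).
  by rewrite (bounded_opD (E_bdd mX) aL cL).
have uA : E A u = 0.
  rewrite kill // pvm_idem // (pvm_disjoint w_gt0 pvm) ?setICr //.
  by rewrite addr0 subrr.
have uC : E (~` A) u = 0.
  rewrite kill // pvm_idem // (pvm_disjoint w_gt0 pvm) ?setICl //.
  by rewrite add0r subrr.
apply/eqP; rewrite -subr_eq0 -/u; apply/eqP/(nrm_eq0 w_gt0 uL); rewrite /nrm.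
have -> : N2 u = (N2 (E A u) + N2 (E (~` A) u))%E; last first.
  by rewrite uA uC norm2sq0 add0e sqrtr0.
rewrite -[in LHS](pvm_setT pvm uL).
change (nu uL setT = nu uL A + nu uL (~` A))%E.
by rewrite -(setUv A) measureU // setICr.
Qed.

Lemma lapD f g : Lap (f + g) = Lap f + Lap g.
Proof. by rewrite !LapE BD opprD addrACA. Qed.

(** The spectral projections commute with the simple functions that approximate
    the operator on a given vector. *)
Lemma lap_offdiag A f : measurable A -> L2 f -> E A (Lap (E (~` A) f)) = 0.
Proof.
move=> mA fL; have mC := measurableC mA; set g := E (~` A) f.
have gL : L2 g by exact: (pvm_L2 w_gt0 pvm).
have lL := L2_lap gL.
have small (e : R) : 0 < e -> (N2 (E A (Lap g)) <= e%:E)%E.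
  move=> e0; have [s [_ ne]] := resolution_approx gL e0.
  have sL : L2 (fcalc E s id g) by exact: L2_fcalc.
  have -> : E A (Lap g) = E A (- (fcalc E s id g - Lap g)).
    rewrite opprB (bounded_opB w_gt0 (E_bdd mA) lL sL).
    rewrite (pvm_fcalc_comm w_gt0 pvm) // /g (pvm_disjoint w_gt0 pvm) ?setICr //.
    rewrite (_ : fcalc E s id 0 = 0) ?subr0 //; apply/funext => x.
    rewrite /fcalc fsbig1 // => c _; have mc : measurable (s @^-1` [set c]) by [].
    by rewrite (bounded_op0 (E_bdd mc)) mulr0.
  apply: le_trans ne; rewrite -[leRHS]norm2sqN.
  by apply: (pvm_contraction w_gt0 pvm) => //; apply/(L2N w_gt0)/(L2B w_gt0).
apply: (nrm_eq0 w_gt0); first exact: (pvm_L2 w_gt0 pvm).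
have n0 : N2 (E A (Lap g)) = 0%E.
  apply/le_anti; rewrite norm2sq_ge0 // andbT.
  by apply/lee_addgt0Pr => e e0; rewrite add0e small.
by rewrite /nrm n0 sqrtr0.
Qed.

Lemma lap_diag A f : measurable A -> L2 f -> E A (Lap f) = E A (Lap (E A f)).
Proof.
move=> mA fL; have mC := measurableC mA.
have aL := pvm_L2 w_gt0 pvm mA fL; have cL := pvm_L2 w_gt0 pvm mC fL.
rewrite {1}(pvm_split mA fL) lapD (bounded_opD (E_bdd mA)); try exact: L2_lap.
by rewrite lap_offdiag // addr0.
Qed.

(** A simple function close to the identity on the spectrum gives an operator
    close to the Laplacian, by summing over the level sets. *)
Lemma cell_approx s (eta : R) f : L2 f -> 0 <= eta ->
  (forall t, spectrum t -> `|t - s t| <= eta) ->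
  nrm (fcalc E s id f - Lap f) <= 2 * eta * nrm f.
Proof.
move=> fL eta0 close; have lL := L2_lap fL; have sL : L2 (fcalc E s id f) by exact: L2_fcalc.
have dL : L2 (fcalc E s id f - Lap f) by exact: L2B.
apply: (nrmP w_gt0 _ _).2; first by rewrite !mulr_ge0 ?nrm_ge0.
rewrite exprMn EFinM -norm2sqE // (pvm_partition w_gt0 pvm s dL) (pvm_partition w_gt0 pvm s fL).
rewrite !fsbig_finite //= ge0_sume_distrr; last by move=> c _; exact: norm2sq_ge0.
apply: lee_sum => c _; have mA : measurable (s @^-1` [set c]) by [].
set A := s @^-1` [set c] in mA *.
have aL := pvm_L2 w_gt0 pvm mA fL.
have -> : E A (fcalc E s id f - Lap f) =
    E A (- (Lap (E A f) - (fun x => c%:C * E A f x))).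
  have zL : L2 (fun x => c%:C * E A f x) by exact: L2Z.
  rewrite opprB !(bounded_opB w_gt0 (E_bdd mA)) //; try exact: L2_lap.
  by rewrite (bounded_opZ _ (E_bdd mA)) // pvm_idem // -lap_diag // (pvm_fcalc w_gt0 pvm).
have vL : L2 (Lap (E A f) - (fun x => c%:C * E A f x)).
  by apply: (L2B w_gt0); [exact: L2_lap|exact: L2Z].
apply: (le_trans (pvm_contraction w_gt0 pvm mA (L2N w_gt0 vL))).
rewrite norm2sqN !norm2sqE // -EFinM lee_fin -exprMn.
rewrite lerXn2r ?nnegrE ?nrm_ge0 ?mulr_ge0 ?nrm_ge0 //.
apply: (near_eigenvector (A := A `&` spectrum)) => //.
- by apply: measurableI => //; exact: m_spectrum.
- rewrite -(pvm_setI pvm) //; last exact: m_spectrum.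
  have := pvm_split m_spectrum aL; rewrite pvm_spectrum // addr0 => <-.
  exact: pvm_idem.
- by move=> t [/= st /close]; rewrite st.
Qed.

Lemma fcalc_subr s phi f g : L2 f -> L2 g ->
  fcalc E s phi f - fcalc E s phi g = fcalc E s phi (f - g).
Proof.
move=> fL gL; rewrite !fcalcE -sumrB; apply: eq_bigr => c _.
have mc : measurable (s @^-1` [set c]) by [].
rewrite (bounded_opB w_gt0 (E_bdd mc) fL gL).
by apply/funext => x; rewrite !fctE mulrBr.
Qed.

Lemma L2_iterB k f : L2 f -> L2 (iter k B f).
Proof. by move=> fL; elim: k => //= k; exact: B_L2. Qed.

Lemma nrm_iterB k f : L2 f -> nrm (iter k B f) <= nrm f.
Proof.
move=> fL; elim: k => //= k IH; apply: le_trans IH.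
by apply: B_contr; exact: L2_iterB.
Qed.

Lemma L2_polyop P f : L2 f -> L2 (polyop B P f).
Proof. by move=> fL; apply: (L2_sum w_gt0) => k; apply/(L2Z w_gt0)/L2_iterB. Qed.

Section Cells.
Variables (s : {sfun RM >-> R}) (eta : R).
Hypothesis s_range : forall t, 0 <= s t <= 2.
Hypothesis eta_ge0 : 0 <= eta.
Hypothesis s_close : forall t, spectrum t -> `|t - s t| <= eta.

(** The simple approximation of [B] is a contraction as well, so that each of the
    [k] factors contributes one error term. *)
Lemma fcalc_pow k f : L2 f ->
  nrm (fcalc E s (fun t => (1 - t) ^+ k) f - iter k B f) <= (2 * k%:R) * eta * nrm f.
Proof.
move=> fL; elim: k => [|k IH].
  by rewrite (fcalc1 w_gt0 pvm s fL) subrr nrm0 !mulr0 !mul0r.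
set v := iter k B f in IH *; have vL : L2 v by exact: L2_iterB.
set u := fcalc E s (fun t => (1 - t) ^+ k) f in IH *.
have uL : L2 u by exact: L2_fcalc.
have -> : fcalc E s (fun t => (1 - t) ^+ k.+1) f = fcalc E s (fun t => 1 - t) u.
  by rewrite (fcalcM w_gt0 pvm) //; congr fcalc; apply/funext => t; rewrite exprS.
rewrite iterS -/v; set X := fcalc E s (fun t => 1 - t).
have XE h : L2 h -> X h = h - fcalc E s id h.
  by move=> hL; rewrite -[in X in _ = X - _](fcalc1 w_gt0 pvm s hL) (fcalcB E).
have -> : X u - B v = X (u - v) - (fcalc E s id v - Lap v).
  rewrite /X -(fcalc_subr s _ uL vL) -/X (XE v vL) LapE.
  by apply/funext => x; rewrite !fctE; ring.
have XuvL : L2 (X (u - v)) by apply: L2_fcalc => //; exact: L2B.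
have dL : L2 (fcalc E s id v - Lap v).
  by apply: L2B => //; [exact: L2_fcalc|exact: L2_lap].
apply: le_trans (nrm_triangle w_gt0 XuvL (L2N w_gt0 dL)) _; rewrite nrmN.
have h1 : nrm (X (u - v)) <= 1 * nrm (u - v).
  apply: (nrm_fcalc_le w_gt0 pvm (A := setT)) => //; first exact: L2B.
    by apply: (pvm_setT pvm); exact: L2B.
  by move=> t _; rewrite ler_norml; have /andP[] := s_range t; lra.
have h2 : nrm (fcalc E s id v - Lap v) <= 2 * eta * nrm f.
  apply: le_trans (cell_approx vL eta_ge0 s_close) _.
  by rewrite ler_wpM2l ?mulr_ge0 // nrm_iterB.
rewrite -natr1; apply: le_trans (lerD h1 h2) _; lra.
Qed.

Definition poly_modulus (P : {poly R}) : R := \sum_(k < size P) `|P`_k| * (2 * k%:R).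

Lemma fcalc_poly (P : {poly R}) f : L2 f ->
  nrm (fcalc E s (fun t => P.[1 - t]) f - polyop B P f) <=
  poly_modulus P * eta * nrm f.
Proof.
move=> fL.
have -> : fcalc E s (fun t => P.[1 - t]) f =
    \sum_(k < size P) (fun x => (P`_k)%:C * fcalc E s (fun t => (1 - t) ^+ k) f x).
  apply/funext => x; rewrite fct_sumE /fcalc.
  under [RHS]eq_bigr => k _ do rewrite fsbig_finite // big_distrr /=.
  rewrite fsbig_finite //= exchange_big /=; apply: eq_bigr => c _.
  rewrite horner_coef rmorph_sum big_distrl /=; apply: eq_bigr => k _.
  by rewrite rmorphM mulrA.
have dL (k : nat) : L2 (fcalc E s (fun t => (1 - t) ^+ k) f - iter k B f).
  by apply: (L2B w_gt0); [exact: L2_fcalc|exact: L2_iterB].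
rewrite -sumrB (eq_bigr (fun k : 'I_(size P) => fun x =>
    (P`_k)%:C * (fcalc E s (fun t => (1 - t) ^+ k) f - iter k B f) x)); last first.
  by move=> k _; apply/funext => x; rewrite !fctE mulrBr.
apply: le_trans (nrm_sum w_gt0 _ _) _; first by move=> k; exact: L2Z.
rewrite /poly_modulus !big_distrl /=; apply: ler_sum => k _.
rewrite (nrmZ w_gt0 _ (dL k)) normc_real -!mulrA ler_wpM2l //.
by rewrite !mulrA; exact: fcalc_pow.
Qed.

End Cells.

Local Notation psi := (fun t : R => (Num.sqrt t)^-1).

Lemma powR_invsqrt (t : R) : 0 <= t -> t `^ (- 2^-1) = psi t.
Proof. by move=> t0; rewrite powRN powR12_sqrt. Qed.

Lemma measurable_powR_comp (s : {sfun RM >-> R}) :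
  (fun t : RM => s t `^ (- 2^-1)) \in @sfun _ RM R.
Proof.
rewrite inE /=; apply/andP; split; apply/mem_set.
  by apply: (measurableT_comp (f := fun t : R => t `^ (- 2^-1))) => //; exact: measurable_powR.
have : finite_set ((fun c : R => c `^ (- 2^-1)) @` range s) by exact: finite_image.
by apply: sub_finite_set => _ [t _ <-]; exists (s t) => //; exists t.
Qed.

Lemma invsqrt_dist (a t u : R) : 0 < a -> a <= t -> t <= u ->
  (psi t - psi u) ^+ 2 <= ((u - t) / (a * Num.sqrt a)) ^+ 2.
Proof.
move=> a0 ta tu; have t0 : 0 < t by lra. have u0 : 0 < u by lra.
have sa : 0 < Num.sqrt a by rewrite sqrtr_gt0.
have st : 0 < Num.sqrt t by rewrite sqrtr_gt0.
have su : 0 < Num.sqrt u by rewrite sqrtr_gt0.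
have sat : Num.sqrt a <= Num.sqrt t by apply: ler_wsqrtr.
have stu : Num.sqrt t <= Num.sqrt u by apply: ler_wsqrtr.
have aE : a = Num.sqrt a ^+ 2 by rewrite sqr_sqrtr ?ltW.
have tE : t = Num.sqrt t ^+ 2 by rewrite sqr_sqrtr ?ltW.
have uE : u = Num.sqrt u ^+ 2 by rewrite sqr_sqrtr ?ltW.
rewrite {1}aE {2}tE {2}uE.
move: (Num.sqrt a) (Num.sqrt t) (Num.sqrt u) sa st su sat stu {aE tE uE} => x y z x0 y0 z0 xy yz.
have -> : y^-1 - z^-1 = (z - y) / (y * z) by field; rewrite !gt_eqF.
have yz2 : y ^+ 2 <= z ^+ 2 by rewrite lerXn2r ?nnegrE ?(ltW y0) ?(ltW z0).
have lhs0 : 0 <= (z - y) / (y * z).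
  by apply: divr_ge0; rewrite ?subr_ge0 // ltW ?mulr_gt0.
have rhs0 : 0 <= (z ^+ 2 - y ^+ 2) / (x ^+ 2 * x).
  by apply: divr_ge0; rewrite ?subr_ge0 // ltW ?mulr_gt0 ?exprn_gt0.
rewrite lerXn2r ?nnegrE // ler_pdivrMr ?mulr_gt0 //.
rewrite mulrAC ler_pdivlMr ?mulr_gt0 ?exprn_gt0 //.
rewrite subr_sqr -[leRHS]mulrA ler_wpM2l ?subr_ge0 //.
have xx : x * x <= y * z by rewrite ler_pM ?(ltW x0) //; lra.
have yz0 : 0 <= y * z by rewrite ltW ?mulr_gt0.
by rewrite expr2 mulrC ler_pM ?mulr_ge0 ?(ltW x0) //; lra.
Qed.

Let cell n : {sfun RM >-> R} := projT1 (cid (cells R n)).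
Let cell_range n t : 0 <= cell n t <= 2.
Proof. by have [h _] := projT2 (cid (cells R n)); exact: h. Qed.
Let cell_le n t : 0 <= t <= 2 -> t <= cell n t <= t + n.+1%:R^-1.
Proof. by have [_ h] := projT2 (cid (cells R n)); exact: h. Qed.
Let succ_inv_ge0 n : 0 <= n.+1%:R^-1 :> R. Proof. by rewrite invr_ge0. Qed.
Let cell_close n t : spectrum t -> `|t - cell n t| <= n.+1%:R^-1.
Proof.
move=> /andP[t0 t2]; have /andP[lo hi] : t <= cell n t <= t + n.+1%:R^-1.
  by apply: cell_le; rewrite t2 ltW.
rewrite ler_norml; have := succ_inv_ge0 n.
by move: (n.+1%:R^-1) lo hi => e lo hi e0; lra.
Qed.

Local Notation approx j := (newton R j.+1).1.

(** On [[a, 2]] the Newton approximants converge uniformly. The simple functions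
    tie the resulting limit to the spectral integral, while the polynomials in
    [B] tie it to the averaging operator. *)
Lemma inv_sqrt_local (a : R) f : 0 < a <= 4^-1 -> L2 f -> E `[a, 2]%classic f = f ->
  exists g, [/\ L2 g, inv_sqrt w E f g &
    forall e : R, 0 < e -> \forall j \near \oo, nrm (polyop B (approx j) f - g) <= e].
Proof.
move=> aP fL EAf; have /andP[a0 a4] := aP.
have mA : measurable (`[a, 2]%classic : set RM) by exact: measurable_itv.
have inA t : (`[a, 2]%classic : set RM) t -> a <= t <= 2 by rewrite /= in_itv.
pose rho j := (1 - a) ^+ j.+1 / Num.sqrt a.
have rho0 j : 0 <= rho j by rewrite divr_ge0 ?sqrtr_ge0 // exprn_ge0 //; lra.
have cellA n t : (`[a, 2]%classic : set RM) t -> a <= cell n t <= 2.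
  move=> /inA/andP[ta t2]; have /andP[lo _] : t <= cell n t <= t + n.+1%:R^-1.
    by apply: cell_le; rewrite t2 andbT; lra.
  by have /andP[_ ->] := cell_range n t; rewrite andbT (le_trans ta).
pose C j := poly_modulus (approx j).
pose F j := polyop B (approx j) f; pose S n := fcalc E (cell n) psi f.
have FL j : L2 (F j) by exact: L2_polyop.
have SL n : L2 (S n) by exact: L2_fcalc.
have SF n j : nrm (S n - F j) <= (rho j + C j / n.+1%:R) * nrm f.
  have pL : L2 (fcalc E (cell n) (fun t => (approx j).[1 - t]) f) by exact: L2_fcalc.
  apply: le_trans (nrm_dist w_gt0 (SL n) pL (FL j)) _; rewrite mulrDl.
  apply: lerD; last exact: (fcalc_poly (cell_range n) (succ_inv_ge0 n) (cell_close n)).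
  rewrite (fcalcB E); apply: (nrm_fcalc_le w_gt0 pvm mA) => // t At.
  by rewrite distrC; apply: newton_cvg => //; exact: cellA.
pose r j := rho j * nrm f.
have r0 j : 0 <= r j by rewrite mulr_ge0 ?nrm_ge0.
have r_cvg : r @ \oo --> 0.
  rewrite -[X in _ --> X](mul0r (nrm f)); apply: cvgMr_tmp.
  rewrite -[X in _ --> X](mul0r (Num.sqrt a)^-1); apply: cvgMr_tmp.
  by rewrite (cvg_shiftS (fun j => (1 - a) ^+ j)); apply: cvg_expr; rewrite ger0_norm; lra.
have Fcauchy i j : nrm (F i - F j) <= r i + r j.
  apply/ler_addgt0Pr => e e0.
  have [n _ small] := near_div_succ ((C i + C j) * nrm f) e0.
  apply: le_trans (nrm_dist w_gt0 (FL i) (SL n) (FL j)) _; rewrite nrmBC.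
  apply: le_trans (lerD (SF n i) (SF n j)) _.
  rewrite [leLHS](_ : _ = r i + r j + (C i + C j) * nrm f / n.+1%:R).
    by rewrite lerD2l; exact: (small n (leqnn n)).
  by rewrite /r; ring.
have [g gL Fg] := L2_complete w_gt0 FL r_cvg Fcauchy.
have Sg (e : R) : 0 < e -> \forall n \near \oo, nrm (S n - g) <= e.
  move=> e0; have e4 : 0 < e / 4 by rewrite divr_gt0.
  have [j _ rj] : \forall j \near \oo, r j <= e / 4.
    have /cvgr0_norm_le/(_ _ e4) := r_cvg.
    by apply: filterS => j; apply: le_trans; exact: ler_norm.
  have := near_div_succ (C j * nrm f) e4; apply: filterS => n small.
  apply: le_trans (nrm_dist w_gt0 (SL n) (FL j) gL) _.
  apply: le_trans (lerD (SF n j) (Fg j)) _; rewrite mulrDl -/(r j) mulrAC.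
  by apply: three_quarters => //; exact: (rj j (leqnn j)).
exists g; split=> //; last first.
  move=> e e0; have /cvgr0_norm_le/(_ _ e0) := r_cvg.
  by apply: filterS => j rj; apply: le_trans (Fg j) (le_trans (ler_norm _) rj).
have int_cvg : (fun n => \int[nu fL]_(t in [set: RM])
    ((t `^ (- 2^-1) - cell n t `^ (- 2^-1)) ^+ 2)%:E)%E @ \oo --> 0%E.
  apply: cvge0 => [n|e e0].
    by apply: integral_ge0 => t _; rewrite lee_fin sqr_ge0.
  pose K := (a * Num.sqrt a)^-1 * nrm f.
  have K0 : 0 <= K.
    by rewrite mulr_ge0 ?nrm_ge0 // invr_ge0 mulr_ge0 ?sqrtr_ge0 // ltW.
  have := near_div_succ (K ^+ 2) e0; apply: filterS => n small.
  apply: (@le_trans _ _ ((K / n.+1%:R) ^+ 2)%:E); last first.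
    rewrite lee_fin; apply: le_trans small; rewrite exprMn ler_wpM2l ?sqr_ge0 //.
    by rewrite expr2 ler_piMr // invf_le1 // ler1n.
  have mu : measurable_fun [set: RM] (fun t : RM => (t `^ (- 2^-1) - cell n t `^ (- 2^-1)) ^+ 2).
    apply: measurable_funX; apply: measurable_funB; first exact: measurable_powR.
    by apply: (measurableT_comp (f := fun t : R => t `^ (- 2^-1))) => //; exact: measurable_powR.
  rewrite (integral_support fL mA EAf) //; last by move=> t; exact: sqr_ge0.
  rewrite (_ : (K / n.+1%:R) ^+ 2 = (n.+1%:R^-1 / (a * Num.sqrt a)) ^+ 2 * nrm f ^+ 2);
    last by rewrite /K; ring.
  rewrite [leRHS]EFinM -(norm2sqE w_gt0 fL) -(measure_support fL mA EAf).
  rewrite -(integral_cst (nu fL) mA) /=; apply: ge0_le_integral => //.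
  - by move=> t _; rewrite lee_fin sqr_ge0.
  - by apply/measurable_EFinP; exact: measurable_funTS.
  - move=> t /= At; have /andP[ta t2] := inA t At; have t0 : 0 < t by lra.
    have /andP[lo hi] : t <= cell n t <= t + n.+1%:R^-1 by apply: cell_le; rewrite t2 ltW.
    rewrite lee_fin !powR_invsqrt; [|lra|lra].
    apply: le_trans (invsqrt_dist a0 ta lo) _.
    have q0 : 0 <= (a * Num.sqrt a)^-1 by rewrite invr_ge0 mulr_ge0 ?sqrtr_ge0 // ltW.
    by rewrite lerXn2r ?nnegrE ?mulr_ge0 // ?subr_ge0 // ler_wpM2r // lerBlDl.
split=> //; exists (fun n => sfun_Sub (measurable_powR_comp (cell n))).
split; first exact: int_cvg.
apply: cvge0 => [n|e e0]; first exact: norm2sq_ge0.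
have se : 0 < Num.sqrt e by rewrite sqrtr_gt0.
apply: filterS (Sg _ se) => n small.
have -> : simple_integral E (sfun_Sub (measurable_powR_comp (cell n))) f = S n.
  rewrite (simple_integral_comp w_gt0 pvm (s := cell n) (phi := psi)) // => t /=.
  by rewrite powR_invsqrt //; case/andP: (cell_range n t).
change (N2 (S n - g)%R <= e%:E)%E.
rewrite (norm2sqE w_gt0 (L2B w_gt0 (SL n) gL)) lee_fin.
by rewrite -[leRHS](sqr_sqrtr (ltW e0)) lerXn2r ?nnegrE ?nrm_ge0 ?(ltW se).
Qed.

Lemma nrm_pvm_compl A f : measurable A -> L2 f -> f - E A f = E (~` A) f.
Proof. by move=> mA fL; rewrite {1}(pvm_split mA fL) addrC addKr. Qed.

(** As 0 carries no spectral mass, the vectors with spectral support in some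
    interval [[a, 2]] are dense. *)
Lemma inv_sqrt_dense f (e : R) : L2 f -> 0 < e -> exists f' g,
  [/\ L2 f', L2 g, nrm (f - f') <= e, inv_sqrt w E f' g &
    forall d : R, 0 < d -> \forall j \near \oo, nrm (polyop B (approx j) f' - g) <= d].
Proof.
move=> fL e0; pose a n : R := (n + 4)%:R^-1.
have aP n : 0 < a n <= 4^-1.
  by rewrite /a invr_gt0 ltr0n addnS /= lef_pV2 ?posrE ?ler_nat ?ltr0n ?addnS //; lia.
pose I n : set RM := `[a n, 2]%classic.
have mI n : measurable (I n) by exact: measurable_itv.
pose F n := ~` I n; have mF n : measurable (F n) by exact: measurableC.
have capF : \bigcap_n F n = ~` spectrum.
  rewrite /F -setC_bigcup; congr (~` _); apply/seteqP; split=> [t [n _]|t /andP[t0 t2]].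
    rewrite /I /= in_itv /= => /andP[at' t2]; rewrite /spectrum /= t2 andbT.
    by apply: lt_le_trans at'; have /andP[] := aP n.
  exists (Num.truncn t^-1) => //; rewrite /I /= in_itv /= t2 andbT /a.
  rewrite -[leRHS]invrK lef_pV2 ?posrE ?invr_gt0 ?ltr0n ?addnS //.
  apply: (le_trans (ltW (truncnS_gt _))); rewrite ler_nat.
  by rewrite addn0 ltnS; do 3 apply: leqW.
have cv : (nu fL) \o F @ \oo --> nu fL (\bigcap_n F n).
  apply: nonincreasing_cvg_mu => //.
  - apply: le_lt_trans (pvm_contraction w_gt0 pvm (mF 0%N) fL) _; exact: fL.
  - by rewrite capF; apply: measurableC; exact: m_spectrum.
  - apply/nonincreasing_seqP => n; apply/subsetPset => t; apply: contra_not.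
    rewrite /I /= !in_itv /= => /andP[at' ->]; rewrite andbT; apply: le_trans at'.
    by rewrite /a lef_pV2 ?posrE ?ltr0n ?addnS // ler_nat; lia.
have {}cv : (fun n => N2 (E (F n) f)) @ \oo --> 0%E.
  have -> : 0%E = nu fL (\bigcap_n F n); last exact: cv.
  change (0%E = N2 (E (\bigcap_n F n) f)).
  by rewrite capF pvm_spectrum // norm2sq0.
have e2 : 0 < e ^+ 2 by rewrite exprn_gt0.
have [n _ small] := cvge0_le e2 cv.
have f'L := pvm_L2 w_gt0 pvm (mI n) fL.
have [g [gL inv conv]] := inv_sqrt_local (aP n) f'L (pvm_idem (mI n) fL).
exists (E (I n) f), g; split=> //.
rewrite nrm_pvm_compl //; apply: (nrmP w_gt0 (ltW e0) _).2.
exact: (small n (leqnn n)).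
Qed.

End Resolution.

(** * The pairing of square-summable functions *)

Section Inner.
Variables (R : realType) (V : choiceType) (w : V -> R).
Hypothesis w_gt0 : forall x, 0 < w x.
Local Notation normc := Normc.normc.
Local Notation C := R[i].
Local Notation fct := (V -> C).
Implicit Types (u v : V -> R) (f g h : fct).
Local Notation L2 := (L2 w).
Local Notation nrm := (nrm w).

Let w_ge0 x : 0 <= w x. Proof. exact: ltW. Qed.

Let fin u : Prop := (forall x, 0 <= u x) /\ (\esum_(x in [set: V]) (u x)%:E < +oo)%E.
Let total u : R := fine (\esum_(x in [set: V]) (u x)%:E).

Let finE u : fin u -> (\esum_(x in [set: V]) (u x)%:E)%E = (total u)%:E.
Proof.
by case=> u0 us; rewrite fineK // ge0_fin_numE // esum_ge0 // => x _; rewrite lee_fin.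
Qed.

Let finD u v : fin u -> fin v ->
  fin (fun x => u x + v x) /\ total (fun x => u x + v x) = total u + total v.
Proof.
move=> fu fv; have e : (\esum_(x in [set: V]) (u x + v x)%:E = (total u + total v)%:E)%E.
  under eq_esum do rewrite EFinD.
  rewrite esumD ?finE // => x _; rewrite lee_fin; [exact: fu.1|exact: fv.1].
split; last by rewrite /total e.
by split=> [x|]; [rewrite addr_ge0 ?fu.1 ?fv.1|rewrite e ltry].
Qed.

Let fin_le u v : (forall x, 0 <= u x <= v x) -> fin v -> fin u.
Proof.
move=> uv [_ vs]; split=> [x|]; first by case/andP: (uv x).
by apply: esum_ltoo vs => x _; exact: uv.
Qed.

Let total_le u v : (forall x, 0 <= u x <= v x) -> fin v -> total u <= total v.
Proof.
move=> uv fv; rewrite -lee_fin -!finE //; last exact: fin_le uv fv.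
by apply: le_esum => x _; rewrite lee_fin; case/andP: (uv x).
Qed.

Let total_ge0 u : fin u -> 0 <= total u.
Proof. by case=> u0 _; rewrite fine_ge0 // esum_ge0 // => x _; rewrite lee_fin. Qed.

(** The sum does not depend on the way in which a family is written as a
    difference of nonnegative ones; additivity follows. *)
Lemma rsum_diff u v : fin u -> fin v -> rsum (fun x => u x - v x) = total u - total v.
Proof.
move=> fu fv; apply: EFin_inj.
have summ a : fin a -> summable [set: V] (EFin \o a).
  case=> a0 as'; rewrite /summable; under eq_esum => x _ do rewrite /= ger0_norm ?a0 //.
  exact: as'.
have pos : fin (fun x => Num.max (u x - v x) 0).
  apply: (fin_le _ fu) => x; rewrite le_max lexx orbT ge_max fu.1 andbT.
  by rewrite lerBlDr lerDl fv.1.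
have neg : fin (fun x => Num.max (- (u x - v x)) 0).
  apply: (fin_le _ fv) => x; rewrite le_max lexx orbT ge_max fv.1 andbT.
  by rewrite opprB lerBlDr lerDl fu.1.
transitivity (\esum_(x in [set: V]) (Num.max (u x - v x) 0)%:E -
    \esum_(x in [set: V]) (Num.max (- (u x - v x)) 0)%:E)%E.
  by rewrite (finE pos) (finE neg) -EFinB.
transitivity (\esum_(x in [set: V]) (u x)%:E - \esum_(x in [set: V]) (v x)%:E)%E; last first.
  by rewrite (finE fu) (finE fv) -EFinB.
have /= <- := esumB (summ u fu) (summ v fv)
  (fun x _ => (fu.1 x : (0 <= (EFin \o u) x)%E)) (fun x _ => (fv.1 x : (0 <= (EFin \o v) x)%E)).
by congr (_ - _)%E; apply: eq_esum => x _;
  rewrite ?funeposE ?funenegE /= EFin_max ?EFinN ?EFinB.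
Qed.

Let parts u : u = (fun x => Num.max (u x) 0 - Num.max (- u x) 0).
Proof.
apply/funext => x; have [u0|u0] := orP (le_total 0 (u x)).
  by rewrite max_l // max_r ?subr0 // oppr_le0.
by rewrite max_r // max_l ?sub0r ?opprK // oppr_ge0.
Qed.

Definition abs_summable u := fin (fun x => `|u x|).

Let fin_pos u : abs_summable u -> fin (fun x => Num.max (u x) 0).
Proof. by apply: fin_le => x; rewrite le_max lexx orbT ge_max ler_norm normr_ge0. Qed.

Let fin_neg u : abs_summable u -> fin (fun x => Num.max (- u x) 0).
Proof.
by apply: fin_le => x; rewrite le_max lexx orbT ge_max -normrN ler_norm normr_ge0.
Qed.

Lemma rsumD u v : abs_summable u -> abs_summable v ->
  rsum (fun x => u x + v x) = rsum u + rsum v.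
Proof.
move=> us vs; have [fp tp] := finD (fin_pos us) (fin_pos vs).
have [fn tn] := finD (fin_neg us) (fin_neg vs).
have -> : (fun x => u x + v x) = (fun x =>
    (Num.max (u x) 0 + Num.max (v x) 0) - (Num.max (- u x) 0 + Num.max (- v x) 0)).
  by apply/funext => x; rewrite {1}(parts u) {1}(parts v) opprD addrACA.
by rewrite (rsum_diff fp fn) tp tn opprD addrACA.
Qed.

Lemma rsum_le u v : (forall x, `|u x| <= v x) -> fin v -> `|rsum u| <= total v.
Proof.
move=> uv fv; have us : abs_summable u.
  by apply: fin_le fv => x; rewrite normr_ge0 uv.
have p := total_ge0 (fin_pos us); have n := total_ge0 (fin_neg us).
have ple : total (fun x => Num.max (u x) 0) <= total v.
  apply: total_le => // x; rewrite le_max lexx orbT ge_max (le_trans (normr_ge0 (u x))) ?uv //.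
  by rewrite (le_trans (ler_norm _)) ?uv.
have nle : total (fun x => Num.max (- u x) 0) <= total v.
  apply: total_le => // x; rewrite le_max lexx orbT ge_max (le_trans (normr_ge0 (u x))) ?uv //.
  by rewrite (le_trans (ler_norm _)) // normrN uv.
by rewrite ler_norml; change (- total v <= total (fun x => Num.max (u x) 0) -
  total (fun x => Num.max (- u x) 0) <= total v); lra.
Qed.

Lemma rsum_single u z : (forall x, x != z -> u x = 0) -> rsum u = u z.
Proof.
move=> u0; have single v : (forall x, x != z -> v x = 0) -> (forall x, 0 <= v x) ->
    fine (\esum_(x in [set: V]) (v x)%:E) = v z.
  move=> vz v0; rewrite (esumID [set z]) ?setTI; last by move=> x _; rewrite lee_fin.
  rewrite esum_set1 ?lee_fin // esum1 ?adde0 //.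
  by move=> x /= /eqP xz; rewrite vz.
rewrite /rsum !single.
- by rewrite [RHS](congr1 (fun h : V -> R => h z) (parts u)).
- by move=> x xz; rewrite u0 // oppr0 maxxx.
- by move=> x; rewrite le_max lexx orbT.
- by move=> x xz; rewrite u0 // maxxx.
- by move=> x; rewrite le_max lexx orbT.
Qed.

Lemma inner_term_le (k : R) f g : 0 < k -> forall x, normc (f x * (g x)^* * (w x)%:C) <=
  k * (normc (f x) ^+ 2 * w x) + k^-1 * (normc (g x) ^+ 2 * w x).
Proof.
move=> k0 x; rewrite !Normc.normcM normc_conj normc_real (ger0_norm (w_ge0 x)).
have := normc_ge0 (f x); have := normc_ge0 (g x).
move: (normc (f x)) (normc (g x)) => a b b0 a0.
rewrite [leRHS](_ : _ = (k * a ^+ 2 + k^-1 * b ^+ 2) * w x); last by ring.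
rewrite ler_wpM2r //.
have : 0 <= k^-1 * (k * a - b) ^+ 2 by rewrite mulr_ge0 ?sqr_ge0 ?invr_ge0 ?ltW.
have kk : k * k^-1 = 1 by rewrite divff ?gt_eqF.
have -> : k^-1 * (k * a - b) ^+ 2 =
    (k * k^-1) * (k * a ^+ 2) - (k * k^-1) * (2 * (a * b)) + k^-1 * b ^+ 2 by ring.
by rewrite kk; have := mulr_ge0 a0 b0; lra.
Qed.

Let dominating (k : R) f g : 0 < k -> L2 f -> L2 g ->
  let v x := k * (normc (f x) ^+ 2 * w x) + k^-1 * (normc (g x) ^+ 2 * w x) in
  fin v /\ total v = k * nrm f ^+ 2 + k^-1 * nrm g ^+ 2.
Proof.
move=> k0 fL gL v.
have k0' : 0 <= k by exact: ltW.
have ki0 : 0 <= k^-1 by rewrite invr_ge0.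
have e : (\esum_(x in [set: V]) (v x)%:E =
    (k * nrm f ^+ 2 + k^-1 * nrm g ^+ 2)%:E)%E.
  transitivity (\esum_(x in [set: V]) (k%:E * (normc (f x) ^+ 2 * w x)%:E +
      k^-1%:E * (normc (g x) ^+ 2 * w x)%:E))%E; first by apply: eq_esum.
  rewrite esumD; last 2 first.
  - by move=> x _; apply: mule_ge0; [rewrite lee_fin|exact: (mass_ge0 w_gt0)].
  - by move=> x _; apply: mule_ge0; [rewrite lee_fin|exact: (mass_ge0 w_gt0)].
  rewrite !esumZ //; try (by move=> x _; exact: (mass_ge0 w_gt0)).
  by rewrite -/(norm2sq w f) -/(norm2sq w g) (norm2sqE w_gt0 fL) (norm2sqE w_gt0 gL).
split; last by rewrite /total e.
split=> [x|]; last by rewrite e ltry.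
by rewrite addr_ge0 // mulr_ge0 // mulr_ge0 ?sqr_ge0.
Qed.

Let inner_summable f g : L2 f -> L2 g ->
  abs_summable (fun x => complex.Re (f x * (g x)^* * (w x)%:C)) /\
  abs_summable (fun x => complex.Im (f x * (g x)^* * (w x)%:C)).
Proof.
move=> fL gL; have [fv _] := dominating ltr01 fL gL.
split; apply: (fin_le _ fv) => x; rewrite normr_ge0 /=;
  apply: le_trans (inner_term_le f g ltr01 x); [exact: normc_Re|exact: normc_Im].
Qed.

Lemma innerD f g h : L2 f -> L2 g -> L2 h -> inner w (f + g) h = inner w f h + inner w g h.
Proof.
move=> fL gL hL; have [rf jf] := inner_summable fL hL.
have [rg jg] := inner_summable gL hL.
rewrite /inner /csum; transitivity
   ((rsum (fun x => complex.Re (f x * (h x)^* * (w x)%:C)) +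
     rsum (fun x => complex.Re (g x * (h x)^* * (w x)%:C))) +i*
    (rsum (fun x => complex.Im (f x * (h x)^* * (w x)%:C)) +
     rsum (fun x => complex.Im (g x * (h x)^* * (w x)%:C)))); last by [].
rewrite -(rsumD rf rg) -(rsumD jf jg).
by congr Complex; congr rsum; apply/funext => x; rewrite fctE !mulrDl raddfD.
Qed.

Lemma inner0 h : inner w 0 h = 0.
Proof.
rewrite /inner /csum; have z (u : V -> R) : (forall x, u x = 0) -> rsum u = 0.
  move=> u0; rewrite /rsum !esum1 ?subrr // => x _; by rewrite u0 ?oppr0 maxxx.
by rewrite !z // => x; rewrite !mul0r.
Qed.

Lemma inner_sum (I : Type) (r : seq I) (F : I -> fct) h : (forall i, L2 (F i)) -> L2 h ->
  inner w (\sum_(i <- r) F i) h = \sum_(i <- r) inner w (F i) h.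
Proof.
move=> FL hL; elim: r => [|i r IH]; first by rewrite !big_nil inner0.
by rewrite !big_cons innerD ?IH //; exact: (L2_sum w_gt0).
Qed.

Lemma innerN f h : L2 f -> L2 h -> inner w (- f) h = - inner w f h.
Proof.
move=> fL hL; apply/eqP; rewrite -addr_eq0 -innerD ?addNr ?inner0 //.
exact: (L2N w_gt0).
Qed.

(** A Cauchy-Schwarz inequality with a free weight: a small second factor may be
    traded against a large first one. *)
Lemma inner_bound (k : R) f g : 0 < k -> L2 f -> L2 g ->
  normc (inner w f g) <= 2 * (k * nrm f ^+ 2 + k^-1 * nrm g ^+ 2).
Proof.
move=> k0 fL gL; have [fv tv] := dominating k0 fL gL.
have re : `|complex.Re (inner w f g)| <= k * nrm f ^+ 2 + k^-1 * nrm g ^+ 2.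
  rewrite -tv; apply: rsum_le => // x.
  exact: le_trans (normc_Re _) (inner_term_le f g k0 x).
have im : `|complex.Im (inner w f g)| <= k * nrm f ^+ 2 + k^-1 * nrm g ^+ 2.
  rewrite -tv; apply: rsum_le => // x.
  exact: le_trans (normc_Im _) (inner_term_le f g k0 x).
apply: le_trans (_ : normc (inner w f g) <=
  `|complex.Re (inner w f g)| + `|complex.Im (inner w f g)|) _; last by lra.
case: (inner w f g) => a b.
rewrite [leLHS](_ : _ = normc (a%:C + 0 +i* b)); last by simpc.
apply: le_trans (normc_triangle _ _) _; rewrite normc_real lerD2l /=.
by rewrite expr0n add0r sqrtr_sqr.
Qed.

Lemma inner_single f g z : (forall x, x != z -> f x = 0) ->
  inner w f g = f z * (g z)^* * (w z)%:C.
Proof.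
move=> f0; rewrite /inner /csum !(rsum_single (z := z)).
- by case: (_ * _).
- by move=> x xz; rewrite f0 // !mul0r.
- by move=> x xz; rewrite f0 // !mul0r.
Qed.

End Inner.

(** * The adjoint as a limit of explicit kernels *)

Section Adjoint.
Variables (R : realType) (V : choiceType) (q : nat) (p : V -> V) (w : V -> R).
Hypothesis q_gt0 : (0 < q)%N.
Hypothesis w_gt0 : forall x, 0 < w x.
Hypothesis w_pred : forall x, w (p x) = q%:R * w x.
Hypothesis fibreP : forall x,
  finite_set (p @^-1` [set x]) /\ #|` fset_set (p @^-1` [set x])| = q.
Local Notation normc := Normc.normc.
Local Notation C := R[i].
Local Notation fct := (V -> C).
Variables (eps : fct) (M : R).
Hypothesis M_ge0 : 0 <= M.
Hypothesis eps_le : forall x, normc (eps x) <= M.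
Hypothesis eps_sum : forall x, \sum_(y \in p @^-1` [set x]) eps y = 0.
Implicit Types f g h u : fct.
Local Notation L2 := (L2 w).
Local Notation nrm := (nrm w).
Local Notation avg := (avg q p).
Local Notation avgop := (avgop q p).
Local Notation tower := (tower q p eps).
Local Notation cotower := (cotower p eps).

Definition delta z : fct := fun x => (x == z)%:R.

Lemma avg_delta z : avg (delta z) = (fun x => (q%:R^-1)%:C * delta (p z) x).
Proof.
apply/funext => x; rewrite (avgE fibreP); congr (_ * _); rewrite /delta.
have [xz|xz] := eqVneq x (p z).
  rewrite (bigD1_seq z) ?fset_uniq ?(in_fibre fibreP) ?xz //= eqxx big1 ?addr0 //.
  by move=> y /negPf ->.
rewrite big1_seq // => y /=; rewrite (in_fibre fibreP) => /eqP yx.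
by case: eqP => // yz; rewrite -yx yz eqxx in xz.
Qed.

Lemma iter_avg_delta n z : iter n avg (delta z) =
  (fun x => (q%:R^-1 ^+ n)%:C * delta (iter n p z) x).
Proof.
elim: n => [|n IH]; first by apply/funext => x; rewrite /= mul1r.
rewrite /= IH (avgZ fibreP) avg_delta; apply/funext => x.
by rewrite mulrA exprSr rmorphM.
Qed.

Lemma tower_delta n z : tower n (delta z) = (fun x =>
  ((q%:R^-1 ^+ n.+1)%:C * eps (iter n p z)) * delta (iter n.+1 p z) x).
Proof.
rewrite /tower iter_avg_delta.
have -> : (fun x => eps x * ((q%:R^-1 ^+ n)%:C * delta (iter n p z) x)) =
    (fun x => ((q%:R^-1 ^+ n)%:C * eps (iter n p z)) * delta (iter n p z) x).
  apply/funext => x; rewrite /delta; case: eqP => [->|_]; last by rewrite !mulr0.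
  by rewrite !mulr1 mulrC.
rewrite (avgZ fibreP) avg_delta; apply/funext => x.
by rewrite iterS exprSr rmorphM; ring.
Qed.

Lemma L2_delta z : L2 (delta z).
Proof.
rewrite /Defs.L2 /norm2sq (esumID [set z]) ?setTI; last by move=> x _; exact: mass_ge0.
rewrite esum_set1; last exact: (mass_ge0 w_gt0).
rewrite esum1 ?adde0 ?ltry // => x /= /eqP/negPf xz.
by rewrite /delta xz Normc.normc0 expr0n mul0r.
Qed.

(** Testing against point masses identifies the adjoint kernel. *)
Lemma inner_tower_delta (c : nat -> R) N z g : L2 g ->
  inner w (\sum_(n < N) (fun x => (c n)%:C * tower n (delta z) x)) g =
  (cotower c N g z)^* * (w z)%:C.
Proof.
move=> gL; rewrite (inner_sum w_gt0) //; last first.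
  move=> n; apply: (L2Z w_gt0); rewrite tower_delta; apply: (L2Z w_gt0); exact: L2_delta.
rewrite /cotower rmorph_sum big_distrl /=; apply: eq_bigr => n _.
rewrite (@inner_single _ _ w _ g (iter n.+1 p z)); last first.
  by move=> x /negPf xz; rewrite tower_delta /delta xz !mulr0.
rewrite tower_delta /delta -iterS eqxx mulr1 (w_iter w_pred) !rmorphM /= conjCK.
have -> : Num.conj (c n)%:C = (c n)%:C by apply: conj_Creal; rewrite complex_real.
have qq : (q%:R^-1 ^+ n.+1)%:C * (q%:R ^+ n.+1)%:C = 1 :> C.
  by rewrite -rmorphM -exprMn mulVf ?expr1n // pnatr_eq0 -lt0n.
set A := (_ ^+ _)%:C in qq *; set A' := (_ ^+ _)%:C in qq *.
rewrite -[RHS]mul1r -qq; ring.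
Qed.

Variables (E : opmeasure R V) (Lap Reps Rstar : fct -> fct).
Hypothesis q_ge2 : (2 <= q)%N.
Hypothesis LapE : forall f, Lap f = f - avgop f.
Hypothesis E_res : spectral_resolution w Lap E.
Hypothesis Reps_bdd : bounded_operator w Reps.
Hypothesis RepsE : forall f g, inv_sqrt w E f g -> Reps f = tower 0 g.
Hypothesis Reps_adj : is_adjoint w Reps Rstar.

Let coef j : nat -> R := ballot_coef (newton R j.+1).1.
Let deg j := size (newton R j.+1).1.
Let T j f : fct := \sum_(n < deg j) (fun x => (coef j n)%:C * tower n f x).

Lemma coef_bound j n : 0 <= coef j n <= 4 / n.+1%:R.
Proof.
by apply: ballot_coef_bound => k; [exact: (newton_nneg _ _).1|exact: newton_coef_le].
Qed.

Let TE j f : T j f = tower 0 (polyop avgop (newton R j.+1).1 f).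
Proof.
apply/funext => x.
by rewrite (tower_polyop q_gt0 fibreP eps_sum) /T fct_sumE.
Qed.

Let towerB n f g : tower n (f - g) = tower n f - tower n g.
Proof. by rewrite towerD // -!fctZN1 towerZ. Qed.

Let TB j f g : T j (f - g) = T j f - T j g.
Proof.
rewrite /T -sumrB; apply: eq_bigr => n _; rewrite towerB.
by apply/funext => x; rewrite !fctE mulrBr.
Qed.

Let L2tower n f : L2 f -> L2 (tower n f).
Proof. exact: (L2_tower q_gt0 w_gt0 w_pred fibreP M_ge0 eps_le). Qed.

Let L2T j f : L2 f -> L2 (T j f).
Proof. by move=> fL; apply: (L2_sum w_gt0) => n; apply/(L2Z w_gt0)/L2tower. Qed.

Let nrmT j f : L2 f -> nrm (T j f) <= (16 + M ^+ 2) * nrm f.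
Proof.
move=> fL; apply: (nrm_sum_tower q_gt0 w_gt0 w_pred fibreP M_ge0 eps_le eps_sum) => //.
exact: coef_bound.
Qed.

Let nrm_tower0 f : L2 f -> nrm (tower 0 f) <= M * nrm f.
Proof.
move=> fL; rewrite -(ler_pXn2r (n := 2)) ?nnegrE ?mulr_ge0 ?nrm_ge0 // exprMn.
apply: le_trans (nrm_tower q_gt0 w_gt0 w_pred fibreP M_ge0 eps_le eps_sum 0 fL) _.
by rewrite ler_wpM2l ?sqr_ge0 // lerBlDr lerDl sqr_ge0.
Qed.

(** The approximations converge on the dense domain of the inverse square root
    and are uniformly bounded. *)
Lemma riesz_approx f (e : R) : L2 f -> 0 < e ->
  \forall j \near \oo, nrm (T j f - Reps f) <= e.
Proof.
move=> fL e0; have [_ [K RepsK]] := Reps_bdd.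
pose K1 := `|K| + (16 + M ^+ 2) + M + 1; have K0 : 0 < K1.
  by rewrite ltr_wpDl // !addr_ge0 ?sqr_ge0.
have d0 : 0 < e / 2 / K1 by rewrite !divr_gt0.
have nrmR h : L2 h -> nrm (Reps h) <= `|K| * nrm h.
  move=> hL; apply: (nrmP w_gt0 _ _).2; first by rewrite mulr_ge0 ?nrm_ge0.
  apply: le_trans (RepsK h hL) _.
  by rewrite (norm2sqE w_gt0 hL) -EFinM exprMn real_normK ?num_real.
have [f' [g [f'L gL close inv conv]]] := inv_sqrt_dense w_gt0
  (L2_avgop q_gt0 w_gt0 w_pred fibreP) (nrm_avgop q_gt0 w_gt0 w_pred fibreP)
  (avgopD fibreP) (fun h => avgop_fixed q_gt0 w_gt0 w_pred fibreP q_ge2)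
  LapE E_res fL d0.
have := conv _ d0; apply: filterS => j near_g.
have RL h : L2 h -> L2 (Reps h) by exact: bounded_L2.
have PL : L2 (polyop avgop (newton R j.+1).1 f').
  apply: (L2_sum w_gt0) => k; apply: (L2Z w_gt0).
  by elim: (k : nat) => //= i; exact: (L2_avgop q_gt0 w_gt0 w_pred fibreP).
have dL : L2 (f - f') by exact: L2B.
have split3 : T j f - Reps f =
    T j (f - f') + (tower 0 (polyop avgop (newton R j.+1).1 f' - g) - Reps (f - f')).
  rewrite TB towerB -TE (bounded_opB w_gt0 Reps_bdd fL f'L) -(RepsE inv).
  by apply/funext => x; rewrite !fctE; ring.
rewrite split3; have bL : L2 (tower 0 (polyop avgop (newton R j.+1).1 f' - g)).
  by apply: L2tower; exact: L2B.
apply: le_trans (nrm_triangle w_gt0 (L2T j dL) (L2B w_gt0 bL (RL _ dL))) _.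
apply: le_trans (lerD (nrmT j dL) (nrm_triangle w_gt0 bL (L2N w_gt0 (RL _ dL)))) _.
rewrite nrmN.
have h1 := nrm_tower0 (L2B w_gt0 PL gL); have h2 := nrmR _ dL.
set y := e / 2 / K1 in near_g close d0.
have h3 : (16 + M ^+ 2) * nrm (f - f') <= (16 + M ^+ 2) * y.
  by rewrite ler_wpM2l // addr_ge0 ?sqr_ge0.
have h4 : M * nrm (polyop avgop (newton R j.+1).1 f' - g) <= M * y by rewrite ler_wpM2l.
have h5 : `|K| * nrm (f - f') <= `|K| * y by rewrite ler_wpM2l.
have K1y : K1 * y = e / 2 by rewrite /y mulrC divfK // gt_eqF.
apply: (@le_trans _ _ (K1 * y)); last by rewrite K1y ler_pdivrMr // mulr_natr mulr2n lerDl ltW.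
have y0 : 0 <= y by exact: ltW.
move: h1 h2 h3 h4 h5 y0; rewrite /K1.
move: (nrm (f - f')) (nrm (Reps _)) (nrm (tower 0 _)) (nrm (_ - g)) => a b c d.
move: ((16 + _) * a) (M * d) (`|K| * a) => aa dd bb; lra.
Qed.

(** Pairing with the point mass at [z] turns strong convergence of the operators
    into convergence at [z] of the adjoints. *)
Lemma adjoint_approx g z (e : R) : L2 g -> 0 < e ->
  \forall j \near \oo, normc (cotower (coef j) (deg j) g z - Rstar g z) <= e.
Proof.
move=> gL e0; have dL := L2_delta z.
have RdL : L2 (Reps (delta z)) by exact: (bounded_L2 w_gt0 Reps_bdd).
pose t := e * w z; have t0 : 0 < t by rewrite mulr_gt0.
(* the weight [k] makes the contribution of [g] to the bound at most [t / 2] *)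
pose k := 4 * (nrm g ^+ 2 + 1) / t.
have g2 : 0 <= nrm g ^+ 2 by exact: sqr_ge0.
have k0 : 0 < k by rewrite divr_gt0 // mulr_gt0 // ltr_wpDl.
pose D := t / (4 * k); have D0 : 0 < D by rewrite divr_gt0 // mulr_gt0.
have m0 : 0 < Num.min 1 D by rewrite lt_min ltr01.
have := riesz_approx dL m0; apply: filterS => j near_T.
have TdL := L2T j dL; have dfL := L2B w_gt0 TdL RdL.
have pairing : inner w (T j (delta z) - Reps (delta z)) g =
    Num.conj (cotower (coef j) (deg j) g z - Rstar g z) * (w z)%:C.
  rewrite (innerD w_gt0 TdL (L2N w_gt0 RdL) gL) (innerN w_gt0 RdL gL).
  rewrite (Reps_adj.2 _ _ dL gL) (inner_tower_delta _ _ _ gL).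
  rewrite (@inner_single _ _ w _ (Rstar g) z); last first.
    by move=> x /negPf xz; rewrite /delta xz.
  by rewrite /delta eqxx mul1r rmorphB mulrBl.
rewrite -(ler_pM2r (w_gt0 z)).
have -> : normc (cotower (coef j) (deg j) g z - Rstar g z) * w z =
    normc (inner w (T j (delta z) - Reps (delta z)) g).
  by rewrite pairing Normc.normcM normc_conj normc_real gtr0_norm.
apply: le_trans (inner_bound w_gt0 k0 dfL gL) _; rewrite -/t.
set n := nrm _ in near_T *; have n0 : 0 <= n by exact: nrm_ge0.
have nD : n ^+ 2 <= D.
  move: near_T; rewrite le_min => /andP[n1 nD]; apply: le_trans nD.
  by rewrite expr2 ler_piMr.
have h1 : k * n ^+ 2 <= t / 4.
  apply: le_trans (ler_wpM2l (ltW k0) nD) _; rewrite /D le_eqVlt; apply/orP; left.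
  by apply/eqP; field; rewrite gt_eqF.
have h2 : k^-1 * nrm g ^+ 2 <= t / 4.
  have -> : t / 4 = k^-1 * (nrm g ^+ 2 + 1).
    by rewrite /k; field; rewrite !gt_eqF // ltr_wpDl.
  by rewrite ler_wpM2l ?invr_ge0 ?(ltW k0) // lerDl.
by lra.
Qed.

(** The weak type estimate is uniform in the approximations and only involves
    finite sets of points, hence it passes to their pointwise limit. *)
Lemma adjoint_weak_type (lambda : R) g : 0 < lambda -> L2 g ->
  (wmeasure w [set x | (lambda < normc (Rstar g x))%R] <=
    ((1 + 64 * M ^+ 2) * lambda^-1)%:E * norm1 w g)%E.
Proof.
move=> l0 gL; apply: ge_ereal_sup => _ [X [finX subX] <-].
have [j /= near_j] : exists j, forall x, x \in (fset_set X : seq V) ->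
    lambda < normc (cotower (coef j) (deg j) g x).
  have : \forall j \near \oo, forall x, x \in (fset_set X : seq V) ->
      lambda < normc (cotower (coef j) (deg j) g x).
    have : {subset (fset_set X : seq V) <= [pred x | lambda < normc (Rstar g x)]}.
      move=> x; change (x \in fset_set X -> lambda < normc (Rstar g x)).
      by rewrite in_fset_set // => /set_mem /subX.
    elim: (enum_fset (fset_set X)) => [_|x s IH xs]; first by apply: nearW => j y; rewrite in_nil.
    have lx : lambda < normc (Rstar g x) by apply: xs; rewrite mem_head.
    have := IH (fun y ys => xs y (mem_behead (s := x :: s) ys)).
    have d0 : 0 < (normc (Rstar g x) - lambda) / 2 by rewrite divr_gt0 ?subr_gt0.
    have := adjoint_approx x gL d0; apply: filterS2 => j hx hs y.
    rewrite inE => /orP[/eqP ->|]; last exact: hs.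
    set a := cotower _ _ _ _ in hx *.
    have : normc (Rstar g x) <= normc (a - Rstar g x) + normc a.
      rewrite -{1}[Rstar g x](subrK a) (le_trans (normc_triangle _ _)) // lerD2r.
      by rewrite -[leLHS]normcN opprB.
    move: (normc _) (normc a) (normc (Rstar g x)) hx lx => b c d hx lx; lra.
  by case=> N _ /(_ N (leqnn N)) ?; exists N.
apply: le_trans (cotower_weak_type q_gt0 w_gt0 w_pred fibreP M_ge0 eps_le eps_sum
  (deg j) g l0 (coef_bound j)).
apply: esum_ge; exists X => //; split=> // x Xx.
by apply: near_j; rewrite in_fset_set // mem_set.
Qed.

End Adjoint.

(** * The weak type bound on the tree *)

(** With the square roots of the masses, the adjacency sum of the Laplacian is
    the sum of the contribution of the predecessor and of those of the
    successors with equal weights. *)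
Lemma flow_laplacianE (R : realType) (q : nat) (V : choiceType) (adj : rel V)
    (omega : nat -> V) (p : V -> V) :
  (0 < q)%N ->
  (forall x, [set y | adj x y] = p x |` successors adj omega x /\
     ~ successors adj omega x (p x)) ->
  (forall x, successors adj omega x = p @^-1` [set x]) ->
  (forall x, finite_set (p @^-1` [set x]) /\
     #|` fset_set (p @^-1` [set x])|%fset = q) ->
  (forall x, flow_measure R q adj omega (p x) =
     q%:R * flow_measure R q adj omega x) ->
  forall f : V -> R[i], flow_laplacian q adj omega f = f - avgop q p f.
Proof.
move=> q0 nbr succ fibreP mu_pred f; apply/funext => x.
have mu_gt0 y : 0 < flow_measure R q adj omega y by rewrite exprz_gt0 // ltr0n.
have qR : 0 < q%:R :> R by rewrite ltr0n.
have s_gt0 : 0 < Num.sqrt q%:R :> R by rewrite sqrtr_gt0.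
have ratio y : Num.sqrt (flow_measure R q adj omega (p y)) /
    Num.sqrt (flow_measure R q adj omega y) = Num.sqrt q%:R.
  by rewrite mu_pred sqrtrM ?ler0n // mulfK // gt_eqF // sqrtr_gt0.
have [fin _] := fibreP x; rewrite /flow_laplacian (nbr x).1.
rewrite fsbig_finite; last first.
  by rewrite finite_setU; split; [exact: finite_set1|rewrite succ].
rewrite fset_setU1 ?succ // big_fsetU1 /=; last first.
  by rewrite (in_fibre fibreP); apply/eqP => e; apply: (nbr x).2; rewrite succ.
rewrite ratio (eq_big_seq (fun y => (Num.sqrt q%:R)^-1%:C * f y)); last first.
  move=> y; rewrite (in_fibre fibreP) => /eqP <-.
  by rewrite -invf_div ratio.
rewrite -big_distrr /= !fctE; congr (_ - _).
rewrite /avgop /halve fctE (avgE fibreP) /pull !mulrDr.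
rewrite !mulrA -!rmorphM /=; congr (_%:C * _ + _%:C * _).
  by field; rewrite gt_eqF.
by rewrite -{3}(sqr_sqrtr (ltW qR)); field; rewrite gt_eqF.
Qed.

Theorem theorem5p5 (R : realType) (q : nat) (V : choiceType) (adj : rel V)
    (omega : nat -> V) (eps : V -> R[i]) (E : opmeasure R V)
    (Reps Rstar : (V -> R[i]) -> (V -> R[i])) :
  let mu := flow_measure R q adj omega in
  (2 <= q)%N ->
  homogeneous_tree adj q ->
  geodesic_ray adj omega ->
  (exists M : R, forall x, Normc.normc (eps x) <= M) ->
  (forall x, \sum_(y \in successors adj omega x) eps y = 0) ->
  spectral_resolution mu (flow_laplacian q adj omega) E ->
  horizontal_riesz q adj omega eps E Reps ->
  is_adjoint mu Reps Rstar ->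
  exists K : R, forall lambda : R, 0 < lambda ->
    forall f : V -> R[i], L1 mu f -> L2 mu f ->
      (wmeasure mu [set x | (lambda < Normc.normc (Rstar f x))%R]
         <= (K * lambda^-1)%:E * norm1 mu f)%E.
Proof.
move=> mu q2 tree ray [M eps_le] eps_sum E_res [Reps_bdd RepsE] Reps_adj.
have q0 : (0 < q)%N by exact: ltnW.
have [p [nbr succ succ_card mu_pred]] := flow_structure R tree ray.
have fibreP x : finite_set (p @^-1` [set x]) /\
    #|` fset_set (p @^-1` [set x])|%fset = q by rewrite -succ.
have mu_gt0 x : 0 < mu x by rewrite exprz_gt0 // ltr0n.
have M0 : 0 <= M by apply: le_trans (eps_le (omega 0%N)); exact: normc_ge0.
exists (1 + 64 * M ^+ 2) => lambda l0 f _ fL2.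
have LapE := flow_laplacianE q0 nbr succ fibreP (mu_pred q0).
apply: (adjoint_weak_type q0 mu_gt0 (mu_pred q0) fibreP M0 eps_le _ q2 LapE E_res
  Reps_bdd _ Reps_adj l0 fL2) => [x|g h /RepsE ->]; first by rewrite -succ.
by apply/funext => x; rewrite /nabla_eps succ.
Qed.
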